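(* Let $Y$ be a connected, locally path connected, first countable, Hausdorff topological space and let $S\subset Y$ be a skeletal subset such that $Y\setminus S$ is semi-locally simply connected. Let $y_0\in Y\setminus S$ and let $\Omega:=\bigcup_{y\in Y}\Omega(y_0,y,Y\setminus S)$, endowed with the compact-open topology. Let $X$ be the set of almost homotopy classes of $\Omega$ with respect to $Y\setminus S$ (endowed with the quotient topology) and let $\varphi:\Omega\to Y$, $\gamma\mapsto\gamma(1)$. Then $\varphi$ induces a branched covering $\overline\varphi:X\to Y$ which is isomorphic to the universal covering $\widetilde Y^S\to Y$ possibly branched over $S$.
   Context: All topological spaces are Hausdorff, locally path connected and first countable. A subset $D$ of a space $X$ is locally connected in $X$ if $U\cap D$ is connected for every open connected $U\subset X$. A subset is portly in $X$ if it is open, dense and locally connected in $X$; a subset is skeletal if its complement is portly. A spread $p:X\to Y$ is a continuous map such that the connected components of preimages $p^{-1}(U)$ of open subsets $U\subset Y$ generate the topology of $X$. It is complete if for every $y\in\overline{p(X)}$ and every inclusion-increasing assignment $\chi$ associating to each open connected neighborhood $U$ of $y$ a connected component $\chi(U)$ of $p^{-1}(U)$, one has $\bigcap_U\chi(U)\neq\emptyset$. A completion of a spread $X\to Y$ is a complete spread $X'\to Y$ with an embedding $X\to X'$ over $Y$ whose image is open, dense and locally connected in $X'$; every spread has a completion, unique up to isomorphism. The ordinary locus $\mathrm{Ord}(Y)$ is the set of $y\in Y$ having an open neighborhood $U$ such that each connected component of $p^{-1}(U)$ is mapped homeomorphically onto $U$ by $p$, and $\mathrm{Ord}(X)=p^{-1}(\mathrm{Ord}(Y))$.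 A branched covering is a complete surjective spread $X\to Y$ with $X,Y$ connected and $\mathrm{Ord}(X)$, $\mathrm{Ord}(Y)$ portly in $X$, $Y$. It is possibly branched over $S$ if $Y\setminus\mathrm{Ord}(Y)\subset S$. Isomorphism of branched coverings of $Y$ means homeomorphism of total spaces commuting with the projections to $Y$. A space $Z$ is semi-locally simply connected if every point $z$ has a neighborhood $U$ such that every loop in $U$ based at $z$ is null-homotopic in $Z$. When $S$ is skeletal in connected $Y$ and $Y\setminus S$ is semi-locally simply connected, the universal covering $\widetilde Y^S\to Y$ possibly branched over $S$ is the completion of the spread $\widetilde{Y\setminus S}\to Y$, where $\widetilde{Y\setminus S}$ is the universal covering of $Y\setminus S$. For an open subset $U$ of a space $Z$ and $x,y\in\overline U$, $\Omega(x,y,U)$ is the set of paths $\gamma:[0,1]\to Z$ with $\gamma(0)=x$, $\gamma(1)=y$, $\gamma(]0,1[)\subset U$; two such paths are homotopic in $\Omega(x,y,U)$ if there is a fixed-ends homotopy $H$ between them with $H([0,1]\times]0,1[)\subset U$. A loop $\gamma\in\Omega(x,x,U)$ is almost trivial with respect to $U$ if for every open neighborhood $V$ of $x$ it is homotopic in $\Omega(x,x,U)$ to an element of $\Omega(x,x,V\cap U)$. Two paths $\gamma_1,\gamma_2\in\Omega(x,y,U)$, with $x\in U$, $y\in\overline U$, are almost homotopic with respect to $U$ if the loop based at $y$ which follows $\gamma_1$ backwards from $y$ to $x$ and then $\gamma_2$ from $x$ to $y$ is almost trivial with respect to $U$; this is an equivalence relation. *)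

(* Defs.v *)
From HB Require Import structures.
From mathcomp Require Import all_boot all_order all_algebra.
From mathcomp Require Import generic_quotient.
From mathcomp Require Import all_classical all_reals all_analysis.

Set Implicit Arguments.
Unset Strict Implicit.
Unset Printing Implicit Defensive.

Import Order.TTheory GRing.Theory Num.Theory numFieldNormedType.Exports.

Local Open Scope classical_set_scope.
Local Open Scope ring_scope.

Definition unit_interval (R : realType) : Type := set_type `[0 : R, 1]%classic.

HB.instance Definition _ (R : realType) := Topological.on (unit_interval R).

Section unit_interval.
Variable R : realType.
Local Notation I := (unit_interval R).

Lemma unit_interval_zero_subproof : (0 : R) \in `[0 : R, 1]%classic.
Proof. by rewrite inE /= in_itv /= lexx ler01. Qed.

Lemma unit_interval_one_subproof : (1 : R) \in `[0 : R, 1]%classic.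
Proof. by rewrite inE /= in_itv /= lexx ler01. Qed.

Let zeroI : I := exist _ 0 unit_interval_zero_subproof.
Let oneI : I := exist _ 1 unit_interval_one_subproof.

Let zeroI_neq_oneI : zeroI != oneI.
Proof. by apply/eqP => /(congr1 val) /= /eqP; rewrite eq_sym oner_eq0. Qed.

HB.instance Definition _ := isBiPointed.Build I zeroI_neq_oneI.

(* The point [x] of the interval; the value [zero] taken when [x] lies outside
   of [0, 1] is never used below. *)
Definition to_unit_interval (x : R) : I := insubd zeroI x.

End unit_interval.

Section paths.
Variables (R : realType) (Z : topologicalType).
Local Notation I := (unit_interval R).
Implicit Types (g : I -> Z) (U V : set Z) (x y z : Z).

Definition is_path x y g := [/\ continuous g, g zero = x & g one = y].

(* Omega(x, y, U); that x and y are in the closure of U is automatic. *)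
Definition path_through x y U g :=
  is_path x y g /\ forall t : I, 0 < val t < 1 -> U (g t).

(* Homotopy in Omega(x, y, U), where x and y are the ends of [g1] and [g2];
   the first variable of [H] is the parameter of the deformation. *)
Definition homotopic_through U g1 g2 := exists H : I * I -> Z,
  [/\ continuous H,
      forall t, H (zero, t) = g1 t,
      forall t, H (one, t) = g2 t,
      forall s, H (s, zero) = g1 zero /\ H (s, one) = g1 one
    & forall s t : I, 0 < val t < 1 -> U (H (s, t))].

Definition null_homotopic z g := homotopic_through setT g (cst z).

Definition reverse_path g : I -> Z := fun t => g (to_unit_interval (1 - val t)).

Definition concat_path g1 g2 : I -> Z := fun t =>
  if val t <= 2^-1 then g1 (to_unit_interval (2 * val t))
  else g2 (to_unit_interval (2 * val t - 1)).

Definition almost_trivial U x g :=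
  path_through x x U g /\
  forall V, open V -> V x ->
    exists2 g', path_through x x (V `&` U) g' & homotopic_through U g g'.

Definition almost_homotopic U g1 g2 :=
  g1 one = g2 one /\
  almost_trivial U (g1 one) (concat_path (reverse_path g1) g2).

Definition path_connected_set V := forall x y, V x -> V y ->
  exists2 g, is_path x y g & forall t, V (g t).

End paths.

Definition first_countable (T : topologicalType) :=
  forall x : T, exists B : nat -> set T,
    (forall n, nbhs x (B n)) /\
    forall U, nbhs x U -> exists n, B n `<=` U.

Definition locally_path_connected (R : realType) (T : topologicalType) :=
  forall (x : T) (U : set T), nbhs x U ->
    exists V : set T, [/\ open V, V x, V `<=` U & path_connected_set R V].

Definition admissible_space (R : realType) (T : topologicalType) :=
  [/\ hausdorff_space T, locally_path_connected R T & first_countable T].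

Definition semi_locally_simply_connected (R : realType) (Z : topologicalType) :=
  forall z : Z, exists2 U : set Z, nbhs z U &
    forall g : unit_interval R -> Z,
      is_path z z g -> (forall t, U (g t)) -> null_homotopic z g.

Definition simply_connected (R : realType) (Z : topologicalType) :=
  path_connected_set R [set: Z] /\
  forall (z : Z) (g : unit_interval R -> Z), is_path z z g -> null_homotopic z g.

Definition locally_connected_in (X : topologicalType) (D : set X) :=
  forall U : set X, open U -> connected U -> connected (U `&` D).

Definition portly (X : topologicalType) (D : set X) :=
  [/\ open D, dense D & locally_connected_in D].

Definition skeletal (X : topologicalType) (D : set X) := portly (~` D).

(* The components of [A] as nonempty sets: in the library,
   [connected_component A x] is empty when [x] is not in [A]. *)
Definition is_component (X : topologicalType) (A C : set X) :=
  exists2 x, A x & C = connected_component A x.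

(* [B] is a subbase of the topology of [X]. *)
Definition generates_topology (X : topologicalType) (B : set (set X)) :=
  open = [set \bigcup_(A in F) A | F in [set F | F `<=` finI_from B id]].

(* [f] restricts to a homeomorphism from the subspace [A] to the subspace [B]. *)
Definition maps_homeomorphically (X Y : topologicalType)
    (A : set X) (B : set Y) (f : X -> Y) :=
  [/\ set_bij A B f, {within A, continuous f} &
      forall W : set X, open W ->
        exists2 W' : set Y, open W' & f @` (A `&` W) = B `&` W'].

Definition homeomorphism (X Y : topologicalType) (h : X -> Y) :=
  continuous h /\ exists k : Y -> X, [/\ continuous k, cancel h k & cancel k h].

Definition embedding (X Y : topologicalType) (i : X -> Y) :=
  injective i /\
  forall A : set X, open A <-> exists2 B : set Y, open B & A = i @^-1` B.

Section spreads.
Variables (R : realType) (X Y : topologicalType) (p : X -> Y).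

Definition spread :=
  continuous p /\
  generates_topology
    [set C | exists2 U : set Y, open U & is_component (p @^-1` U) C].

Definition complete :=
  forall y, closure (range p) y ->
  forall chi : set Y -> set X,
    let N := [set U : set Y | [/\ open U, connected U & U y]] in
    (forall U, N U -> is_component (p @^-1` U) (chi U)) ->
    (forall U V, N U -> N V -> U `<=` V -> chi U `<=` chi V) ->
    \bigcap_(U in N) chi U !=set0.

Definition complete_spread := spread /\ complete.

(* Ord(Y); the ordinary locus Ord(X) is [p @^-1` ordinary]. *)
Definition ordinary : set Y :=
  [set y | exists U : set Y, [/\ open U, U y &
     forall C, is_component (p @^-1` U) C -> maps_homeomorphically C U p]].

Definition branched_covering :=
  [/\ admissible_space R X /\ admissible_space R Y,
      complete_spread,
      set_surj setT setT p,
      connected [set: X] /\ connected [set: Y]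
    & portly (p @^-1` ordinary) /\ portly ordinary].

Definition covering :=
  [/\ continuous p, set_surj setT setT p &
      forall y, exists U : set Y, [/\ open U, U y &
        exists F : set (set X),
          [/\ p @^-1` U = \bigcup_(C in F) C,
              trivIset F id &
              forall C, F C -> open C /\ maps_homeomorphically C U p]]].

Definition universal_covering :=
  [/\ admissible_space R X, simply_connected R X & covering].

End spreads.

(* [p : X' -> Y] is a completion of the spread [f : X -> Y]. *)
Definition is_completion (R : realType) (X X' Y : topologicalType)
    (f : X -> Y) (p : X' -> Y) :=
  [/\ admissible_space R X', spread f, complete_spread p &
      exists i : X -> X', [/\ embedding i, p \o i = f & portly (range i)]].

(* [p : X -> Y] is a completion of the spread E -> Y \ S -> Y, where
   E -> Y \ S is a universal covering; the type [~` S] is Y \ S with the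
   subspace topology, and [set_val] its inclusion in [Y]. *)
Definition is_universal_branched_covering (R : realType)
    (X Y : topologicalType) (S : set Y) (p : X -> Y) :=
  exists (E : topologicalType) (q : E -> set_type (~` S)),
    universal_covering R q /\ is_completion R (set_val \o q) p.

Definition isomorphic_over (X X' Y : topologicalType)
    (p : X -> Y) (p' : X' -> Y) :=
  exists2 h : X -> X', homeomorphism h & p' \o h = p.

Section almost_homotopy_space.
Variables (R : realType) (Y : topologicalType) (S : set Y) (y0 : Y).
Local Notation I := (unit_interval R).

Definition Omega : topologicalType :=
  set_type [set g : {compact-open, I -> Y} |
    exists y, path_through y0 y (~` S) g].

Definition endpoint (g : Omega) : Y := (val g : I -> Y) one.

Definition almost_homotopy_class (g : Omega) : set Omega :=
  [set g' | almost_homotopic (~` S) (val g : I -> Y) (val g' : I -> Y)].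

Definition almost_homotopy_classes : Type :=
  set_type (range almost_homotopy_class).

Definition to_class (g : Omega) : almost_homotopy_classes :=
  SigSub (mem_set (imageT almost_homotopy_class g)).

Definition class_repr (c : almost_homotopy_classes) : Omega :=
  projT1 (cid2 (set_mem (valP c))).

Lemma class_reprK : cancel class_repr to_class.
Proof.
move=> c; apply: val_inj; rewrite /= /class_repr.
by case: (cid2 _).
Qed.

HB.instance Definition _ :=
  isQuotient.Build Omega almost_homotopy_classes class_reprK.

Definition almost_homotopy_space : topologicalType :=
  quotient_topology almost_homotopy_classes.

Definition class_of : Omega -> almost_homotopy_space := to_class.

End almost_homotopy_space.

(* Main.v *)
Require Import Defs.
From HB Require Import structures.
From mathcomp Require Import all_boot all_order all_algebra finmap.
From mathcomp Require Import generic_quotient.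
From mathcomp Require Import all_classical all_reals all_analysis.
From mathcomp Require Import lra.

(* Let [p : X -> Y] be a universal covering possibly branched over [S]. A path
   of [Y] issued from [y0] and contained in [~` S] except maybe at its end lifts
   to [X]: on [0, 1[ by path lifting in the covering, at time 1 by completeness
   of the spread. Mapping a path to the end of its lift is continuous and open
   for the compact-open topology, and it is onto by first countability, so it
   identifies [X] with a topological quotient of the space of paths. Two lifts
   have the same end iff the paths are almost homotopic: near a common end the
   two lifts can be joined over an arbitrarily small neighborhood, and the
   unbranched part of [X] is simply connected; conversely a homotopy through
   [~` S] lifts to [X].

   It remains to have one such [X]. Its points over [y] are the compatible
   families of classes, indexed by the connected neighborhoods [U] of [y], of
   paths of [~` S] ending in [U], modulo the homotopies through [~` S] whose end
   moves inside [U]. With these moving ends the relation is stable under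
   restriction and continuation of paths, and a homotopy of paths is itself a
   continuous family of points of [X], hence its own lift. *)
Set Implicit Arguments.
Unset Strict Implicit.
Unset Printing Implicit Defensive.

Import Order.TTheory GRing.Theory Num.Theory numFieldNormedType.Exports.

Local Open Scope classical_set_scope.
Local Open Scope ring_scope.

(** * Real paths and locally path connected spaces *)

(** Sheets are available only over the complement of [S], so no step may use them at the end of a
    path. Before time 1 the arguments are those of covering spaces; at time 1 they give way to
    components of preimages of small connected open sets, which form a base of the topology of a
    spread. Local connectedness of the unbranched part is what keeps such a component connected once
    the other points are removed. Homotopies are lifted through the space of paths: a square in the
    complement of [S] gives a continuous family of paths, one segment for each point of the square,
    and the end of the lift depends continuously on the path. The space constructed at the end is
    the completion from the outset, and its part over the complement of [S] is shown to be the
    universal covering. A class on [U] does not remember the exact end of a path; this is why a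
    point may lie over a point of [S], where no path contained in the complement of [S] can end. *)

Section continuity.
Context {R : realType} {T : topologicalType}.
Implicit Types f g a b : T -> R.

Lemma cont_id : continuous (fun x : T => x).
Proof. by move=> x; exact: cvg_id. Qed.

Lemma cont_cst (U : topologicalType) (c : U) : continuous (fun _ : T => c).
Proof. by move=> x; exact: cvg_cst. Qed.

Lemma cont_comp (U V : topologicalType) (g : U -> V) (f : T -> U) :
  continuous g -> continuous f -> continuous (fun x => g (f x)).
Proof. by move=> cg cf x; apply: continuous_comp; [exact: cf|exact: cg]. Qed.

Lemma cont_add f g : continuous f -> continuous g ->
  continuous (fun x => f x + g x).
Proof. by move=> cf cg x; exact: (continuousD (cf x) (cg x)). Qed.

Lemma cont_opp f : continuous f -> continuous (fun x => - f x).
Proof. by move=> cf x; exact: (continuousN (cf x)). Qed.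

Lemma cont_mul f g : continuous f -> continuous g ->
  continuous (fun x => f x * g x).
Proof. by move=> cf cg x; exact: (continuousM (cf x) (cg x)). Qed.

Lemma cont_min f g : continuous f -> continuous g ->
  continuous (fun x => Num.min (f x) (g x)).
Proof. by move=> cf cg x; exact: (continuous_min (cf x) (cg x)). Qed.

Lemma cont_max f g : continuous f -> continuous g ->
  continuous (fun x => Num.max (f x) (g x)).
Proof. by move=> cf cg x; exact: (continuous_max (cf x) (cg x)). Qed.

Lemma cont_pair (U V : topologicalType) (f : T -> U) (g : T -> V) :
  continuous f -> continuous g -> continuous (fun x => (f x, g x)).
Proof. by move=> cf cg x; exact: (cvg_pair (cf x) (cg x)). Qed.

Lemma open_ltr f g : continuous f -> continuous g -> open [set x | f x < g x].
Proof.
move=> cf cg.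
have -> : [set x | f x < g x] = (fun x => g x - f x) @^-1` [set r | r > 0].
  by apply/seteqP; split => x /=; rewrite subr_gt0.
apply: open_comp; last exact: open_gt.
by move=> x _; apply: cont_add => //; exact: cont_opp.
Qed.

(** Away from the locus [a = b] a single branch is active near the point; on it the two branches
    have the same value, to which both converge. The piecewise homotopies below are pasted in this
    way. *)
Lemma cont_glue (Z : topologicalType) (a b : T -> R) (f g : T -> Z) :
  continuous a -> continuous b -> continuous f -> continuous g ->
  (forall x, a x = b x -> f x = g x) ->
  continuous (fun x => if a x <= b x then f x else g x).
Proof.
move=> ca cb cf cg fg x W /= Wx.
suff : \forall u \near x, W (if a u <= b u then f u else g u) by [].
case: (ltgtP (a x) (b x)) Wx => [ab|ba|ab] Wx.
- have nab : nbhs x [set u | a u < b u].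
    by apply: open_nbhs_nbhs; split => //; exact: open_ltr.
  near=> u; rewrite ifT; first by near: u; exact: (cf x W).
  by apply/ltW; near: u.
- have nab : nbhs x [set u | b u < a u].
    by apply: open_nbhs_nbhs; split => //; exact: open_ltr.
  near=> u; rewrite ifF; first by near: u; exact: (cg x W).
  by apply/negbTE; rewrite -ltNge; near: u.
- near=> u; case: ifP => _.
  + by near: u; exact: (cf x W).
  + by near: u; apply: (cg x W); rewrite -fg.
Unshelve. all: by end_near. Qed.

End continuity.

Lemma cont_fst (T U : topologicalType) : continuous (@fst T U).
Proof. by move=> x; exact: cvg_fst. Qed.

Lemma cont_snd (T U : topologicalType) : continuous (@snd T U).
Proof. by move=> x; exact: cvg_snd. Qed.

(** Retraction of the line onto [[a, b]] when [a <= b]. Paths and homotopies are taken on the whole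
    line or plane, so that reparametrizations are plain arithmetic; this retraction freezes them
    outside the range that matters. *)
Definition clamp (R : realType) (a b t : R) : R := Num.max a (Num.min b t).

Lemma clamp_continuous (R : realType) (a b : R) : continuous (clamp a b).
Proof.
exact: (@cont_max R R _ _ (@cont_cst R R a)
  (@cont_min R R _ _ (@cont_cst R R b) (@cont_id R))).
Qed.

Ltac cont1 :=
  lazymatch goal with
  | |- forall x, @continuous_at _ _ x ?F =>
    lazymatch F with
    | (fun y => y) => refine (@cont_id _)
    | (fun _ => ?c) => refine (@cont_cst _ _ c)
    | (fun y => (@?f y + @?g y)%R) => refine (@cont_add _ _ f g _ _)
    | (fun y => (- @?f y)%R) => refine (@cont_opp _ _ f _)
    | (fun y => (@?f y * @?g y)%R) => refine (@cont_mul _ _ f g _ _)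
    | (fun y => Num.min (@?f y) (@?g y)) => refine (@cont_min _ _ f g _ _)
    | (fun y => Num.max (@?f y) (@?g y)) => refine (@cont_max _ _ f g _ _)
    | (fun y => (@?f y, @?g y)) => refine (@cont_pair _ _ _ f g _ _)
    | (fun y => ?h (@?g y)) => refine (@cont_comp _ _ _ h g _ _)
    | fst => refine (@cont_fst _ _)
    | snd => refine (@cont_snd _ _)
    | clamp _ _ => refine (@clamp_continuous _ _ _)
    | _ =>
      match goal with
      | H : forall x, @continuous_at _ _ x F |- _ => exact H
      | H : forall w x, @continuous_at _ _ x _ |- _ => exact (H _)
      | _ => assumption
      end
    end
  end.
Ltac cont := repeat cont1.

Lemma half_itv (R : realType) : 0 <= (2^-1 : R) < 1.
Proof. by lra. Qed.

Section interval.
Variable R : realType.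
Local Notation I := (unit_interval R).

Lemma clamp_itv (a b t : R) : a <= b -> a <= clamp a b t <= b.
Proof.
move=> ab; rewrite /clamp; case: (leP b t) => ?.
  by case: (leP a b) => ?; lra.
by case: (leP a t) => ?; lra.
Qed.

Lemma clamp_id (a b t : R) : a <= t <= b -> clamp a b t = t.
Proof.
rewrite /clamp; case: (leP b t) => ?; first by case: (leP a b) => ?; lra.
by case: (leP a t) => ?; lra.
Qed.

Lemma clamp_le (a b t : R) : a <= b -> t <= a -> clamp a b t = a.
Proof.
rewrite /clamp; case: (leP b t) => ?; first by case: (leP a b) => ?; lra.
by case: (leP a t) => ?; lra.
Qed.

Lemma clamp_ge (a b t : R) : a <= b -> b <= t -> clamp a b t = b.
Proof.
rewrite /clamp; case: (leP b t) => ?; first by case: (leP a b) => ?; lra.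
by case: (leP a t) => ?; lra.
Qed.

Definition clampI (t : R) : I := to_unit_interval (clamp 0 1 t).

Lemma val_unit_itv (i : I) : 0 <= (val i : R) <= 1.
Proof. by case: i => x /=; rewrite inE /= in_itv /=. Qed.

Lemma val_to_unit_interval (x : R) :
  0 <= x <= 1 -> val (to_unit_interval x) = x.
Proof. by move=> x01; rewrite /to_unit_interval insubdK// inE /= in_itv. Qed.

Lemma val_clampI t : val (clampI t) = clamp 0 1 t.
Proof. by rewrite val_to_unit_interval// clamp_itv. Qed.

Lemma clampIK (i : I) : clampI (val i) = i.
Proof. by apply: val_inj; rewrite /= val_clampI clamp_id// val_unit_itv. Qed.

Lemma to_unit_intervalE (x : R) : 0 <= x <= 1 -> to_unit_interval x = clampI x.
Proof. by move=> x01; rewrite /clampI clamp_id. Qed.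

Lemma clampI0 : clampI 0 = zero.
Proof. by apply: val_inj; rewrite /= val_clampI clamp_id// lexx ler01. Qed.

Lemma clampI1 : clampI 1 = one.
Proof. by apply: val_inj; rewrite /= val_clampI clamp_id// lexx ler01. Qed.

Lemma clampI_le (t : R) : t <= 0 -> clampI t = zero.
Proof.
by move=> t0; apply: val_inj; rewrite /= val_clampI clamp_le// ler01.
Qed.

Lemma clampI_ge (t : R) : 1 <= t -> clampI t = one.
Proof.
by move=> t0; apply: val_inj; rewrite /= val_clampI clamp_ge// ler01.
Qed.

Lemma val_continuous : continuous (fun i : I => val i : R).
Proof. exact: initial_continuous. Qed.

Lemma val_fst_continuous (T : topologicalType) :
  continuous (fun z : I * T => val z.1 : R).
Proof. exact: (cont_comp val_continuous (@cont_fst _ _)). Qed.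

Lemma val_snd_continuous (T : topologicalType) :
  continuous (fun z : T * I => val z.2 : R).
Proof. exact: (cont_comp val_continuous (@cont_snd _ _)). Qed.

Lemma clampI_continuous : continuous clampI.
Proof.
apply: continuous_comp_initial.
rewrite (_ : _ \o _ = clamp 0 1); first exact: clamp_continuous.
by apply/funext => t; exact: val_clampI.
Qed.

End interval.

Section connectedness.

(** [Q] and its negation are both relatively open in [W]. In the path lifting arguments this
    induction along a connected set takes the place of a subdivision of the interval. *)
Lemma connected_ind (T : topologicalType) (W : set T) (Q : T -> Prop) :
  connected W ->
  (forall t, W t -> \forall u \near t, W u -> (Q t <-> Q u)) ->
  forall t u, W t -> W u -> Q t -> Q u.
Proof.
move=> cW loc t u Wt Wu Qt.
have key (P : T -> Prop) :
  (forall t, W t -> \forall u \near t, W u -> (P t <-> P u)) ->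
    exists2 C, open C & [set v | W v /\ P v] = W `&` C.
  move=> locP; exists (interior [set v | W v -> P v]); first exact: open_interior.
  apply/seteqP; split => v /= [Wv Pv]; split => //.
    by rewrite /interior; apply: filterS (locP _ Wv) => w /= H /H <-.
  by move/nbhs_singleton: Pv; exact.
suff E : [set v | W v /\ Q v] = W by move: Wu; rewrite -E => -[].
apply: cW; first by exists t.
  exact: key.
have [C oC CE] : exists2 C, open C & [set v | W v /\ ~ Q v] = W `&` C.
  by apply: key => v Wv; apply: filterS (loc _ Wv) => w /= H /H ->.
exists (~` C); first exact: open_closedC.
apply/seteqP; split => v /= [Wv Qv]; split => //.
  by move=> Cv; have : (W `&` C) v by []; rewrite -CE => -[].
apply: contrapT => nQ; apply: Qv.
by have : [set v | W v /\ ~ Q v] v by []; rewrite CE => -[].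
Qed.

Lemma connected_image (T U : topologicalType) (f : T -> U) (A : set T) :
  continuous f -> connected A -> connected (f @` A).
Proof.
move=> cf cA; apply: connected_continuous_connected => //.
exact: continuous_subspaceT.
Qed.

Lemma connected_itv (R : realType) (i : interval R) : connected [set` i].
Proof. by apply/connected_intervalP; exact: interval_is_interval. Qed.

Lemma connected_setT_real (R : realType) : connected [set: R].
Proof. by apply/connected_intervalP => x y _ _ z _. Qed.

End connectedness.

Section joined.
Variables (R : realType) (Z : topologicalType).
Implicit Types (A B W : set Z) (x y z : Z).

Definition joined A x y := exists f : R -> Z,
  [/\ continuous f, f 0 = x, f 1 = y & forall t, A (f t)].

Lemma joined_refl A x : A x -> joined A x x.
Proof. by move=> Ax; exists (fun _ => x); split => //; cont. Qed.

Lemma joined_sub A B x y : A `<=` B -> joined A x y -> joined B x y.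
Proof. by move=> AB [f [? ? ? fA]]; exists f; split => // t; exact: AB. Qed.

Lemma joined_sym A x y : joined A x y -> joined A y x.
Proof.
move=> [f [cf f0 f1 fA]]; exists (fun t => f (1 - t)); split => //.
- by cont.
- by rewrite subr0.
- by rewrite subrr.
Qed.

Definition concatR (f g : R -> Z) (t : R) : Z :=
  if t <= 2^-1 then f (2 * t) else g (2 * t - 1).

Lemma concatR_continuous (f g : R -> Z) : continuous f -> continuous g ->
  f 1 = g 0 -> continuous (concatR f g).
Proof.
move=> cf cg fg; apply: cont_glue => //; cont => t ->.
by rewrite divff// subrr.
Qed.

Lemma concatR0 f g : concatR f g 0 = f 0.
Proof. by rewrite /concatR ifT ?mulr0// invr_ge0. Qed.

Lemma concatR1 f g : concatR f g 1 = g 1.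
Proof.
by rewrite /concatR ifF ?mulr1; [congr g; lra|apply/negbTE; rewrite -ltNge; lra].
Qed.

Lemma joined_trans A y x z : joined A x y -> joined A y z -> joined A x z.
Proof.
move=> [f [cf f0 f1 fA]] [g [cg g0 g1 gA]]; exists (concatR f g); split => //.
- by apply: concatR_continuous => //; rewrite f1.
- by rewrite concatR0.
- by rewrite concatR1.
- by move=> t; rewrite /concatR; case: ifP.
Qed.

Lemma path_image_component A (f : R -> Z) (B : set R) s t :
  continuous f -> connected B -> (forall u, B u -> A (f u)) -> B s -> B t ->
  connected_component A (f s) (f t).
Proof.
move=> cf cB fA Bs Bt; exists (f @` B); last by exists t.
split; [by exists s| by move=> _ [u Bu <-]; exact: fA|exact: connected_image].
Qed.

Lemma joined_component A x y : joined A x y -> connected_component A x y.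
Proof.
move=> [f [cf <- <- fA]].
by apply: (@path_image_component _ _ setT) => //; exact: connected_setT_real.
Qed.

Lemma joined_connected A : (forall x y, A x -> A y -> joined A x y) ->
  connected A.
Proof.
move=> jA; have [[x Ax]|A0] := pselect (A !=set0); last first.
  by move/nonemptyPn : A0 => ->; exact: connected0.
rewrite (_ : A = connected_component A x); first exact: component_connected.
apply/seteqP; split; last exact: connected_component_sub.
by move=> y Ay; apply: joined_component; exact: jA.
Qed.

Lemma is_path_joined A x y (g : unit_interval R -> Z) :
  is_path x y g -> (forall t, A (g t)) -> joined A x y.
Proof.
move=> [cg g0 g1] gA; exists (fun t => g (clampI t)); split => //.
- by apply: cont_comp => //; exact: clampI_continuous.
- by rewrite clampI0.
- by rewrite clampI1.
Qed.

Lemma joined_is_path A x y : joined A x y ->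
  exists2 g : unit_interval R -> Z, is_path x y g & forall t, A (g t).
Proof.
move=> [f [cf f0 f1 fA]]; exists (fun t => f (val t)) => //; split => //.
by apply: cont_comp => //; exact: val_continuous.
Qed.

Lemma lpc_joined x U : locally_path_connected R Z -> nbhs x U ->
  exists V, [/\ open V, V x, V `<=` U &
    forall y z, V y -> V z -> joined V y z].
Proof.
move=> lZ /lZ [V [oV Vx VU cV]]; exists V; split => // y z Vy Vz.
by have [g] := cV _ _ Vy Vz; exact: is_path_joined.
Qed.

Lemma joined_lpc : (forall x U, nbhs x U ->
  exists V, [/\ open V, V x, V `<=` U &
    forall y z, V y -> V z -> joined V y z]) -> locally_path_connected R Z.
Proof.
move=> H x U /H [V [oV Vx VU cV]]; exists V; split => // y z Vy Vz.
exact/joined_is_path/cV.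
Qed.

Lemma lpc_connected x U : locally_path_connected R Z -> nbhs x U ->
  exists V, [/\ open V, connected V, V x & V `<=` U].
Proof.
move=> lZ /(lpc_joined lZ) [V [oV Vx VU cV]]; exists V; split => //.
exact: joined_connected.
Qed.

(** Being joined to [x] in [W] is a locally constant property. *)
Lemma open_joined W : locally_path_connected R Z -> open W -> connected W ->
  forall x y, W x -> W y -> joined W x y.
Proof.
move=> lZ oW cW x y Wx Wy.
apply: (@connected_ind _ W (joined W x) cW _ x y Wx Wy); last exact: joined_refl.
move=> t Wt; have [V [oV Vt VW jV]] :
  exists V, [/\ open V, V t, V `<=` W & forall y z, V y -> V z -> joined V y z].
  by apply: lpc_joined => //; exact: open_nbhs_nbhs.
have nV : nbhs t V by exact: open_nbhs_nbhs.
apply: filterS nV => u Vu Wu.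
have tu : joined W t u by apply: joined_sub VW _; exact: jV.
by split => xt; apply: joined_trans xt _ => //; exact: joined_sym.
Qed.

Lemma component_open W x :
  locally_path_connected R Z -> open W -> open (connected_component W x).
Proof.
move=> lZ oW; rewrite openE => y /= xy; rewrite /interior.
have Wy := connected_component_sub xy.
have [V [oV cV Vy VW]] := lpc_connected lZ (open_nbhs_nbhs (conj oW Wy)).
apply: (@filterS _ _ _ V); last exact: open_nbhs_nbhs.
move=> z Vz; apply: connected_component_trans xy _.
by exists V.
Qed.

End joined.

(** * Infinite concatenations of paths, and access to a point through a portly set *)

Section telescoping.
Variables (R : realType) (Z : topologicalType).

(* [pieces n] runs through the first [n] paths on [0, n] and stops there. *)
Fixpoint pieces (f : nat -> R -> Z) (a : Z) (n : nat) : R -> Z :=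
  if n is m.+1 then
    fun u => if u <= m%:R then pieces f a m u else f m (clamp 0 1 (u - m%:R))
  else fun _ => a.

(** The [n]-th path, which stays in [A n], is run through on [[n, n+1]], and the half-line is
    squeezed into [[0, 1[]. The limit at 1 is [x] because the sets [A n] shrink to [x]. *)
Lemma telescoping_path (x : Z) (A : nat -> set Z) (a : nat -> Z) :
  (forall n, A n.+1 `<=` A n) ->
  (forall U, nbhs x U -> exists n, A n `<=` U) ->
  (forall n, joined R (A n) (a n) (a n.+1)) ->
  exists g : R -> Z, [/\ continuous g, g 0 = a 0%N,
    forall t : R, 1 <= t -> g t = x & forall t : R, t < 1 -> A 0%N (g t)].
Proof.
move=> decA Ax /choice [f Hf].
have fc n : continuous (f n) by case: (Hf n).
have f0 n : f n 0 = a n by case: (Hf n).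
have f1 n : f n 1 = a n.+1 by case: (Hf n).
have fA n t : A n (f n t) by case: (Hf n).
have decA2 n m : (n <= m)%N -> A m `<=` A n.
  elim: m => [|m IH]; first by rewrite leqn0 => /eqP ->.
  rewrite leq_eqVlt => /orP[/eqP -> //|/IH]; exact: subset_trans.
pose G := pieces f (a 0%N).
have GE n u : G n.+1 u =
  if u <= n%:R then G n u else f n (clamp 0 1 (u - n%:R)) by [].
have Gend n u : n%:R <= u -> G n u = a n.
  elim: n u => [//|n IH] u nu; rewrite GE.
  have nu' : n%:R + 1 <= u by rewrite natr1.
  rewrite ifF ?clamp_ge ?f1//; [lra|apply/negbTE; rewrite -ltNge; lra].
have Gc n : continuous (G n).
  elim: n => [|n IH] /=; first exact: cont_cst.
  apply: (@cont_glue R R Z) => //; cont.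
  by move=> u ->; rewrite subrr clamp_id ?lexx ?ler01// f0; exact: Gend.
have GS n m u : (n <= m)%N -> u <= n%:R -> G m u = G n u.
  elim: m => [|m IH]; first by rewrite leqn0 => /eqP ->.
  rewrite leq_eqVlt => /orP[/eqP -> //|nm] un.
  by rewrite GE ifT ?IH//; apply: le_trans un _; rewrite ler_nat.
have GA n m u : (n < m)%N -> n%:R <= u -> A n (G m u).
  elim: m => [//|m IH]; rewrite ltnS leq_eqVlt => /orP[/eqP <-|nm] nu; rewrite GE.
    by case: ifP => [un|_]; [rewrite -/(G n) Gend// -f0; exact: fA|exact: fA].
  case: ifP => _; first exact: IH.
  by apply: (decA2 n m); [exact: ltnW|exact: fA].
(* An index beyond [u]; by [KE] any other one gives the same value. The maximum with 0 takes care of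
   negative times. *)
pose N (u : R) := (Num.truncn (Num.max 0 u)).+1.
have uN u : u < (N u)%:R.
  apply: le_lt_trans (_ : Num.max 0 u < _); first by rewrite le_max lexx orbT.
  by apply: truncnS_gt.
pose K u := G (N u) u.
have KE n u : u <= n%:R -> K u = G n u.
  move=> un; rewrite /K; have [nN|/ltnW Nn] := leqP n (N u).
    exact: GS.
  by rewrite (GS (N u) n)//; exact/ltW.
have K0 u : u <= 0 -> K u = a 0%N by move=> u0; rewrite (KE 0%N).
have KA n u : n%:R <= u -> A n (K u).
  move=> nu; apply: GA => //; rewrite -(@ltr_nat R).
  exact: le_lt_trans (uN u).
have KA0 u : A 0%N (K u).
  have [u0|/ltW u0] := lerP u 0; last exact: KA.
  by rewrite K0// -f0; exact: fA.
have Kc : continuous K.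
  move=> u W WK.
  suff : \forall v \near u, W (K v) by [].
  have nb : nbhs u [set v | v < (N u)%:R].
    by apply: open_nbhs_nbhs; split; [exact: open_lt|exact: uN].
  near=> v; rewrite (KE (N u)); last by apply/ltW; near: v.
  by near: v; apply: (Gc (N u) u W).
(* [t / (1 - t)] maps [[0, 1[] increasingly onto the half-line and is negative for [t < 0], where
   [K] is still [a 0]. It exceeds [n] exactly beyond [n / (1 + n)], the threshold used for
   continuity at 1. *)
exists (fun t => if t < 1 then K (t / (1 - t)) else x); split.
- move=> t; have [t1|t1] := ltrP t 1.
    have nb : nbhs t [set v | v < 1].
      by apply: open_nbhs_nbhs; split => //; exact: open_lt.
    have c1 : {for t, continuous (fun v : R => K (v / (1 - v)))}.
      apply: (@continuous_comp _ _ _ (fun v : R => v / (1 - v)) K);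
        last exact: Kc.
      apply: cvgM; first exact: cvg_id.
      apply: cvgV; first by rewrite gt_eqF// subr_gt0.
      by apply: cvgB; [exact: cvg_cst|exact: cvg_id].
    move=> W /=; rewrite t1 => WK.
    suff : \forall v \near t, W (if v < 1 then K (v / (1 - v)) else x) by [].
    near=> v; rewrite ifT; first by near: v; exact: c1.
    by near: v.
  move=> W /=; rewrite ltNge t1 /= => Wx.
  have [n AW] := Ax _ Wx.
  have nb : nbhs t [set v | n%:R / (1 + n%:R) < v].
    apply: open_nbhs_nbhs; split; first exact: open_gt.
    rewrite /=; apply: lt_le_trans t1; rewrite ltr_pdivrMr; last first.
      by rewrite ltr_pwDl.
    by rewrite mul1r ltrDr.
  suff : \forall v \near t, W (if v < 1 then K (v / (1 - v)) else x) by [].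
  near=> v; case: ifP => v1; last exact: nbhs_singleton.
  apply/AW/KA; rewrite ler_pdivlMr ?subr_gt0//.
  have : n%:R / (1 + n%:R) < v by near: v.
  rewrite ltr_pdivrMr; last by rewrite ltr_pwDl.
  by nra.
- by rewrite ltr01 mul0r K0.
- by move=> t t1; rewrite ltNge t1.
- by move=> t t1; rewrite t1.
Unshelve. all: by end_near. Qed.

End telescoping.

Lemma connected_base (R : realType) (Z : topologicalType) (W : set Z) (x : Z) :
  locally_path_connected R Z -> first_countable Z ->
  open W -> connected W -> W x -> exists U : nat -> set Z,
  [/\ U 0%N = W, forall n, [/\ open (U n), connected (U n) & U n x],
      forall n, U n.+1 `<=` U n &
      forall V, nbhs x V -> exists n, U n `<=` V].
Proof.
move=> lZ fZ oW cW Wx; have [B [nB HB]] := fZ x.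
(* The bound is strict so that the intersection is empty at index 0, which gives [W] itself. *)
pose Bi n := W `&` \bigcap_(k in [set k | (k < n)%N]) interior (B k).
have oBi n : open (Bi n).
  apply: openI => //; elim: n => [|n IH].
    rewrite (_ : [set k | (k < 0)%N] = set0) ?bigcap_set0; first exact: openT.
    by apply/seteqP; split.
  rewrite (_ : \bigcap_(k in _) _ =
    \bigcap_(k in [set k | (k < n)%N]) interior (B k) `&` interior (B n)).
    by apply: openI => //; exact: open_interior.
  apply/seteqP; split => z.
    move=> H; split; last exact: (H n (ltnSn n)).
    by move=> k /= kn; apply: H => /=; exact: ltnW.
  by move=> [H Hn] k /=; rewrite ltnS leq_eqVlt => /orP[/eqP -> //|]; exact: H.
pose U n := connected_component (Bi n) x.
have Bix n : Bi n x.
  by split => // k _; exact: (nbhs_singleton (nbhs_interior (nB k))).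
exists U; split.
- rewrite /U /Bi (_ : [set k | (k < 0)%N] = set0); last first.
    by apply/seteqP; split.
  by rewrite bigcap_set0 setIT connected_component_id.
- move=> n; split.
  + exact: (@component_open R).
  + exact: component_connected.
  + exact: connected_component_refl.
- move=> n; apply: connected_component_max.
  + exact: connected_component_refl.
  + apply: subset_trans (@connected_component_sub _ _ _) _.
    by move=> z [Wz H]; split => // k /= kn; apply: H => /=; exact: ltnW.
  + exact: component_connected.
- move=> V /HB [n nV]; exists n.+1 => z /connected_component_sub [_ H].
  by apply: nV; apply: interior_subset; exact: (H n (ltnSn n)).
Qed.

(** Density gives points of [D] in a shrinking base at [x], local connectedness joins consecutive
    ones inside [D], and the telescope of these paths reaches [x], which may lie outside of [D]. *)
Lemma portly_path (R : realType) (Z : topologicalType) (D W : set Z) w x :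
  locally_path_connected R Z -> first_countable Z -> portly D ->
  open W -> connected W -> W w -> D w -> W x ->
  exists g : R -> Z, [/\ continuous g, g 0 = w,
    forall t : R, 1 <= t -> g t = x & forall t : R, t < 1 -> (W `&` D) (g t)].
Proof.
move=> lZ fZ [oD dD lcD] oW cW Ww Dw Wx.
have [U [U0 HU decU baseU]] := connected_base lZ fZ oW cW Wx.
have ne n : exists z, (U n `&` D) z.
  have [oU _ Ux] := HU n.
  by have [z ?] := dD _ (ex_intro _ x Ux) oU; exists z.
have [b Hb] := choice ne.
pose a n := if n is 0%N then w else b n.
have Ha n : (U n `&` D) (a n) by case: n => [|n]; [split; rewrite ?U0|exact: Hb].
have [|||g [cg g0 g1 gA]] := @telescoping_path R Z x (fun n => U n `&` D) a.
- by move=> n z [/decU ? ?].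
- by move=> V /baseU [n nV]; exists n => z [/nV].
- move=> n; have [oU cU _] := HU n; apply: open_joined => //.
  + exact: openI.
  + exact: lcD.
  + by have [/decU ? ?] := Ha n.+1.
by exists g; split => // t t1; rewrite -U0; exact: gA.
Qed.

(** * Path lifting in complete spreads *)

Section hausdorff.

Lemma hausdorff_sep (T : topologicalType) (x y : T) : hausdorff_space T ->
  x <> y -> exists U V, [/\ open U, open V, U x, V y & U `&` V = set0].
Proof.
rewrite open_hausdorff => hT /eqP /hT [[U V] /= [/set_mem Ux /set_mem Vy]].
by move=> [oU oV /eqP UV]; exists U, V.
Qed.

Lemma near_neq (T X : topologicalType) (f g : T -> X) t : hausdorff_space X ->
  {for t, continuous f} -> {for t, continuous g} -> f t <> g t ->
  \forall u \near t, f u <> g u.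
Proof.
move=> hX cf cg /(hausdorff_sep hX) [U [V [oU oV Uf Vg UV]]].
have nU : \forall u \near t, U (f u) by apply: cf; exact: open_nbhs_nbhs.
have nV : \forall u \near t, V (g u) by apply: cg; exact: open_nbhs_nbhs.
near=> u => fg; have : (U `&` V) (f u).
  by split; [near: u|rewrite fg; near: u].
by rewrite UV.
Unshelve. all: by end_near. Qed.

End hausdorff.

Section spread_base.
Variables (R : realType) (X Y : topologicalType) (p : X -> Y).

(** A finite intersection of components through [x], over sets [V i], contains the component over
    any connected neighborhood of [p x] that lies in all of the [V i]. So the components form a
    base, and not only a subbase. *)
Lemma spread_base : locally_path_connected R Y -> spread p ->
  forall x W, nbhs x W -> exists U, [/\ open U, connected U, U (p x) &
    connected_component (p @^-1` U) x `<=` W].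
Proof.
move=> lY [cp gen] x W; rewrite nbhsE => -[W' [oW' W'x] W'W].
move: oW'; rewrite gen => -[F FB FE].
move: W'x; rewrite -FE => -[C FC Cx]; have [D' D'B CE] := FB _ FC.
have /choice [V HV] : forall i : set X, exists U : set Y, i \in D' ->
    [/\ open U, U (p x) & connected_component (p @^-1` U) x = i].
  move=> i; have [iD|_] := boolP (i \in D'); last by exists setT.
  have := D'B _ iD; rewrite inE /= => -[U oU [z Uz iE]]; exists U => _.
  have ix : i x by move: Cx; rewrite -CE; apply.
  split => //; first by move: ix; rewrite iE => /connected_component_sub.
  by rewrite iE; apply/esym/same_connected_component; rewrite -iE.
have nV : nbhs (p x) (\bigcap_(i in [set` D']) V i).
  apply: filter_bigI => i iD; apply: open_nbhs_nbhs.
  by have [] := HV _ iD.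
have [U [oU cU Ux UV]] := lpc_connected lY nV.
exists U; split => //; apply: subset_trans W'W; rewrite -FE.
move=> z xz; exists C => //; rewrite -CE => i /= iD.
have [_ _ <-] := HV _ iD.
apply: connected_component_max xz; first exact: connected_component_refl.
  by apply: subset_trans (@connected_component_sub _ _ _) _ => v /UV; apply.
exact: component_connected.
Qed.

(** Local path connectedness of [X] makes the components open, so that they generate nothing finer
    than the topology; the base condition gives the other inclusion. *)
Lemma spread_intro : locally_path_connected R X -> continuous p ->
  (forall x W, nbhs x W -> exists U, [/\ open U, U (p x) &
    connected_component (p @^-1` U) x `<=` W]) -> spread p.
Proof.
move=> lX cp base; split => //.
set B := [set C | _].
have oB C : B C -> open C.
  move=> [U oU [x _ ->]]; apply: (component_open _ lX).
  by apply: open_comp => // z _; exact: cp.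
apply/seteqP; split => W.
  move=> oW; exists [set C | B C /\ C `<=` W].
    by move=> C [BC _]; exact: (@finI_from1 _ _ B id).
  apply/seteqP; split => x; first by move=> [C [_ CW] /CW].
  move=> Wx; have [U [oU Ux UW]] := base _ _ (open_nbhs_nbhs (conj oW Wx)).
  exists (connected_component (p @^-1` U) x).
    by split => //; exists U => //; exists x.
  exact: connected_component_refl.
move=> [F FB <-]; apply: bigcup_open => C /FB [D' D'B <-].
rewrite openE => x Hx; rewrite /interior.
apply: filter_bigI => i iD; apply: open_nbhs_nbhs; split; last exact: Hx.
by apply: oB; have := D'B _ iD; rewrite inE.
Qed.

End spread_base.

Section lifting.
Variables (R : realType) (X Y : topologicalType) (p : X -> Y).
Variables (A : set X) (S : set Y).
Local Notation D := (~` S).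

(** The section [s] is a total map that matters only on [U]. The last clause says that [C] is also
    closed in the part of [A] over [U]: it keeps a connected set in one sheet although [U] need not
    be connected. *)
Definition sheet (U : set Y) (C : set X) (s : Y -> X) :=
  [/\ open C, C `<=` A `&` p @^-1` U,
      forall u, U u -> [/\ C (s u), p (s u) = u & {for u, continuous s}],
      forall c, C c -> s (p c) = c &
      open ((A `&` p @^-1` U) `\` C)].

Definition evenly_covered (U : set Y) :=
  [/\ open U, U `<=` D &
    forall a, A a -> U (p a) -> exists C s, C a /\ sheet U C s].

Definition sheeted := forall y, D y -> exists2 U, evenly_covered U & U y.

Hypotheses (hX : hausdorff_space X) (lX : locally_path_connected R X).
Hypotheses (hY : hausdorff_space Y) (lY : locally_path_connected R Y).
Hypotheses (oA : open A) (pA : forall a, A a -> D (p a)).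
Hypotheses (csp : complete_spread p) (shp : sheeted).

Let cp : continuous p. Proof. by case: csp => -[]. Qed.

Lemma component_preimage_open U x :
  open U -> open (connected_component (p @^-1` U) x).
Proof.
by move=> oU; apply: (component_open _ lX); apply: open_comp => // z _; exact: cp.
Qed.

(** Agreement is open because both maps enter one sheet, where its section recovers them from their
    common projection; disagreement is open because [X] is Hausdorff. *)
Lemma lift_unique (T : topologicalType) (W : set T) (f g : T -> X) t0 :
  connected W ->
  (forall t, W t -> {for t, continuous f}) ->
  (forall t, W t -> {for t, continuous g}) ->
  (forall t, W t -> [/\ A (f t), A (g t) & p (f t) = p (g t)]) ->
  W t0 -> f t0 = g t0 -> forall t, W t -> f t = g t.
Proof.
move=> cW cf cg H Wt0 fg0 t Wt.
apply: (@connected_ind _ W (fun t => f t = g t) cW _ t0 t Wt0 Wt fg0).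
move=> {}t {}Wt; have [fg|nfg] := pselect (f t = g t); last first.
  by apply: filterS (near_neq hX (cf _ Wt) (cg _ Wt) nfg) => u ? _; split.
have [Af Ag pfg] := H _ Wt.
have [U [oU UD ecU] Upf] := shp (pA Af).
have [C [s [Cf [oC CA sU sC _]]]] := ecU _ Af Upf.
have nf : \forall u \near t, C (f u) by apply: (cf _ Wt); exact: open_nbhs_nbhs.
have ng : \forall u \near t, C (g u).
  by apply: (cg _ Wt); rewrite -fg; exact: open_nbhs_nbhs.
near=> u => Wu; split => // _.
have [_ _ pu] := H _ Wu.
have Cfu : C (f u) by near: u.
have Cgu : C (g u) by near: u.
by rewrite -(sC _ Cfu) pu sC.
Unshelve. all: by end_near. Qed.

Lemma sheet_stay (T : topologicalType) (W : set T) (f : T -> X) U C s t0 :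
  connected W -> sheet U C s ->
  (forall t, W t -> {for t, continuous f}) ->
  (forall t, W t -> A (f t) /\ U (p (f t))) ->
  W t0 -> C (f t0) -> forall t, W t -> C (f t).
Proof.
move=> cW [oC CA _ _ oCC] cf H Wt0 Ct0 t Wt.
apply: (@connected_ind _ W (fun t => C (f t)) cW _ t0 t Wt0 Wt Ct0).
move=> {}t {}Wt; have [Cf|nCf] := pselect (C (f t)).
  have nf : \forall u \near t, C (f u).
    by apply: (cf _ Wt); exact: open_nbhs_nbhs.
  by apply: filterS nf => u ? _; split.
have nf : \forall u \near t, ((A `&` p @^-1` U) `\` C) (f u).
  apply: (cf _ Wt); apply: open_nbhs_nbhs; split => //.
  by split => //; exact: H.
by apply: filterS nf => u [_ nCu] _; split.
Qed.

Lemma ball_itv (t e u : R) : ball t e u <-> t - e < u < t + e.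
Proof. by rewrite /ball /= ltr_distlC. Qed.

Lemma near_ballP (t : R) (P : R -> Prop) : (\forall u \near t, P u) <->
  exists2 e : R, 0 < e & forall u : R, t - e < u < t + e -> P u.
Proof.
split.
  move=> /nbhs_ballP [e /= e0 H]; exists e => // u tu.
  by apply: H; apply/ball_itv.
move=> [e e0 H]; apply/nbhs_ballP; exists e => // u /ball_itv; exact: H.
Qed.

Section lift_interval.
Variables (k : R -> Y) (e0 : X).
Hypotheses (ck : continuous k) (kD : forall t : R, D (k t)).
Hypotheses (k0 : forall t : R, t <= 0 -> k t = k 0).
Hypotheses (Ae0 : A e0) (pe0 : p e0 = k 0).

(** The path is frozen after time [T], so that a partial lift is still a map on the whole line. *)
Let P (T : R) := exists f : R -> X, [/\ continuous f, f 0 = e0,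
  forall t, A (f t) & forall t, p (f t) = k (Num.min t T)].

(** The two times come in either order, because [connected_ind] asks for an equivalence: going back
    freezes the lift earlier, going forward follows the section of one sheet. *)
Let lift_step U (T1 T2 : R) : evenly_covered U -> 0 <= T1 -> 0 <= T2 ->
  (forall u : R, Num.min T1 T2 <= u <= Num.max T1 T2 -> U (k u)) -> P T1 -> P T2.
Proof.
move=> [oU UD ecU] T10 T20 kU [f [cf f0 fA pf]].
have [T21|T12] := leP T2 T1.
  exists (fun t => f (Num.min t T2)); split => [|||t] //.
  - by cont.
  - by rewrite min_l.
  - by rewrite pf -minA (min_l T21).
have {}kU (u : R) : T1 <= u <= T2 -> U (k u).
  by move=> ?; apply: kU; rewrite (min_l (ltW T12)) (max_r (ltW T12)).
have kT1 : U (k T1) by apply: kU; lra.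
have pT1 : p (f T1) = k T1 by rewrite pf minxx.
have [|C [s [Cf [oC CA sU sC _]]]] := ecU (f T1) (fA _); first by rewrite pT1.
have Uc t : U (k (clamp T1 T2 t)) by apply: kU; apply: clamp_itv; exact: ltW.
exists (fun t => if t <= T1 then f t else s (k (clamp T1 T2 t))); split.
- have csk : continuous (fun t : R => s (k (clamp T1 T2 t))).
    move=> t; have [_ _ cs] := sU _ (Uc t).
    have ckc : continuous (fun t : R => k (clamp T1 T2 t)) by cont.
    by apply: (continuous_comp (ckc t)).
  apply: (@cont_glue R R X) => //; cont.
  by move=> t ->; rewrite clamp_le// ?ltW// -pT1 sC.
- by rewrite T10.
- move=> t; case: ifP => // _.
  by have [/CA[]] := sU _ (Uc t).
- move=> t; case: ifP => tT1; first by rewrite pf !min_l//; lra.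
  have [_ -> _] := sU _ (Uc t); congr k; rewrite /clamp minC max_r//.
  by rewrite le_min (ltW T12) andbT ltW// ltNge tT1.
Qed.

Lemma lift_interval (T : R) : 0 <= T -> exists f : R -> X, [/\ continuous f,
  f 0 = e0, forall t, A (f t) & forall t, p (f t) = k (Num.min t T)].
Proof.
move=> T0; have P0 : P 0.
  exists (fun _ => e0); split => //; first by cont.
  by move=> t; rewrite pe0 (k0 (t := Num.min t 0))// ge_min lexx orbT.
rewrite -/(P T); apply: (@connected_ind R [set` `[0, +oo[] P _ _ 0 T);
  rewrite /= ?in_itv /= ?lexx ?T0//; first exact: connected_itv.
move=> t; rewrite in_itv /= andbT => t0.
have [U ecU Ukt] := shp (@kD t); have [oU _ _] := ecU.
have /near_ballP [e e_gt0 He] : \forall u \near t, U (k u).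
  by apply: ck; exact: open_nbhs_nbhs.
apply/near_ballP; exists e => // u tu; rewrite in_itv /= andbT => u0.
have H v : Num.min t u <= v <= Num.max t u -> U (k v).
  rewrite ge_min le_max => /andP[] /orP[?|?] /orP[?|?]; apply: He; lra.
split; apply: (lift_step ecU) => //.
by move=> v; rewrite minC maxC; exact: H.
Qed.

End lift_interval.

(** The elements of [Omega], extended to the line by constants; only the value at times from 1 on
    may lie in [S]. *)
Definition opath (y0 : Y) (k : R -> Y) := [/\ continuous k,
  forall t : R, t <= 0 -> k t = y0, forall t : R, 1 <= t -> k t = k 1 &
  forall t : R, t < 1 -> D (k t)].

Definition is_lift (e0 : X) (k : R -> Y) (g : R -> X) := [/\ continuous g,
  g 0 = e0, forall t, p (g t) = k t & forall t : R, t < 1 -> A (g t)].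

Lemma is_lift_unique e0 k g g' : is_lift e0 k g -> is_lift e0 k g' ->
  forall t : R, t <= 1 -> g t = g' t.
Proof.
move=> [cg g0 pg gA] [cg' g'0 pg' g'A].
have H t : t < 1 -> g t = g' t.
  move=> t1; apply: (@lift_unique R [set` `]-oo, 1[] g g' 0) => //.
  - exact: connected_itv.
  - by move=> u _; exact: cg.
  - by move=> u _; exact: cg'.
  - by move=> u; rewrite /= in_itv /= => u1; rewrite pg pg'; split; auto.
  - by rewrite /= in_itv /= ltr01.
  - by rewrite g0.
move=> t; rewrite le_eqVlt => /orP[/eqP ->|]; last exact: H.
apply: contrapT => /(near_neq hX (cg 1) (cg' 1)) /near_ballP [e e_gt0 He].
by apply: (He (1 - e / 2)); [lra|apply: H; lra].
Qed.

(** Sheets give the lift up to any time before 1. Its tails single out one component over each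
    connected neighborhood of [k 1], increasing with the neighborhood; completeness gives a common
    point of these components, which is taken as the end of the lift. *)
Lemma lift_exists y0 e0 k : opath y0 k -> A e0 -> p e0 = y0 ->
  exists g, is_lift e0 k g.
Proof.
move=> [ck k0 k1 kD] Ae0 pe0.
have /choice [F HF] : forall T : R, exists f : R -> X, 0 <= T < 1 ->
    [/\ continuous f, f 0 = e0, forall t, A (f t) &
        forall t, p (f t) = k (Num.min t T)].
  move=> T; have [/andP[T0 T1]|nT] := boolP (0 <= T < 1); last first.
    by exists (fun _ => e0).
  have [||||f [cf f0 fA pf]] :=
      @lift_interval (fun t => k (Num.min t T)) e0 _ _ _ Ae0 _ T T0.
  - by cont.
  - by move=> t; apply: kD; apply: le_lt_trans T1; rewrite ge_min lexx orbT.
  - by move=> t t0; rewrite !min_l ?(le_trans t0)// !k0.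
  - by rewrite min_l// k0.
  by exists f => _; split => // t; rewrite pf -minA minxx.
(* Diagonal choice: the lift up to [T] is read at [T] itself, or the lift up to 0 at negative times.
   By uniqueness [f] agrees with each [F T] up to time [T]. *)
pose f (t : R) := F (Num.max t 0) t.
have fE (t T : R) : t <= T -> 0 <= T < 1 -> f t = F T t.
  move=> tT T01; have t01 : 0 <= Num.max t 0 < 1.
    by rewrite le_max lexx orbT gt_max /= ltr01 andbT; lra.
  have [cT T0 TA pT] := HF _ T01; have [ct t0 tA pt] := HF _ t01.
  apply: (@lift_unique R [set` `]-oo, Num.max t 0]] (F (Num.max t 0)) (F T) 0)
    => //.
  - exact: connected_itv.
  - by move=> u _; exact: ct.
  - by move=> u _; exact: cT.
  - move=> u; rewrite /= in_itv /= => ut; split => //.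
    rewrite pt pT min_l// min_l// (le_trans ut)// ge_max tT.
    by case/andP: T01.
  - by rewrite /= in_itv /= le_max lexx orbT.
  - by rewrite T0 t0.
  - by rewrite /= in_itv /= le_max lexx.
have f0 : f 0 = e0.
  by rewrite (fE 0 0) ?lexx ?ltr01//; have [|] := HF 0; rewrite ?lexx ?ltr01.
have fA t : t < 1 -> A (f t).
  move=> t1; rewrite /f; have [|_ _ + _] := HF (Num.max t 0); last exact.
  by rewrite le_max lexx orbT gt_max /= ltr01 t1.
have pf t : t < 1 -> p (f t) = k t.
  move=> t1; rewrite /f; have [|_ _ _ ->] := HF (Num.max t 0).
    by rewrite le_max lexx orbT gt_max /= ltr01 t1.
  by rewrite min_l// le_max lexx.
have fc (T : R) : T < 1 -> continuous (fun u : R => f (Num.min u T)).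
  move=> T1; pose T' := Num.max T 0.
  have T'01 : 0 <= T' < 1 by rewrite le_max lexx orbT gt_max /= ltr01 T1.
  rewrite (_ : (fun u => _) = fun u => F T' (Num.min u T)).
    by have [cF _ _ _] := HF _ T'01; cont.
  apply/funext => u; apply: fE => //.
  by rewrite le_max ge_min lexx orbT.
(* From [t] on the path stays in [U], so all later values of [f] lie in the component of [f t];
   [chi U] will be this component, independently of [t]. *)
pose tail U (t : R) := t < 1 /\ forall u : R, t <= u -> U (k u).
have tail_ex U : open U -> U (k 1) -> exists t, tail U t.
  move=> oU Uk; have /near_ballP [e e_gt0 He] : \forall u \near (1 : R), U (k u).
    by apply: ck; exact: open_nbhs_nbhs.
  exists (1 - e / 2); split; first by lra.
  move=> u eu; have [u1|u1] := lerP 1 u; first by rewrite k1.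
  by apply: He; lra.
have tail_comp0 U (t t' : R) : tail U t -> t <= t' -> t' < 1 ->
    connected_component (p @^-1` U) (f t) (f t').
  move=> [t1 tU] tt' t'1.
  have := @path_image_component R X (p @^-1` U) (fun u => f (Num.min u t'))
    [set` `[t, t']] t t' (fc _ t'1) (@connected_itv R _).
  rewrite minxx (min_l tt') /= !in_itv /= !lexx tt'; apply => // u.
  by rewrite in_itv /= => /andP[tu ut']; rewrite min_l// pf; [exact: tU|lra].
have tail_comp U t t' : tail U t -> tail U t' ->
    connected_component (p @^-1` U) (f t) (f t').
  move=> Ht Ht'; have [tt'|/ltW tt'] := lerP t t'.
    by apply: tail_comp0 => //; case: Ht'.
  by apply: connected_component_sym; apply: tail_comp0 => //; case: Ht.
pose chi U := [set z | exists2 t, tail U t &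
  connected_component (p @^-1` U) (f t) z].
have chiE U t : tail U t -> chi U = connected_component (p @^-1` U) (f t).
  move=> Ut; apply/seteqP; split => z; last by exists t.
  by move=> [t' Ut']; apply: connected_component_trans; exact: tail_comp.
have [|||x xchi] := csp.2 (k 1) _ chi.
- move=> B nB; have /near_ballP [e e_gt0 He] : \forall u \near (1 : R), B (k u).
    exact: ck.
  exists (k (1 - e / 2)); split; last by apply: He; lra.
  by exists (f (1 - e / 2)) => //; rewrite pf//; lra.
- move=> U [oU cU Uk]; have [t Ut] := tail_ex _ oU Uk.
  exists (f t); last exact: chiE.
  by case: Ut => t1 Ut; rewrite /= pf//; exact: Ut.
- move=> U V [oU cU Uk] [oV cV Vk] UV; have [t Ut] := tail_ex _ oU Uk.
  have Vt : tail V t by case: Ut => ? Ut; split => // u /Ut /UV.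
  rewrite (chiE _ _ Ut) (chiE _ _ Vt) => z [B [Bt BU cB] Bz].
  by exists B => //; split => // v /BU; exact: UV.
(* Otherwise some connected neighborhood of [k 1] would miss [p x], although [x] belongs to a
   component over it. *)
have px : p x = k 1.
  apply: contrapT => /(hausdorff_sep hY) [V [U [oV oU Vx Uk VU]]].
  have [U' [oU' cU' U'k U'U]] := lpc_connected lY (open_nbhs_nbhs (conj oU Uk)).
  have [t _ /connected_component_sub /= /U'U Ux] := xchi U' (And3 oU' cU' U'k).
  by have : (V `&` U) (p x) by []; rewrite VU.
exists (fun t => if t < 1 then f t else x); split.
- move=> t; have [t1|t1] := ltrP t 1.
    move=> W /=; rewrite t1 => Wf.
    suff : \forall v \near t, W (if v < 1 then f v else x) by [].
    have : \forall v \near t, v < (t + 1) / 2.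
      by apply: open_nbhs_nbhs; split; [exact: open_lt|rewrite /=; lra].
    have : \forall v \near t, W (f (Num.min v ((t + 1) / 2))).
      by apply: (fc _ _ t W); [lra|rewrite min_l//; lra].
    apply: filterS2 => v + v1; rewrite min_l; last exact: ltW.
    by rewrite ifT//; lra.
  move=> W /=; rewrite ltNge t1 /= => Wx.
  suff : \forall v \near t, W (if v < 1 then f v else x) by [].
  have [U [oU cU Ux UW]] := spread_base lY csp.1 Wx.
  rewrite px in Ux.
  have [t0 Ut0 t0x] := xchi U (And3 oU cU Ux).
  have : \forall v \near t, t0 < v.
    apply: open_nbhs_nbhs; split; first exact: open_gt.
    by case: Ut0 => /= t01 _; lra.
  apply: filterS => v t0v; case: ifP => v1; last exact: nbhs_singleton.
  apply: UW; apply: connected_component_trans (connected_component_sym t0x) _.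
  by apply: tail_comp0 => //; exact: ltW.
- by rewrite ltr01.
- by move=> t; case: ifP => [/pf//|/negbT]; rewrite -leNgt px => /k1.
- by move=> t t1; rewrite t1; exact: fA.
Qed.

End lifting.

(** * The space of paths and the endpoints of their lifts *)

Lemma nbhs_setT (T : topologicalType) (x : T) : nbhs x [set: T].
Proof. exact: filterT. Qed.

Section omega_topology.
Variables (R : realType) (Y : topologicalType) (S : set Y) (y0 : Y).
Local Notation I := (unit_interval R).
Local Notation Omega := (Omega R S y0).
Local Notation D := (~` S).

Definition omega_fun (w : Omega) : I -> Y := val w.

Definition omega_path (w : Omega) (t : R) : Y := omega_fun w (clampI t).

Lemma omega_funE w i : omega_fun w i = omega_path w (val i).
Proof. by rewrite /omega_path clampIK. Qed.

Lemma omega_intro (g : I -> Y) : continuous g -> g zero = y0 ->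
  (forall i : I, 0 < val i < 1 -> D (g i)) -> exists w, omega_fun w = g.
Proof.
move=> cg g0 gD.
have H : exists y, path_through y0 y D g by exists (g one).
by exists (SigSub (mem_set (H : [set g : {compact-open, I -> Y} | _] g))).
Qed.

Lemma omega_path_opath w : D y0 -> opath S y0 (omega_path w).
Proof.
move=> Dy0; have [y [[cw w0 w1] wD]] := set_valP w; split.
- by apply: (@cont_comp _ _ _ (omega_fun w)) => //; exact: clampI_continuous.
- by move=> t t0; rewrite /omega_path clampI_le.
- by move=> t t1; rewrite /omega_path !clampI_ge.
- move=> t t1; rewrite /omega_path; have [t0|t0] := lerP t 0.
    by rewrite clampI_le ?[omega_fun w _]w0.
  by apply: wD; rewrite val_clampI clamp_id; lra.
Qed.

Lemma omega_near (w : Omega) (a b : R) (O : set Y) : open O ->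
  (forall u, a <= u <= b -> O (omega_path w u)) ->
  \forall w' \near w, forall u, a <= u <= b -> O (omega_path w' u).
Proof.
move=> oO wO.
have cK : compact (@clampI R @` `[a, b]).
  apply: continuous_compact; last exact: segment_compact.
  by apply: continuous_subspaceT; exact: clampI_continuous.
have oC := @compact_open_open I Y _ _ cK oO.
have nC : nbhs w (omega_fun @^-1` [set g | g @` (@clampI R @` `[a, b]) `<=` O]).
  apply: open_nbhs_nbhs; split; first by eexists; [exact: oC|].
  by move=> _ [_ [u /= uab <-] <-]; apply: wO; rewrite in_itv in uab.
apply: filterS nC => w' /= H u uab; apply: H; exists (clampI u) => //.
Qed.

Lemma omega_continuous (T : topologicalType) (c : T -> Omega) :
  continuous (fun x : T * I => omega_fun (c x.1) x.2) -> continuous c.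
Proof.
move=> cc; apply: continuous_comp_initial.
exact: (continuous_curry_fun cc).
Qed.

(** Not a neighborhood of [w] in general, since its elements coincide with [w] up to time [t]. But
    every neighborhood contains such a set, and changing the tail is enough to reach all nearby
    ends. *)
Definition tail_nbhs (w : Omega) (U : set Y) (t : R) : set Omega :=
  [set w' | forall i : I, (val i <= t -> omega_fun w' i = omega_fun w i) /\
                          (t <= val i -> U (omega_fun w' i))].

Definition is_tail (w : Omega) (U : set Y) (t : R) :=
  [/\ open U, connected U, 0 <= t < 1 &
      forall u, t <= u -> U (omega_path w u)].

Lemma is_tail_ex w U : D y0 -> locally_path_connected R Y ->
  nbhs (omega_path w 1) U ->
  forall t0 : R, t0 < 1 -> exists V t, [/\ is_tail w V t, V `<=` U & t0 <= t].
Proof.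
move=> Dy0 lY nU t0 t01; have [V [oV cV Vw VU]] := lpc_connected lY nU.
have [ck k0 k1 _] := omega_path_opath w Dy0.
have /near_ballP [e e0 He] : \forall u \near (1 : R), V (omega_path w u).
  by apply: ck; exact: open_nbhs_nbhs.
exists V, (Num.max (Num.max 0 t0) (1 - e / 2)); split => //; last first.
  by rewrite !le_max lexx orbT.
split => //.
  by rewrite !le_max lexx /= !gt_max ltr01 t01 /=; lra.
move=> u; rewrite ge_max => /andP[_ eu].
by have [u1|u1] := lerP 1 u; [rewrite k1|apply: He; lra].
Qed.

(** The sets that contain a tail set form a filter, so its convergence to [w] can be tested on the
    subbase of the compact-open topology. *)
Lemma tail_nbhs_sub w O : D y0 -> locally_path_connected R Y ->
  hausdorff_space I -> nbhs w O ->
  exists U t, is_tail w U t /\ tail_nbhs w U t `<=` O.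
Proof.
move=> Dy0 lY hI nO.
pose F := [set P | exists U t, is_tail w U t /\ tail_nbhs w U t `<=` P].
have Wt U t i : is_tail w U t -> t <= val i -> U (omega_fun w i).
  by move=> [_ _ _ H] ti; rewrite omega_funE; exact: H.
have FF : Filter F.
  split.
  - have [U [t [Ut _ _]]] := is_tail_ex Dy0 lY (nbhs_setT (omega_path w 1)) ltr01.
    by exists U, t.
  - move=> P Q [U [t [Ut UP]]] [V [u [Vu VQ]]].
    have nUV : nbhs (omega_path w 1) (U `&` V).
      have [oU cU /andP[_ t1] HU] := Ut; have [oV cV /andP[_ u1] HV] := Vu.
      apply: open_nbhs_nbhs; split; first exact: openI.
      by split; [apply: HU|apply: HV]; exact: ltW.
    have tu1 : Num.max t u < 1.
      have [_ _ /andP[_ t1] _] := Ut; have [_ _ /andP[_ u1] _] := Vu.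
      by rewrite gt_max t1.
    have [W [v [Wv WUV tuv]]] := is_tail_ex Dy0 lY nUV tu1.
    move: tuv; rewrite ge_max => /andP[tv uv].
    exists W, v; split => // w' Hw'; split; [apply: UP|apply: VQ] => i.
    + split => [it|ti]; first by apply: (Hw' i).1; exact: le_trans tv.
      have [iv|/ltW vi] := lerP (val i) v.
        by rewrite (Hw' i).1//; exact: (Wt _ _ _ Ut).
      by have /WUV[] := (Hw' i).2 vi.
    + split => [it|ti]; first by apply: (Hw' i).1; exact: le_trans uv.
      have [iv|/ltW vi] := lerP (val i) v.
        by rewrite (Hw' i).1//; exact: (Wt _ _ _ Vu).
      by have /WUV[] := (Hw' i).2 vi.
  - move=> P Q PQ [U [t [Ut UP]]]; exists U, t; split => //.
    exact: subset_trans PQ.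
suff : nbhs w `<=` F by exact.
move=> P [Q /= [[B oB BQ] Qw QP]].
suff : fmap (omega_fun : Omega -> {compact-open, I -> Y}) F -->
    (omega_fun w : {compact-open, I -> Y}).
  move=> /(_ B) H; have : F (omega_fun @^-1` B).
    apply: H; apply: open_nbhs_nbhs; split => //.
    by move: Qw; rewrite -BQ.
  move=> [U [t [Ut UB]]]; exists U, t; split => //.
  by apply: subset_trans QP; rewrite -BQ.
apply/compact_open_cvgP => K O' cK oO' wKO'.
have one1 : omega_path w 1 = omega_fun w one by rewrite /omega_path clampI1.
(* If [K] contains the end, [U] is taken inside [O']; otherwise the closed set [K] avoids a final
   segment, and the tail starts inside that segment. *)
have [K1|nK1] := pselect (K one).
  have nO' : nbhs (omega_path w 1) O'.
    by apply: open_nbhs_nbhs; split => //; rewrite one1; apply: wKO'; exists one.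
  have [U [t [Ut UO' _]]] := is_tail_ex Dy0 lY nO' ltr01.
  exists U, t; split => // w' Hw' _ [i Ki <-].
  have [iv|/ltW vi] := lerP (val i) t.
    by rewrite (Hw' i).1//; apply: wKO'; exists i.
  by apply: UO'; exact: (Hw' i).2.
have /near_ballP [e e0 He] : \forall u \near (1 : R), ~ K (clampI u).
  apply: (@clampI_continuous R 1 (~` K)); apply: open_nbhs_nbhs; split.
    by apply: closed_openC; exact: compact_closed.
  by rewrite clampI1.
have e1 : 1 - e / 2 < 1 by lra.
have [U [t [Ut _ et]]] := is_tail_ex Dy0 lY (nbhs_setT (omega_path w 1)) e1.
exists U, t; split => // w' Hw' _ [i Ki <-].
have [iv|vi] := lerP (val i) t.
  by rewrite (Hw' i).1//; apply: wKO'; exists i.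
exfalso; apply: (He (val i)); last by rewrite clampIK.
have := val_unit_itv i; lra.
Qed.

End omega_topology.

Lemma hausdorff_inj (T U : topologicalType) (f : T -> U) :
  hausdorff_space U -> continuous f -> injective f -> hausdorff_space T.
Proof.
move=> hU cf fI; rewrite open_hausdorff => x y xy.
have /(hausdorff_sep hU) [A [B [oA oB Ax By AB]]] : f x <> f y.
  by move=> /fI fxy; rewrite fxy eqxx in xy.
exists (f @^-1` A, f @^-1` B) => /=; first by rewrite !inE.
split; [by apply: open_comp => // z _; exact: cf..|].
by rewrite -preimage_setI AB preimage_set0.
Qed.

Lemma hausdorff_unit_interval (R : realType) : hausdorff_space (unit_interval R).
Proof.
apply: (hausdorff_inj (f := fun i : unit_interval R => val i : R)).
- exact: Rhausdorff.
- exact: val_continuous.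
- exact: val_inj.
Qed.

(** * The end of the lift as a function of the path *)

Section endpoint_of_lift.
Variables (R : realType) (X Y : topologicalType) (p : X -> Y).
Variables (A : set X) (S : set Y) (e0 : X).
Local Notation I := (unit_interval R).
Local Notation D := (~` S).
Local Notation y0 := (p e0).
Local Notation Omega := (Omega R S y0).
Hypotheses (aX : admissible_space R X) (aY : admissible_space R Y).
Hypotheses (cX : connected [set: X]).
Hypotheses (prA : portly A) (pA : forall a, A a -> D (p a)).
Hypotheses (csp : complete_spread p) (shp : sheeted p A S) (Ae0 : A e0).
Variable lift : Omega -> R -> X.
Hypothesis liftP : forall w, is_lift p A e0 (omega_path w) (lift w).

Let hX : hausdorff_space X. Proof. by case: aX. Qed.
Let lX : locally_path_connected R X. Proof. by case: aX. Qed.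
Let fX : first_countable X. Proof. by case: aX. Qed.
Let hY : hausdorff_space Y. Proof. by case: aY. Qed.
Let lY : locally_path_connected R Y. Proof. by case: aY. Qed.
Let cp : continuous p. Proof. by case: csp => -[]. Qed.
Let oA : open A. Proof. by case: prA. Qed.
Let Dy0 : D y0. Proof. exact: pA. Qed.
Let liftC w : continuous (lift w). Proof. by case: (liftP w). Qed.
Let lift0 w : lift w 0 = e0. Proof. by case: (liftP w). Qed.
Let liftE w t : p (lift w t) = omega_path w t. Proof. by case: (liftP w). Qed.
Let liftA w (t : R) : t < 1 -> A (lift w t).
Proof. by case: (liftP w) => _ _ _; apply. Qed.
Let pathC (w : Omega) : continuous (omega_path w).
Proof. by have [] := omega_path_opath w Dy0. Qed.

(** Elements of [Omega] are produced by constructing their lifts: by uniqueness, a path of [X] is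
    the lift of its projection. *)
Lemma omega_of_lift (g : R -> X) : continuous g -> g 0 = e0 ->
  (forall t : R, t < 1 -> A (g t)) -> exists w : Omega,
    (forall i, omega_fun w i = p (g (val i))) /\
    (forall t : R, 0 <= t <= 1 -> lift w t = g t).
Proof.
move=> cg g0 gA.
have [|||w wE] := @omega_intro R Y S y0 (fun i => p (g (val i))).
- by cont; exact: val_continuous.
- by rewrite /= g0.
- by move=> i /andP[_ i1]; apply/pA/gA.
exists w; split => [i|t t01]; first by rewrite wE.
rewrite -[in RHS](clamp_id t01).
have gl : is_lift p A e0 (omega_path w) (fun t => g (clamp 0 1 t)).
  split => //.
  - by cont.
  - by rewrite clamp_id// lexx ler01.
  - by move=> u; rewrite /omega_path wE val_clampI.
  - move=> u u1; apply: gA; have [u0|u0] := lerP u 0; first by rewrite clamp_le.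
    by rewrite clamp_id//; lra.
by apply: (is_lift_unique hX pA shp (liftP w) gl); case/andP: t01.
Qed.

(** Reroutes a lift after time [t0] inside [W]. With [W] the whole space this gives surjectivity,
    with [W] a component over a small open set it gives openness. *)
Lemma lift_portly_path (w : Omega) (W : set X) (t0 : R) x :
  open W -> connected W -> 0 <= t0 < 1 -> W (lift w t0) -> W x ->
  exists w' : Omega, [/\ lift w' 1 = x,
    forall i, val i <= t0 -> omega_fun w' i = omega_fun w i &
    forall i, t0 <= val i -> (p @` W) (omega_fun w' i)].
Proof.
move=> oW cW /andP[t00 t01] Wt Wx.
have [g [cg g0 g1 gA]] := portly_path lX fX prA oW cW Wt (liftA w t01) Wx.
have t0n : 1 - t0 != 0 by lra.
pose h (t : R) := if t <= t0 then lift w t else g ((t - t0) / (1 - t0)).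
have ch : continuous h.
  apply: (@cont_glue R R X) => //; cont.
  by move=> t ->; rewrite subrr mul0r g0.
have [|||w' [w'E liftw']] := @omega_of_lift h.
- exact: ch.
- by rewrite /h t00 lift0.
- move=> t t1; rewrite /h; case: ifP => [_|tt0]; first exact: liftA.
  by apply: (gA _ _).2; rewrite ltr_pdivrMr; lra.
exists w'; split.
- rewrite liftw'; last by rewrite ler01 lexx.
  by rewrite /h leNgt t01 /= divff// g1.
- by move=> i it; rewrite w'E /h it liftE omega_funE.
- move=> i ti; rewrite w'E /h.
  have [it|it] := lerP (val i) t0.
    have -> : val i = t0 by lra.
    by exists (lift w t0).
  eexists; last by [].
  have [i1|i1] := ltrP ((val i - t0) / (1 - t0)) 1; first by have [] := gA _ i1.
  by rewrite g1.
Qed.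

Lemma lift_end_surj x : exists w, lift w 1 = x.
Proof.
have [w _] := omega_of_lift (@cont_cst R X e0) erefl (fun _ _ => Ae0).
have [|||||w' []] := @lift_portly_path w setT 0 x; last by exists w'.
all: by rewrite ?lexx ?ltr01//; exact: openT.
Qed.

(** The hypotheses say that [A] lies over [D], not that it is the whole preimage. A path that stays
    in [D] up to its end is lifted by sheets alone, hence inside [A]. *)
Lemma lift_end_in w : D (omega_path w 1) -> A (lift w 1).
Proof.
move=> Dw; have [ck k0 k1 kD] := omega_path_opath w Dy0.
have kD' t : D (omega_path w t).
  by have [t1|t1] := ltrP t 1; [exact: kD|rewrite k1].
have [||f [cf f0 fA pf]] :=
    @lift_interval _ _ _ p A S shp (omega_path w) e0 ck kD' _ Ae0 _ 1 ler01.
- by move=> t t0; rewrite !k0.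
- by rewrite k0.
rewrite (_ : lift w 1 = f 1); first exact: fA.
apply: (@is_lift_unique _ _ _ p A S hX pA shp e0 _ _ _ (liftP w)) => //.
split => // t; rewrite pf; have [t1|t1] := leP t 1; first by [].
by rewrite k1// ltW.
Qed.

Let lift_near w (t : R) := forall W, nbhs (lift w t) W ->
  \forall w' \near w, W (lift w' t).

(** Paths near [w] stay over [U] between the two times, so their lifts stay in one sheet and are
    read off from the paths by its section. *)
Let lift_near_step w U (t1 t2 : R) : evenly_covered p A S U -> 0 <= t1 < 1 ->
  0 <= t2 < 1 ->
  (forall u, Num.min t1 t2 <= u <= Num.max t1 t2 -> U (omega_path w u)) ->
  lift_near w t1 -> lift_near w t2.
Proof.
move=> [oU UD ecU] /andP[t10 t11] /andP[t20 t21] wU near1 W Wt2.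
set a := Num.min t1 t2; set b := Num.max t1 t2.
have ab1 : a <= t1 <= b by rewrite ge_min le_max !lexx.
have ab2 : a <= t2 <= b by rewrite ge_min le_max !lexx !orbT.
have b1 : b < 1 by rewrite gt_max t11.
have [|C [s [C1 sh]]] := ecU _ (liftA w t11); first by rewrite liftE; exact: wU.
have [oC CA sU sC _] := sh.
have stay w' : (forall u, a <= u <= b -> U (omega_path w' u)) ->
    C (lift w' t1) -> C (lift w' t2).
  move=> w'U C1'; apply: (@sheet_stay _ _ p A R [set` `[a, b]] (lift w') U C s t1)
    => //=; rewrite ?in_itv//.
  - exact: connected_itv.
  - by move=> u _; exact: liftC.
  - move=> u; rewrite in_itv /= => uab; split; last by rewrite liftE; exact: w'U.
    by apply: liftA; case/andP: uab => _ ub; exact: le_lt_trans b1.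
have [_ ps cs] := sU _ (wU _ ab2).
have sW : nbhs (omega_path w t2) (s @^-1` W).
  by apply: cs; rewrite -liftE sC//; exact: stay.
move: sW; rewrite nbhsE => -[V [oV Vt2] VW].
have n1 : \forall w' \near w, forall u, a <= u <= b -> U (omega_path w' u).
  exact: omega_near.
have n2 : \forall w' \near w, V (omega_path w' t2).
  have : \forall w' \near w, forall u, t2 <= u <= t2 -> V (omega_path w' u).
    apply: omega_near => // u ut2; suff -> : u = t2 by [].
    by apply/eqP; rewrite eq_le andbC.
  by apply: filterS => w' H; apply: H; rewrite lexx.
have n3 : \forall w' \near w, C (lift w' t1).
  by apply: near1; exact: open_nbhs_nbhs.
near=> w'.
have C2 : C (lift w' t2) by apply: stay; near: w'.
rewrite -(sC _ C2) liftE; apply: VW.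
by near: w'.
Unshelve. all: by end_near. Qed.

Lemma lift_near_lt1 w (t : R) : 0 <= t < 1 -> lift_near w t.
Proof.
move=> t01.
apply: (@connected_ind R [set` `[0, 1[] (lift_near w) _ _ 0 t).
- exact: connected_itv.
- move=> {t01}u; rewrite /= in_itv /= => u01.
  have Du : D (omega_path w u).
    have [_ _ _] := omega_path_opath w Dy0; apply.
    by case/andP: u01.
  have [U ecU Uu] := shp Du; have [oU _ _] := ecU.
  have /near_ballP [e e_gt0 He] : \forall v \near u, U (omega_path w v).
    by apply: (pathC (w := w)); exact: open_nbhs_nbhs.
  apply/near_ballP; exists e => // v uv; rewrite in_itv /= => v01.
  have H x : Num.min u v <= x <= Num.max u v -> U (omega_path w x).
    rewrite ge_min le_max => /andP[] /orP[?|?] /orP[?|?]; apply: He; lra.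
  split; apply: (lift_near_step ecU) => //.
  by move=> x; rewrite minC maxC; exact: H.
- by rewrite /= in_itv /= lexx ltr01.
- by rewrite /= in_itv.
- move=> W W0; near=> w'; rewrite lift0; apply: nbhs_singleton.
  by rewrite -(lift0 w).
Unshelve. all: by end_near. Qed.

(** No sheet is available at time 1. Paths near [w] stay in [V] from time [t] on, so the end of
    their lift lies in the component over [U] that contains the lift at time [t]. *)
Lemma lift_end_continuous : continuous (fun w => lift w 1).
Proof.
move=> w W Wx.
have [U [oU cU Uy UW]] := spread_base lY csp.1 Wx.
have [ck k0 k1 _] := omega_path_opath w Dy0.
have nU : nbhs (omega_path w 1) U by rewrite -liftE; exact: open_nbhs_nbhs.
have [V [t [[oV cV t01 Vt] VU _]]] := is_tail_ex Dy0 lY nU ltr01.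
set C := connected_component (p @^-1` U) (lift w 1).
have comp w' : (forall u, t <= u <= 1 -> V (omega_path w' u)) ->
    connected_component (p @^-1` U) (lift w' t) (lift w' 1).
  move=> w'V; apply: (@path_image_component R X _ (lift w') [set` `[t, 1]]).
  - exact: liftC.
  - exact: connected_itv.
  - by move=> u; rewrite /= in_itv /= liftE => /w'V /VU.
  - by rewrite /= in_itv /= lexx; lra.
  - by rewrite /= in_itv /= lexx; lra.
have n1 : \forall w' \near w, forall u, t <= u <= 1 -> V (omega_path w' u).
  by apply: omega_near => // u /andP[+ _]; exact: Vt.
have n2 : \forall w' \near w, C (lift w' t).
  apply: lift_near_lt1 => //; apply: open_nbhs_nbhs; split.
    by apply: (component_preimage_open lX csp).
  apply: connected_component_sym; apply: comp => u /andP[+ _]; exact: Vt.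
suff : \forall w' \near w, W (lift w' 1) by [].
near=> w'; apply: UW; apply: (connected_component_trans (y := lift w' t)).
  by near: w'.
by apply: comp; near: w'.
Unshelve. all: by end_near. Qed.

(** Rerouting [w] after time [t] inside the component of its end over [U] reaches every point of
    this component by a path of [tail_nbhs], hence of [O]. *)
Lemma lift_end_open w O : nbhs w O ->
  nbhs (lift w 1) ((fun w => lift w 1) @` O).
Proof.
move=> nO.
have [U [t [Ut UO]]] := tail_nbhs_sub Dy0 lY (@hausdorff_unit_interval R) nO.
have [oU cU t01 HU] := Ut; have /andP[t0 t1] := t01.
have Cx : connected_component (p @^-1` U) (lift w 1) (lift w t).
  apply: (@path_image_component R X _ (lift w) [set` `[t, 1]]).
  - exact: liftC.
  - exact: connected_itv.
  - by move=> u; rewrite /= in_itv /= liftE => /andP[/HU].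
  - by rewrite /= in_itv /= lexx ltW.
  - by rewrite /= in_itv /= lexx ltW.
apply: (@filterS _ _ _ (connected_component (p @^-1` U) (lift w 1))); last first.
  apply: open_nbhs_nbhs; split; first exact: (component_preimage_open lX csp).
  by apply: connected_component_refl; rewrite /= liftE; exact/HU/ltW.
move=> x xC.
have [|||||w' [w'x w'w w'U]] := @lift_portly_path w
    (connected_component (p @^-1` U) (lift w 1)) t x.
- exact: (component_preimage_open lX csp).
- exact: component_connected.
- by [].
- by [].
- by [].
exists w' => //; apply: UO => i; split; first exact: w'w.
by move=> /w'U [z /connected_component_sub Uz <-].
Qed.

(** The loop that compares two paths is the projection of a path of [X], from the end of the first
    lift to the end of the second and through [e0] at time 1/2. Both implications below are about
    this path. *)
Lemma concat_reverseE w1 w2 :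
  concat_path (reverse_path (omega_fun w1)) (omega_fun w2) =
  fun i => p (concatR (fun t => lift w1 (1 - t)) (lift w2) (val i)).
Proof.
apply/funext => i; have i01 := val_unit_itv i.
rewrite /concat_path /concatR /reverse_path; case: ifP => i2.
  rewrite liftE /omega_path !to_unit_intervalE ?val_clampI ?clamp_id//; lra.
move/negbT: i2; rewrite -ltNge => i2.
rewrite liftE /omega_path to_unit_intervalE//; lra.
Qed.

Let loop w1 w2 := concatR (fun t => lift w1 (1 - t)) (lift w2).

Let loopC w1 w2 : continuous (loop w1 w2).
Proof.
apply: concatR_continuous; [by cont; exact: liftC|exact: liftC|].
by rewrite subrr !lift0.
Qed.

Let loop0 w1 w2 : loop w1 w2 0 = lift w1 1.
Proof. by rewrite /loop concatR0 subr0. Qed.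

Let loop1 w1 w2 : loop w1 w2 1 = lift w2 1.
Proof. by rewrite /loop concatR1. Qed.

Let loopA w1 w2 (t : R) : 0 < t < 1 -> A (loop w1 w2 t).
Proof.
move=> t01; rewrite /loop /concatR; case: ifP => ?; apply: liftA; lra.
Qed.

Let lift1E w : p (lift w 1) = omega_fun w one.
Proof. by rewrite liftE /omega_path clampI1. Qed.

(** The form in which simple connectedness of the unbranched part is used. *)
Definition homotopy_unique := forall f g : R -> X, continuous f ->
  continuous g -> (forall t, A (f t)) -> (forall t, A (g t)) ->
  f 0 = g 0 -> f 1 = g 1 -> exists H : R * R -> X,
  [/\ continuous H, forall t, 0 <= t <= 1 -> H (0, t) = f t,
      forall t, 0 <= t <= 1 -> H (1, t) = g t,
      forall s, H (s, 0) = f 0 /\ H (s, 1) = f 1 & forall z, A (H z)].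

(* The middle part of the loop is deformed into a path lying over a small
   neighborhood of the base point, the two ends being left unchanged. *)
Lemma lift_end_almost_homotopic w1 w2 : homotopy_unique ->
  lift w1 1 = lift w2 1 -> almost_homotopic D (omega_fun w1) (omega_fun w2).
Proof.
move=> hu w12; split; first by rewrite -!lift1E w12.
rewrite concat_reverseE -/(loop w1 w2) -lift1E.
set x := lift w1 1; set c := loop w1 w2.
have cc : continuous c := @loopC w1 w2.
have c0 : c 0 = x by exact: loop0.
have c1 : c 1 = x by rewrite /c loop1.
have vC := @val_continuous R.
split.
  split; last by move=> t t01; apply/pA/loopA.
  by split; [cont|rewrite c0|rewrite c1].
move=> V oV Vx; have nV := open_nbhs_nbhs (conj oV Vx).
have [U [oU cU Ux UV]] := lpc_connected lY nV.
set C := connected_component (p @^-1` U) x.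
have oC : open C by exact: (component_preimage_open lX csp).
have Cx : C x by exact: connected_component_refl.
have /near_ballP [e1 e1_gt0 He1] : \forall u \near (0 : R), C (c u).
  by apply: cc; apply: open_nbhs_nbhs; rewrite c0.
have /near_ballP [e2 e2_gt0 He2] : \forall u \near (1 : R), C (c u).
  by apply: cc; apply: open_nbhs_nbhs; rewrite c1.
have [e [e_gt0 e4 ee1 ee2]] : exists e : R, [/\ 0 < e, e < 4^-1, e < e1 & e < e2].
  exists (Num.min 8^-1 (Num.min (e1 / 2) (e2 / 2))); split.
  - by rewrite !lt_min !divr_gt0// invr_gt0 ltr0n.
  - by rewrite gt_min; apply/orP; left; lra.
  - by rewrite !gt_min; apply/orP; right; apply/orP; left; lra.
  - by rewrite !gt_min; apply/orP; right; apply/orP; right; lra.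
have C_le (t : R) : 0 <= t <= e -> C (c t) by move=> ?; apply: He1; lra.
have C_ge (t : R) : 1 - e <= t <= 1 -> C (c t) by move=> ?; apply: He2; lra.
have e2p : 0 < 1 - 2 * e by lra.
have e2n := lt0r_neq0 e2p.
pose f (u : R) := c (e + (1 - 2 * e) * clamp 0 1 u).
have f0 : f 0 = c e by rewrite /f clamp_id ?lexx ?ler01// mulr0 addr0.
have f1 : f 1 = c (1 - e).
  by rewrite /f clamp_id ?lexx ?ler01// mulr1; congr c; lra.
(* [C] is open and connected, so its trace on the portly set [A] is connected: the middle of the
   loop gets a replacement over [U] that stays in [A]. *)
have [g [cg g0 g1 gCA]] : joined R (C `&` A) (c e) (c (1 - e)).
  apply: open_joined => //.
  - exact: openI.
  - by case: prA => _ _; apply => //; exact: component_connected.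
  - by split; [apply: C_le|apply: loopA]; lra.
  - by split; [apply: C_ge|apply: loopA]; lra.
have [||||||K [cK K0 K1 Kst KA]] := hu f g.
- by rewrite /f; cont.
- by [].
- by move=> t; apply: loopA; have := @clamp_itv R 0 1 t ler01; nra.
- by move=> t; have [] := gCA t.
- by rewrite f0 g0.
- by rewrite f1 g1.
pose H (z : R * R) := if z.2 <= e then c z.2 else
  if z.2 <= 1 - e then K (z.1, (z.2 - e) / (1 - 2 * e)) else c z.2.
have cH : continuous H.
  apply: (@cont_glue R) => //; cont.
    apply: (@cont_glue R) => //; cont.
    move=> z ->; rewrite (_ : _ / _ = 1); first by rewrite (Kst _).2 f1.
    by rewrite (_ : 1 - e - e = 1 - 2 * e) ?divff//; lra.
  move=> z ->; rewrite ifT; last by lra.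
  by rewrite subrr mul0r (Kst _).1 f0.
have H01 s : H (s, 0) = c 0 /\ H (s, 1) = c 1.
  rewrite /H /= ltW//; split => //.
  by rewrite leNgt ifF ?ifF//; apply/negbTE; rewrite -?leNgt -?ltNge; lra.
have HA s t : 0 < t < 1 -> A (H (s, t)).
  by move=> t01; rewrite /H /=; do 2?case: ifP => // _; exact: loopA.
have H1U (t : R) : 0 < t < 1 -> V (p (H (1, t))).
  move=> t01; apply: UV; suff /connected_component_sub : C (H (1, t)) by [].
  rewrite /H /=; case: ifP => te; first by apply: C_le; lra.
  move/negbT: te; rewrite -ltNge => te.
  case: ifP => te'; last first.
    by move/negbT: te'; rewrite -ltNge => te'; apply: C_ge; lra.
  rewrite K1; first by have [] := gCA ((t - e) / (1 - 2 * e)).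
  by rewrite ler_pdivlMr ?ler_pdivrMr; lra.
have H0c (t : R) : H (0, t) = c t.
  rewrite /H /=; case: ifP => // te; case: ifP => // te'.
  move/negbT: te; rewrite -ltNge => te.
  rewrite K0 /f; last by rewrite ler_pdivlMr ?ler_pdivrMr; lra.
  rewrite clamp_id; last by rewrite ler_pdivlMr ?ler_pdivrMr; lra.
  by rewrite mulrC divfK//; congr c; lra.
exists (fun i : I => p (H (1, val i))).
  split; last by move=> t t01; split; [exact: H1U|exact/pA/HA].
  split.
  - by cont.
  - by rewrite (H01 _).1 c0.
  - by rewrite (H01 _).2 c1.
exists (fun z : I * I => p (H (val z.1, val z.2))); split.
- by cont; [exact: val_fst_continuous|exact: val_snd_continuous].
- by move=> t; rewrite /= H0c.
- by [].
- by move=> s; rewrite !(H01 _).1 !(H01 _).2.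
- by move=> s t t01; apply/pA/HA.
Qed.

(* A homotopy through [D] is lifted along the segments issued from the middle
   of the loop, over which it is constantly [y0]. *)
Lemma almost_homotopic_lift_end w1 w2 :
  almost_homotopic D (omega_fun w1) (omega_fun w2) -> lift w1 1 = lift w2 1.
Proof.
move=> [w12]; rewrite concat_reverseE -/(loop w1 w2) -lift1E => -[_ at12].
set c := loop w1 w2 in at12.
have cc : continuous c := @loopC w1 w2.
have c0 : c 0 = lift w1 1 by exact: loop0.
have c1 : c 1 = lift w2 1 by exact: loop1.
apply: contrapT => /(hausdorff_sep hX) [W1 [W2 [oW1 oW2 W1x W2x W12]]].
have p12 : p (lift w2 1) = p (lift w1 1) by rewrite !lift1E w12.
have [U1 [oU1 _ U1x U1W]] := spread_base lY csp.1 (open_nbhs_nbhs (conj oW1 W1x)).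
have [U2 [oU2 _ U2x U2W]] := spread_base lY csp.1 (open_nbhs_nbhs (conj oW2 W2x)).
pose U := U1 `&` U2; have oU : open U by exact: openI.
have Ux : U (p (lift w1 1)) by split; rewrite // -p12.
(* The component over [U1] through the first end lies in [W1], so joining the two ends over [U]
   contradicts the separation. *)
suff x12 : connected_component (p @^-1` U) (lift w1 1) (lift w2 1).
  suff : (W1 `&` W2) (lift w2 1) by rewrite W12.
  split => //; apply: U1W.
  by case: x12 => B [Bx BU cB] B2; exists B => //; split => // z /BU [].
have [g' [[cg' g'0 g'1] g'UD] [H [cH H0 H1 Hst HD]]] := at12 U oU Ux.
pose HR (z : R * R) := H (clampI z.1, clampI z.2).
have cHR : continuous HR.
  by have cl := @clampI_continuous R; rewrite /HR; cont.
have HR0 (t : R) : 0 <= t <= 1 -> HR (0, t) = p (c t).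
  by move=> t01; rewrite /HR clampI0 H0 val_clampI clamp_id.
have HR1 (t : R) : 0 < t < 1 -> U (HR (1, t)).
  move=> t01; rewrite /HR clampI1 H1; have [] := g'UD (clampI t) _ => //.
  by rewrite val_clampI clamp_id//; lra.
have HRD (s t : R) : 0 < t < 1 -> D (HR (s, t)).
  move=> t01; apply: HD; rewrite val_clampI clamp_id //.
  by case/andP: t01 => *; rewrite !ltW.
(* Tube lemma, by compactness of the range of the deformation parameter. *)
have nearU (t0 : R) : (forall s, U (HR (s, t0))) ->
    \forall t \near t0, forall s : R, 0 <= s <= 1 -> U (HR (s, t)).
  move=> Ut0; have cI := @segment_compact R 0 1.
  have /compact_near_coveringP/near_covering_withinP nc := cI.
  have := nc R (nbhs t0) (fun t s => U (HR (s, t))) _ _.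
  move=> /(_ _ _) HH.
  have : \forall t \near t0, `[0, 1] `<=` [set s | U (HR (s, t))].
    apply: HH => s _.
    have : nbhs (s, t0) (HR @^-1` U).
      by apply: cHR; exact: open_nbhs_nbhs.
    move=> [[P Q] /= [Ps Qt] PQ]; exists (P, Q) => //= -[s' t'] /= [Ps' Qt'] _.
    exact: (PQ (s', t')).
  by apply: filterS => t Ht s s01; apply: Ht; rewrite /= in_itv.
have /near_ballP [e1 e1_gt0 He1] :
    \forall t \near (0 : R), forall s : R, 0 <= s <= 1 -> U (HR (s, t)).
  by apply: nearU => s; rewrite /HR clampI0 (Hst _).1 c0.
have /near_ballP [e2 e2_gt0 He2] :
    \forall t \near (1 : R), forall s : R, 0 <= s <= 1 -> U (HR (s, t)).
  by apply: nearU => s; rewrite /HR clampI1 (Hst _).2 c1 p12.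
have [e [e_gt0 e4 ee1 ee2]] : exists e : R, [/\ 0 < e, e < 4^-1, e < e1 & e < e2].
  exists (Num.min 8^-1 (Num.min (e1 / 2) (e2 / 2))); split.
  - by rewrite !lt_min !divr_gt0// invr_gt0 ltr0n.
  - by rewrite gt_min; apply/orP; left; lra.
  - by rewrite !gt_min; apply/orP; right; apply/orP; left; lra.
  - by rewrite !gt_min; apply/orP; right; apply/orP; right; lra.
have e1e : e <= 1 - e by lra.
(* Image of the segment from [(0, 1/2)] to [z], run through by [r]. Clamping the time of [z] away
   from 0 and 1 keeps the segment where the homotopy avoids [S]. *)
pose ray (z : R * R) (r : R) :=
  HR (z.1 * r, 2^-1 + r * (clamp e (1 - e) z.2 - 2^-1)).
have rayD z (r : R) : 0 <= r <= 1 -> D (ray z r).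
  move=> r01; apply: HRD; have := clamp_itv z.2 e1e; nra.
have ray0 z : ray z 0 = y0.
  rewrite /ray !mulr0 mul0r addr0 HR0; last by lra.
  by rewrite /c /loop /concatR lexx mulfV// subrr lift0.
have /choice [sq sqE] : forall z : R * R, exists w : Omega,
    omega_fun w = fun i => ray z (val i).
  move=> z; apply: omega_intro; last first.
  - by move=> i i01; apply: rayD; exact: val_unit_itv.
  - exact: ray0.
  - by have vC := @val_continuous R; rewrite /ray; cont.
(* A jointly continuous family of paths is continuous for the compact-open topology; hence [F], the
   end of the lift, is a continuous lift of the clamped homotopy. *)
have csq : continuous sq.
  apply: omega_continuous.
  rewrite (_ : (fun _ => _) = fun x : ((R * R) * I)%type => ray x.1 (val x.2)).
    by have vC := @val_snd_continuous R (R * R)%type; rewrite /ray; cont.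
  by apply/funext => x; rewrite sqE.
pose F z := lift (sq z) 1.
have cF : continuous F.
  exact: (@cont_comp _ _ _ (fun w => lift w 1) sq lift_end_continuous csq).
have sq1 z : omega_path (sq z) 1 = HR (z.1, clamp e (1 - e) z.2).
  rewrite /omega_path clampI1 sqE /ray /= mulr1 mul1r; congr (HR (_, _)); lra.
have pF z : p (F z) = HR (z.1, clamp e (1 - e) z.2) by rewrite liftE sq1.
have FA z : A (F z).
  by apply: lift_end_in; rewrite sq1; apply: HRD; have := clamp_itv z.2 e1e; lra.
have F0 t : e <= t <= 1 - e -> F (0, t) = c t.
  move=> te; apply: (@lift_unique _ _ p A S hX pA shp R [set` `[e, 1 - e]]
    (fun t : R => F (0, t)) c 2^-1).
  - exact: connected_itv.
  - move=> u _; have cF0 : continuous (fun t : R => F (0, t)) by cont.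
    exact: cF0.
  - by move=> u _; exact: cc.
  - move=> u; rewrite /= in_itv /= => ue; split => //.
      by apply: loopA; lra.
    by rewrite pF /= clamp_id// HR0//; lra.
  - by rewrite /= in_itv /=; lra.
  - rewrite /c /loop /concatR lexx mulfV// subrr lift0.
    have gl : is_lift p A e0 (omega_path (sq (0, 2^-1))) (fun _ => e0).
      split => //; first by cont.
      move=> u; rewrite /omega_path sqE /ray /= mul0r clamp_id; last by lra.
      rewrite subrr mulr0 addr0 HR0; last by lra.
      by rewrite /c /loop /concatR lexx mulfV// subrr lift0.
    by apply: (is_lift_unique hX pA shp (liftP _) gl).
  - by rewrite /= in_itv.
have comp (f : R -> X) (a b : R) : continuous f -> a <= b ->
    (forall t, a <= t <= b -> U (p (f t))) ->
    connected_component (p @^-1` U) (f a) (f b).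
  move=> cf ab fU.
  apply: (@path_image_component R X _ f [set` `[a, b]] _ _ cf
    (@connected_itv R _)); rewrite /= ?in_itv /= ?lexx ?ab//.
(* Route over [U] between the two ends: along [c] up to time [e], around the three other sides of
   the square through [F], then along [c] from time [1 - e]. *)
rewrite -c0 -c1.
have s1 : connected_component (p @^-1` U) (c 0) (c e).
  by apply: comp => //; [lra|move=> t te; rewrite -HR0; [apply: He1|]]; lra.
have s2 : connected_component (p @^-1` U) (F (0, e)) (F (1, e)).
  apply: (comp (fun s => F (s, e))); [by cont|lra|move=> s s01].
  by rewrite pF clamp_id /=; [apply: He1|]; lra.
have s3 : connected_component (p @^-1` U) (F (1, e)) (F (1, 1 - e)).
  apply: (comp (fun t => F (1, t))); [by cont|lra|move=> t te].
  by rewrite pF clamp_id //=; apply: HR1; lra.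
have s4 : connected_component (p @^-1` U) (F (0, 1 - e)) (F (1, 1 - e)).
  apply: (comp (fun s => F (s, 1 - e))); [by cont|lra|move=> s s01].
  by rewrite pF clamp_id /=; [apply: He2|]; lra.
have s5 : connected_component (p @^-1` U) (c (1 - e)) (c 1).
  by apply: comp => //; [lra|move=> t te; rewrite -HR0; [apply: He2|]]; lra.
rewrite F0 in s2; last by lra.
rewrite F0 in s4; last by lra.
apply: connected_component_trans s1 (connected_component_trans s2 _).
apply: connected_component_trans s3 _.
exact: connected_component_trans (connected_component_sym s4) s5.
Qed.

End endpoint_of_lift.

(** * Universal branched coverings as quotients of the space of paths *)

Lemma embedding_lift (R : realType) (E X : topologicalType) (i : E -> X)
    (f : R -> X) : embedding i -> continuous f -> (forall t, range i (f t)) ->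
  exists2 f' : R -> E, continuous f' & forall t, i (f' t) = f t.
Proof.
move=> [_ iO] cf fi.
have /choice [f' f'E] : forall t, exists e, i e = f t.
  by move=> t; have [e _ <-] := fi t; exists e.
exists f' => //; apply/continuousP => U /iO [V oV ->].
rewrite -comp_preimage (_ : i \o f' = f); last by apply/funext => t; exact: f'E.
by apply: open_comp => // t _; exact: cf.
Qed.

(* The null-homotopy of the loop [f g^-1] is constant on three sides of the
   square; the segments joining the points of these sides to the middle of the
   fourth one sweep a homotopy from [f] to [g]. *)
Lemma simply_connected_homotopy_unique (R : realType) (E X : topologicalType)
    (i : E -> X) : embedding i -> continuous i -> simply_connected R E ->
  homotopy_unique R (range i).
Proof.
move=> ei ci [_ scE] f g cf cg fi gi fg0 fg1.
have [f' cf' f'E] := embedding_lift ei cf fi.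
have [g' cg' g'E] := embedding_lift ei cg gi.
have [iI _] := ei.
have fg0' : f' 0 = g' 0 by apply: iI; rewrite f'E g'E.
have fg1' : f' 1 = g' 1 by apply: iI; rewrite f'E g'E.
pose l := concatR f' (fun t => g' (1 - t)).
have cl : continuous l.
  by apply: concatR_continuous => //; [cont|rewrite subr0].
have l0 : l 0 = f' 0 by rewrite /l concatR0.
have l1 : l 1 = f' 0 by rewrite /l concatR1 subrr.
have [|N [cN N0 N1 Nst _]] := scE (f' 0) (fun j : unit_interval R => l (val j)).
  by split; rewrite ?l0 ?l1//; cont; exact: val_continuous.
pose NR (z : R * R) := N (clampI z.1, clampI z.2).
have cNR : continuous NR by have cI := @clampI_continuous R; rewrite /NR; cont.
have NR0 (t : R) : 0 <= t <= 1 -> NR (0, t) = l t.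
  by move=> t01; rewrite /NR clampI0 N0 val_clampI clamp_id.
have NR1 (t : R) : NR (1, t) = f' 0 by rewrite /NR clampI1 N1.
have NRs0 (s : R) : NR (s, 0) = f' 0 by rewrite /NR clampI0 (Nst _).1 l0.
have NRs1 (s : R) : NR (s, 1) = f' 0 by rewrite /NR clampI1 (Nst _).2 l1.
(* [(s1 s, s2 s)] runs along three sides of the square: from [(0, 0)] to [(1, 0)], then [(1, 1)],
   then [(0, 1)]. [K s] follows the segment from this point to [(0, 1/2)]; it reads [f'] at [s = 0]
   and [g'] at [s = 1]. *)
pose s1 (s : R) := Num.min 1 (Num.min (3 * s) (3 - 3 * s)).
pose s2 (s : R) := clamp 0 1 (3 * s - 1).
pose K (s t : R) := NR ((1 - t) * s1 s, (1 - t) * s2 s + t * 2^-1).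
pose H (z : R * R) := K (clamp 0 1 z.1) (clamp 0 1 z.2).
have l2 : l 2^-1 = f' 1 by rewrite /l /concatR lexx mulfV.
have K1 (s : R) : K s 1 = f' 1.
  rewrite /K subrr !mul0r add0r mul1r NR0; last by lra.
  exact: l2.
have K0 (s : R) : 0 <= s <= 1 -> K s 0 = f' 0.
  move=> s01; rewrite /K subr0 !mul1r mul0r addr0 /s1 /s2.
  have [s3|s3] := lerP s 3^-1; first by rewrite clamp_le//; lra.
  have [s3'|s3'] := lerP s (2 / 3); last by rewrite clamp_ge//; lra.
  by rewrite min_l// le_min; lra.
have H0 (s : R) : H (s, 0) = f' 0.
  rewrite /H /= (@clamp_id R 0 1 0) ?lexx ?ler01// K0//.
  by apply: clamp_itv; exact: ler01.
have H1 (s : R) : H (s, 1) = f' 1.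
  by rewrite /H /= (@clamp_id R 0 1 1) ?lexx ?ler01.
exists (fun z => i (H z)); split.
- have cH : continuous H by rewrite /H /K /s1 /s2; cont.
  by cont.
- move=> t t01; rewrite -f'E /H /= !clamp_id ?lexx ?ler01//; congr i.
  rewrite /K /s1 /s2 (_ : Num.min _ _ = 0); last first.
    by rewrite mulr0 subr0 (min_l (y := 3)) ?min_r//; lra.
  rewrite clamp_le; [|by lra|by lra].
  rewrite !mulr0 add0r NR0; last by lra.
  by rewrite /l /concatR ifT; [congr f'; lra|lra].
- move=> t t01; rewrite -g'E /H /= !clamp_id ?lexx ?ler01//; congr i.
  rewrite /K /s1 /s2 (_ : Num.min _ _ = 0); last first.
    by rewrite mulr1 subrr (min_r (x := 3)) ?min_r//; lra.
  rewrite clamp_ge; [|by lra|by lra].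
  rewrite !mulr0 NR0; last by lra.
  rewrite /l /concatR; case: ifP => t1; last by congr g'; lra.
  have -> : t = 1 by lra.
  by rewrite -fg1'; congr f'; lra.
- by move=> s; rewrite H0 H1 !f'E.
- by move=> z; exists (H z).
Qed.

(** The sheets are the images of those of the covering. They remain open in [X], and their sections
    continuous in [Y], because the range of [i] and the complement of [S] are open. *)
Lemma covering_sheeted (X Y E : topologicalType) (S : set Y) (p : X -> Y)
    (i : E -> X) (q : E -> set_type (~` S)) :
  open (~` S) -> open (range i) -> embedding i -> continuous i ->
  p \o i = set_val \o q -> covering q -> sheeted p (range i) S.
Proof.
move=> oD oi [iI iO] ci pi [cq _ ec] y Dy.
pose y' : set_type (~` S) := SigSub (mem_set Dy).
have [U' [oU' U'y [F [FE Ftriv HF]]]] := ec y'.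
have [U0 oU0 U'E] : exists2 U0 : set Y, open U0 & U' = set_val @^-1` U0.
  by case: oU' => U0 ? <-; exists U0.
have piE e : p (i e) = set_val (q e) by rewrite -[LHS]/((p \o i) e) pi.
have io W : open W -> open (i @` W).
  move=> /iO [V oV ->]; rewrite (_ : i @` _ = V `&` range i); first exact: openI.
  apply/seteqP; split => x /=; first by move=> [e Ve <-]; split => //; exists e.
  by move=> [Vx [e _ ix]]; exists e => //=; rewrite ix.
exists (U0 `&` ~` S); last first.
  by split => //; move: U'y; rewrite U'E.
split; [exact: openI|by move=> z []|].
move=> _ [e _ <-] [U0e De].
have : (q @^-1` U') e by rewrite U'E /= -piE.
rewrite FE => -[C FC Ce]; have [oC [Cbij _ Copen]] := HF _ FC.
have CU c : C c -> U' (q c).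
  by move=> Cc; have : (q @^-1` U') c by rewrite FE; exists C.
(* The section has to be a total map; elsewhere it takes the junk value [e]. *)
have /choice [s Hs] : forall u : Y, exists c : E, (U0 `&` ~` S) u ->
    C c /\ set_val (q c) = u.
  move=> u; have [[U0u Du]|nu] := pselect ((U0 `&` ~` S) u); last by exists e.
  have [_ _ /(_ (SigSub (mem_set Du)))] := Cbij.
  case; first by rewrite U'E.
  by move=> c Cc qc; exists c => _; split => //; rewrite qc.
have Cinj c c' : C c -> C c' -> q c = q c' -> c = c'.
  by move=> Cc Cc'; have [_ + _] := Cbij; apply; rewrite inE.
exists (i @` C), (i \o s); split; first by exists e.
split.
- exact: io.
- move=> _ [c Cc <-]; split; first by exists c.
  split; first by rewrite piE; move: (CU _ Cc); rewrite U'E.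
  by rewrite piE; exact: set_valP.
- move=> u Uu; have [Cs qs] := Hs _ Uu; split.
  + by exists (s u).
  + by rewrite /= piE.
  + move=> W; rewrite nbhsE => -[W' [oW' W's] W'W].
    have oiW : open (i @^-1` W') by apply: open_comp => // z _; exact: ci.
    have [V [V0 oV0 VE] qV] := Copen _ oiW.
    apply: (@filterS _ _ _ ((U0 `&` ~` S) `&` V0)).
      move=> v [Uv V0v]; apply: W'W; have [Csv qsv] := Hs _ Uv.
      have : (U' `&` V) (q (s v)).
        by split; [exact: CU|rewrite -VE /= qsv].
      rewrite -qV => -[c [Cc Wc] qc].
      by rewrite /= -(Cinj _ _ Cc Csv qc).
    apply: open_nbhs_nbhs; split.
      by apply: openI => //; exact: openI.
    split => //; have : (q @` (C `&` i @^-1` W')) (q (s u)).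
      by exists (s u).
    by rewrite qV -VE -[X in _ -> V0 X]qs => -[].
- move=> _ [c Cc <-]; have Uc : (U0 `&` ~` S) (p (i c)).
    split; first by rewrite piE; move: (CU _ Cc); rewrite U'E.
    by rewrite piE; exact: set_valP.
  have [Cs qs] := Hs _ Uc; congr i; apply: Cinj => //.
  by apply: val_inj; rewrite -set_valE qs piE.
(* The complement of a sheet is the union of the other sheets over the same set, hence open. *)
- rewrite (_ : _ `\` _ = i @` (\bigcup_(C' in F `\ C) C')).
    apply: io; apply: bigcup_open => C' [FC' _]; exact: (HF _ FC').1.
  apply/seteqP; split.
    move=> _ [[[c _ <-] [U0c Dc]] nCc].
    have : (q @^-1` U') c by rewrite U'E /= -piE.
    rewrite FE => -[C' FC' C'c]; exists c => //; exists C' => //.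
    by split => // C'C; apply: nCc; exists c => //; rewrite -C'C.
  move=> _ [c [C' [FC' C'C] C'c] <-]; split.
    split; first by exists c.
    have : (q @^-1` U') c by rewrite FE; exists C'.
    rewrite U'E /= piE => U0c; split => //; exact: (set_valP (q c)).
  move=> [c' Cc' /iI c'c]; apply: C'C.
  by apply: (Ftriv C' C FC' FC); exists c; split; rewrite // -c'c.
Qed.

Section universal_lift.
Variables (R : realType) (Y : topologicalType) (S : set Y) (y0 : Y).
Variables (X : topologicalType) (p : X -> Y).
Hypotheses (aY : admissible_space R Y) (oD : open (~` S)) (Dy0 : (~` S) y0).

(** These five clauses are what makes the map induced by [L] on almost homotopy classes a
    homeomorphism over [Y]. *)
Lemma universal_lift : is_universal_branched_covering R S p ->
  exists L : Omega R S y0 -> X, [/\ continuous L,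
    forall w O, nbhs w O -> nbhs (L w) (L @` O),
    forall x, exists w, L w = x,
    forall w, p (L w) = omega_fun w one &
    forall w1 w2, L w1 = L w2 <->
      almost_homotopic (~` S) (omega_fun w1) (omega_fun w2)].
Proof.
move=> [E [q [[aE scE covq] [aX _ csp [i [ei pi prA]]]]]].
have ci : continuous i.
  apply/continuousP => U oU; have [_ iO] := ei; apply/iO; by exists U.
have [oA dA _] := prA; have [cq qsurj _] := covq.
have piE e : p (i e) = set_val (q e) by rewrite -[LHS]/((p \o i) e) pi.
have [e0 pe0] : exists e, p (i e) = y0.
  have [e _ qe] := qsurj (SigSub (mem_set Dy0)) I.
  by exists e; rewrite piE qe.
have pA a : range i a -> (~` S) (p a).
  by move=> [e _ <-]; rewrite piE; exact: set_valP.
(* The image of the path connected space [E] is dense. *)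
have cX : connected [set: X].
  rewrite (_ : setT = closure (range i)); last first.
    apply/esym/seteqP; split => // x _ B; rewrite nbhsE => -[B' [oB' B'x] B'B].
    have [z [B'z iz]] := dA _ (ex_intro _ x B'x) oB'.
    by exists z; split => //; exact: B'B.
  apply: connected_closure; apply: connected_image => //.
  apply: (@joined_connected R) => x y _ _.
  have [g gxy _] := scE.1 x y Logic.I Logic.I.
  exact: is_path_joined gxy _.
have shp := covering_sheeted oD oA ei ci pi covq.
have hu := simply_connected_homotopy_unique ei ci scE.
subst y0; have Ae0 : range i (i e0) by exists e0.
have [hX lX _] := aX; have [hY lY _] := aY.
have /choice [lift liftP] : forall w : Omega R S (p (i e0)),
    exists g, is_lift p (range i) (i e0) (omega_path w) g.
  move=> w; apply: (lift_exists hX hY lY pA csp shp) Ae0 erefl.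
  exact: omega_path_opath.
exists (fun w => lift w 1); split.
- exact: (lift_end_continuous aX aY pA csp shp Ae0 liftP).
- exact: (lift_end_open aX aY prA pA csp shp Ae0 liftP).
- exact: (lift_end_surj aX cX prA pA csp shp Ae0 liftP).
- by move=> w; have [_ _ -> _] := liftP w; rewrite /omega_path clampI1.
- move=> w1 w2; split.
    exact: (lift_end_almost_homotopic aX aY prA pA csp liftP).
  exact: (almost_homotopic_lift_end aX aY pA csp shp Ae0 liftP).
Qed.

End universal_lift.

(** * Construction of a universal branched covering *)

Section path_classes.
Variables (R : realType) (Y : topologicalType) (S : set Y) (y0 : Y).
Local Notation D := (~` S).
Implicit Types (U V : set Y) (f g h : R -> Y).

Definition dpath f := [/\ continuous f, f 0 = y0 & forall t, D (f t)].

(** With [U] a singleton this is homotopy with fixed ends. Agreement with [f] and [g] is asked on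
    [[0, 1]] only, as the values of a path at other times are immaterial. *)
Definition drel U f g := exists H : R * R -> Y,
  [/\ continuous H, forall t : R, 0 <= t <= 1 -> H (0, t) = f t,
      forall t : R, 0 <= t <= 1 -> H (1, t) = g t,
      forall s : R, H (s, 0) = y0 /\ U (H (s, 1)) & forall z, D (H z)].

Lemma drel_sub U V f g : U `<=` V -> drel U f g -> drel V f g.
Proof.
move=> UV [H [cH H0 H1 Hs HD]]; exists H; split => // s.
by have [? /UV] := Hs s.
Qed.

Lemma drel_end U f g : drel U f g -> U (f 1) /\ U (g 1).
Proof.
move=> [H [cH H0 H1 Hs HD]].
by rewrite -H0 ?lexx ?ler01// -H1 ?lexx ?ler01//; split; apply: (Hs _).2.
Qed.

Lemma drel_eq U f g : dpath f -> U (f 1) ->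
  (forall t : R, 0 <= t <= 1 -> f t = g t) -> drel U f g.
Proof.
move=> [cf f0 fD] Uf fg; by exists (fun z => f z.2); split => //; cont.
Qed.

Lemma drel_refl U f : dpath f -> U (f 1) -> drel U f f.
Proof. by move=> df Uf; exact: drel_eq. Qed.

Lemma drel_sym U f g : drel U f g -> drel U g f.
Proof.
move=> [H [cH H0 H1 Hs HD]]; exists (fun z => H (1 - z.1, z.2)); split => //.
- by cont.
- by move=> t t01; rewrite /= subr0 H1.
- by move=> t t01; rewrite /= subrr H0. 
Qed.

Lemma drel_trans U g f h : drel U f g -> drel U g h -> drel U f h.
Proof.
move=> [H [cH H0 H1 Hs HD]] [K [cK K0 K1 Ks KD]].
exists (fun z => if z.1 <= 2^-1 then H (2 * z.1, clamp 0 1 z.2)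
                 else K (2 * z.1 - 1, clamp 0 1 z.2)).
have c01 (t : R) : 0 <= clamp 0 1 t <= 1 by apply: clamp_itv; exact: ler01.
have n2 : (1 : R) <= 2^-1 = false by apply/negbTE; rewrite -ltNge; lra.
split.
- apply: (@cont_glue R) => //; cont => z ->.
  by rewrite mulfV// subrr H1// K0.
- by move=> t t01; rewrite /= ifT ?mulr0 ?invr_ge0// clamp_id// H0.
- move=> t t01; rewrite /= n2 clamp_id//.
  by rewrite (_ : 2 * 1 - 1 = 1 :> R) ?K1//; lra.
- move=> s /=; rewrite !clamp_id ?lexx ?ler01//.
  by case: ifP => _; [exact: Hs|exact: Ks].
- by move=> z; case: ifP.
Qed.

Lemma concatR_dpath f g : dpath f -> continuous g -> (forall t, D (g t)) ->
  g 0 = f 1 -> dpath (concatR f g).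
Proof.
move=> [cf f0 fD] cg gD gf; split.
- by apply: concatR_continuous; rewrite // gf.
- by rewrite concatR0.
- by move=> t; rewrite /concatR; case: ifP.
Qed.

Lemma concatR_half f g (t : R) : 0 <= t <= 1 -> concatR f g (t / 2) = f t.
Proof.
by move=> t01; rewrite /concatR ifT; [congr f; lra|lra].
Qed.

Definition truncate (k : R -> Y) (u t : R) := k (u * clamp 0 1 t).

Lemma truncate_dpath (k : R -> Y) (u : R) : continuous k -> k 0 = y0 ->
  0 <= u -> (forall t, 0 <= t <= u -> D (k t)) -> dpath (truncate k u).
Proof.
move=> ck k0 u0 kD; split.
- by rewrite /truncate; cont.
- by rewrite /truncate clamp_id ?lexx ?ler01// mulr0.
- by move=> t; apply: kD; have := @clamp_itv R 0 1 t ler01; nra.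
Qed.

(** The stopping time slides linearly from [u] to [v], and the end of the path follows [k] between
    these two times. *)
Lemma truncate_drel U (k : R -> Y) (u v : R) : continuous k -> k 0 = y0 ->
  0 <= u -> 0 <= v ->
  (forall t, 0 <= t -> (t <= u) || (t <= v) -> D (k t)) ->
  (forall t, (u <= t <= v) || (v <= t <= u) -> U (k t)) ->
  drel U (truncate k u) (truncate k v).
Proof.
move=> ck k0 u0 v0 kD kU.
exists (fun z => k (((1 - clamp 0 1 z.1) * u + clamp 0 1 z.1 * v) *
                    clamp 0 1 z.2)); split.
- by cont.
- move=> t t01; rewrite /= (@clamp_id R 0 1 0) ?lexx ?ler01//.
  by rewrite subr0 mul1r mul0r addr0.
- move=> t t01; rewrite /= (@clamp_id R 0 1 1) ?lexx ?ler01//.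
  by rewrite subrr mul1r mul0r add0r.
- move=> s /=; rewrite (@clamp_id R 0 1 0) ?(@clamp_id R 0 1 1) ?lexx ?ler01//.
  rewrite mulr0 mulr1; split => //; apply: kU.
  have := @clamp_itv R 0 1 s ler01; move: (clamp 0 1 s) => a a01.
  have [uv|/ltW vu] := lerP u v; apply/orP; [left|right]; nra.
- move=> z.
  have := @clamp_itv R 0 1 z.1 ler01; have := @clamp_itv R 0 1 z.2 ler01.
  move: (clamp 0 1 z.1) (clamp 0 1 z.2) => a b /andP[b0 b1] /andP[a0 a1].
  have au : 0 <= (1 - a) * u by apply: mulr_ge0 => //; lra.
  have av : 0 <= a * v by apply: mulr_ge0.
  have w0 : 0 <= (1 - a) * u + a * v by exact: addr_ge0.
  have wb : ((1 - a) * u + a * v) * b <= (1 - a) * u + a * v.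
    by rewrite ler_piMr.
  apply: kD; first exact: mulr_ge0.
  have [uv|/ltW vu] := lerP u v; apply/orP; [right|left].
    have h : (1 - a) * u <= (1 - a) * v by apply: ler_wpM2l => //; lra.
    by apply: le_trans wb _; lra.
  have h : a * v <= a * u by exact: ler_wpM2l.
  by apply: le_trans wb _; lra.
Qed.

(** [f] is the concatenation stopped at time 1/2; letting the stopping time grow to 1 moves the end
    along [g], inside [U]. *)
Lemma drel_ext U f g : dpath f -> continuous g -> (forall t, D (g t)) ->
  g 0 = f 1 -> (forall t : R, 0 <= t <= 1 -> U (g t)) ->
  drel U f (concatR f g).
Proof.
move=> df cg gD gf gU; have [cf f0 fD] := df.
have [ck k0 kD] := concatR_dpath df cg gD gf.
have Uf : U (f 1) by rewrite -gf; apply: gU; rewrite lexx ler01.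
apply: (@drel_trans U (truncate (concatR f g) 2^-1)).
  apply: drel_eq => // t t01.
  by rewrite /truncate clamp_id// mulrC concatR_half.
apply: (@drel_trans U (truncate (concatR f g) 1)).
  have h2 : (0 : R) <= 2^-1 by rewrite invr_ge0 ler0n.
  apply: (truncate_drel ck k0 h2 ler01) => [//|t t12].
  rewrite /concatR; case: ifP => t2.
    have -> : 2 * t = 1 by lra.
    by [].
  by apply: gU; lra.
apply: drel_sym; apply: drel_eq; first by split.
  by rewrite concatR1; apply: gU; rewrite lexx ler01.
by move=> t t01; rewrite /truncate clamp_id// mul1r.
Qed.

Lemma drel_concat f f' g (z : Y) : drel [set z] f f' -> continuous g ->
  (forall t, D (g t)) -> g 0 = z -> drel [set g 1] (concatR f g) (concatR f' g).
Proof.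
move=> [H [cH H0 H1 Hs HD]] cg gD gz.
exists (fun x => if x.2 <= 2^-1 then H (x.1, 2 * x.2) else g (2 * x.2 - 1)).
split.
- apply: (@cont_glue R) => //; cont => x ->.
  by rewrite mulfV// subrr gz (Hs _).2.
- move=> t t01; rewrite /concatR /=; case: ifP => t2 //.
  by rewrite H0//; lra.
- move=> t t01; rewrite /concatR /=; case: ifP => t2 //.
  by rewrite H1//; lra.
- move=> s /=; rewrite invr_ge0 ler0n mulr0 (Hs s).1; split => //.
  rewrite ifF; first by congr g; lra.
  by apply/negbTE; rewrite -ltNge; lra.
- by move=> x; case: ifP.
Qed.

Lemma drel_backtrack f g : dpath f -> continuous g -> (forall t, D (g t)) ->
  g 0 = f 1 ->
  drel [set f 1] (concatR (concatR f g) (fun t => g (1 - t))) f.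
Proof.
move=> df cg gD gf; have [ck k0 kD] := concatR_dpath df cg gD gf.
set k := concatR f g in ck k0 kD *.
(* The time [min (2 t) (3/2 - t)] grows to 1 and comes back to 1/2, so that [k] reads [f], [g] and
   [g] reversed. It is deformed linearly to [t / 2], along which [k] reads [f]; the final time is
   1/2 throughout. *)
exists (fun z => k ((1 - clamp 0 1 z.1) *
  Num.min (2 * clamp 0 1 z.2) (3 / 2 - clamp 0 1 z.2) +
  clamp 0 1 z.1 * (clamp 0 1 z.2 / 2))); split.
- by cont.
- move=> t t01; rewrite /= (@clamp_id R 0 1 0) ?lexx ?ler01// clamp_id//.
  rewrite subr0 mul1r mul0r addr0 [in RHS]/concatR; case: ifP => t2.
    by rewrite min_l//; lra.
  rewrite min_r; last by lra.
  rewrite /k /concatR; case: ifP => t2'; last by congr g; lra.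
  have -> : t = 1 by lra.
  by rewrite (_ : 1 - (2 * 1 - 1) = 0 :> R) ?gf; [congr f|]; lra.
- move=> t t01; rewrite /= (@clamp_id R 0 1 1) ?lexx ?ler01// clamp_id//.
  by rewrite subrr mul0r add0r mul1r /k concatR_half.
- move=> s /=; rewrite (@clamp_id R 0 1 0) ?(@clamp_id R 0 1 1) ?lexx ?ler01//.
  rewrite min_l; last by lra.
  rewrite min_r; last by lra.
  rewrite !mulr0 mul0r mulr0 addr0; split => //.
  have -> : (1 - clamp 0 1 s) * (3 / 2 - 1) + clamp 0 1 s * (1 / 2) = 1 / 2.
    by lra.
  by rewrite /= /k concatR_half ?lexx ?ler01.
- by move=> z; exact: kD.
Qed.

(** Semi-local simple connectedness of the complement of [S], expressed in [Y]. *)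
Definition null_loops U z := forall f, continuous f -> (forall t, U (f t)) ->
  f 0 = z -> f 1 = z -> exists K : R * R -> Y,
  [/\ continuous K, forall t : R, 0 <= t <= 1 -> K (0, t) = f t,
      forall t : R, K (1, t) = z, forall s : R, K (s, 0) = z /\ K (s, 1) = z &
      forall x, D (K x)].

(** The end of the homotopy describes a loop of [U] at [z]. A contraction of this loop is appended
    to the intermediate paths, its deformation parameter serving as time, and the end no longer
    moves. *)
Lemma drel_null_loops U z f g : null_loops U z -> dpath f -> dpath g ->
  f 1 = z -> g 1 = z -> drel U f g -> drel [set z] f g.
Proof.
move=> nU df dg fz gz [H [cH H0 H1 Hs HD]].
have [||||K [cK K0 K1 Ks KD]] := nU (fun s => H (clamp 0 1 s, 1)) _ _.
- by cont.
- by move=> s; exact: (Hs _).2.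
- by rewrite clamp_id ?lexx ?ler01// H0 ?lexx ?ler01.
- by rewrite clamp_id ?lexx ?ler01// H1 ?lexx ?ler01.
have Dz : D z by rewrite -fz; case: df.
have cz : continuous (fun _ : R => z) by cont.
have ez h : dpath h -> h 1 = z -> drel [set z] h (concatR h (fun _ => z)).
  by move=> dh hz; apply: drel_ext.
apply: drel_trans (ez _ df fz) _.
apply: drel_trans (drel_sym (ez _ dg gz)).
exists (fun x => if x.2 <= 2^-1 then H (clamp 0 1 x.1, 2 * x.2)
                 else K (2 * x.2 - 1, clamp 0 1 x.1)).
have c0 : clamp 0 1 0 = 0 :> R by rewrite clamp_id ?lexx ?ler01.
have c1 : clamp 0 1 1 = 1 :> R by rewrite clamp_id ?lexx ?ler01.
split.
- apply: (@cont_glue R) => //; cont => x ->.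
  have c01 : 0 <= clamp 0 1 x.1 <= 1 :> bool by apply: clamp_itv; exact: ler01.
  by rewrite mulfV// subrr K0// (@clamp_id R 0 1 (clamp 0 1 x.1)).
- move=> t t01; rewrite /concatR /= c0; case: ifP => t2.
    by rewrite H0//; lra.
  by rewrite (Ks _).1.
- move=> t t01; rewrite /concatR /= c1; case: ifP => t2.
    by rewrite H1//; lra.
  by rewrite (Ks _).2.
- move=> s /=; rewrite invr_ge0 ler0n mulr0 (Hs _).1; split => //.
  rewrite ifF; last by apply/negbTE; rewrite -ltNge; lra.
  by rewrite (_ : 2 * 1 - 1 = 1 :> R) ?K1//; lra.
- by move=> x; case: ifP.
Qed.

(* The common end of [f] and [g] is moved along [U] to [z], and then back. *)
Lemma drel_null_loops_joined U z f g : U `<=` D ->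
  (forall x y, U x -> U y -> joined R U x y) ->
  U z -> null_loops U z -> dpath f -> dpath g -> f 1 = g 1 -> drel U f g ->
  drel [set f 1] f g.
Proof.
move=> UD jU Uz nU df dg fg1 fg; have [Uf Ug] := drel_end fg.
have [a [ca a0 a1 aU]] := jU _ _ Uf Uz.
have aD t : D (a t) by exact: UD.
have ext h : dpath h -> h 1 = f 1 -> drel U h (concatR h a).
  by move=> dh hf; apply: drel_ext; rewrite ?hf.
have dfa : dpath (concatR f a) by apply: concatR_dpath.
have dga : dpath (concatR g a) by apply: concatR_dpath; rewrite -?fg1.
have fga : drel [set z] (concatR f a) (concatR g a).
  apply: (drel_null_loops nU); rewrite ?concatR1//.
  apply: drel_trans (drel_sym (ext _ df erefl)) _.
  by apply: drel_trans fg _; exact: ext.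
have ca' : continuous (fun t : R => a (1 - t)) by cont.
have := drel_concat fga ca' (fun t : R => aD (1 - t)).
rewrite subr0 subrr a0 a1 => /(_ erefl) H.
apply: drel_trans (drel_sym (drel_backtrack df ca aD a0)) _.
apply: drel_trans H _; rewrite fg1; apply: drel_backtrack => //.
by rewrite -fg1.
Qed.

End path_classes.

(** * The space of compatible families of classes *)

Section branched_space_def.
Variables (R : realType) (Y : topologicalType) (S : set Y) (y0 : Y).

Definition end_class (U : set Y) (f : R -> Y) : set (R -> Y) :=
  [set g | dpath S y0 g /\ drel S y0 U f g].

Definition is_end_class (U : set Y) (c : set (R -> Y)) :=
  exists f, [/\ dpath S y0 f, U (f 1) & c = end_class U f].

Definition cnbhs (y : Y) : set (set Y) :=
  [set U | [/\ open U, connected U & U y]].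

(* A point over [y] is a compatible choice of classes, one for each connected
   open neighborhood of [y]; the other sets get the junk value [set0]. *)
Definition branched_point : set (Y * (set Y -> set (R -> Y))) :=
  [set x | [/\ forall U, cnbhs x.1 U -> is_end_class U (x.2 U),
               forall U, ~ cnbhs x.1 U -> x.2 U = set0 &
               forall U V, cnbhs x.1 U -> cnbhs x.1 V -> U `<=` V ->
                 x.2 U `<=` x.2 V]].

Definition branched_space : Type := set_type branched_point.

HB.instance Definition _ := gen_eqMixin branched_space.
HB.instance Definition _ := gen_choiceMixin branched_space.

Definition bproj (x : branched_space) : Y := (sval x).1.
Definition bclass (x : branched_space) : set Y -> set (R -> Y) := (sval x).2.

(** For [U] open and connected, the nonempty leaves will be the components of the preimage of [U]
    ([component_leaf]). Taking them as a subbase gives the topology that a spread must have. *)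
Definition leaf (U : set Y) (c : set (R -> Y)) : set branched_space :=
  [set x | U (bproj x) /\ bclass x U = c].

HB.instance Definition _ := @isSubBaseTopological.Build branched_space
  (set Y * set (R -> Y))%type [set i | open i.1 /\ connected i.1]
  (fun i => leaf i.1 i.2).

End branched_space_def.

Section branched_space.
Variables (R : realType) (Y : topologicalType) (S : set Y) (y0 : Y).
Local Notation D := (~` S).
Local Notation X := (branched_space R S y0).
Local Notation pr := (@bproj R Y S y0).
Local Notation dpath := (@dpath R Y S y0).
Local Notation drel := (@drel R Y S y0).
Local Notation end_class := (@end_class R Y S y0).
Local Notation is_end_class := (@is_end_class R Y S y0).
Local Notation leaf := (@leaf R Y S y0).
Implicit Types (U V W : set Y) (x : X) (f g : R -> Y) (c : set (R -> Y)).

Lemma bclassP x U : cnbhs (pr x) U -> is_end_class U (bclass x U).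
Proof. by case: x => x Hx; have [+ _ _] := set_mem Hx; apply. Qed.

Lemma bclass_out x U : ~ cnbhs (pr x) U -> bclass x U = set0.
Proof. by case: x => x Hx; have [_ + _] := set_mem Hx; apply. Qed.

Lemma bclass_sub x U V : cnbhs (pr x) U -> cnbhs (pr x) V -> U `<=` V ->
  bclass x U `<=` bclass x V.
Proof. by case: x => x Hx; have [_ _ +] := set_mem Hx; apply. Qed.

Lemma branched_space_eq x x' : pr x = pr x' ->
  (forall U, cnbhs (pr x) U -> bclass x U = bclass x' U) -> x = x'.
Proof.
move=> pxx cxx; apply: (@val_inj _ _ (set_type (@branched_point R Y S y0))).
rewrite [LHS]surjective_pairing [RHS]surjective_pairing; congr pair => //.
apply/funext => U; have [nU|nU] := pselect (cnbhs (pr x) U); first exact: cxx.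
by rewrite -/(bclass x U) -/(bclass x' U) !bclass_out// -pxx.
Qed.

Lemma branched_point_intro (y : Y) (ch : set Y -> set (R -> Y)) :
  (forall U, cnbhs y U -> is_end_class U (ch U)) ->
  (forall U V, cnbhs y U -> cnbhs y V -> U `<=` V -> ch U `<=` ch V) ->
  exists x, pr x = y /\ forall U, cnbhs y U -> bclass x U = ch U.
Proof.
move=> chP chS.
pose ch' U := if `[< cnbhs y U >] then ch U else set0.
have ch'E U : cnbhs y U -> ch' U = ch U by move=> nU; rewrite /ch' asboolT.
have H : branched_point S y0 (y, ch').
  split => /= [U nU|U nU|U V nU nV].
  - by rewrite ch'E//; exact: chP.
  - by rewrite /ch' asboolF.
  - by rewrite !ch'E//; exact: chS.
by exists (SigSub (mem_set H)).
Qed.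

Lemma end_class_refl U f : dpath f -> U (f 1) -> end_class U f f.
Proof. by move=> df Uf; split => //; exact: drel_refl. Qed.

Lemma end_class_eq U f g : drel U f g -> end_class U f = end_class U g.
Proof.
move=> fg; apply/seteqP; split => h [dh fh]; split => //.
  by apply: drel_trans fh; exact: drel_sym.
exact: drel_trans fh.
Qed.

Lemma is_end_classE U c f : is_end_class U c -> c f ->
  [/\ dpath f, U (f 1) & c = end_class U f].
Proof.
move=> [g [dg Ug ->]] [df gf]; split => //; last exact: end_class_eq.
by have [] := drel_end gf.
Qed.

Lemma is_end_class_neq0 U c : is_end_class U c -> exists f, c f.
Proof. by move=> [f [df Uf ->]]; exists f; exact: end_class_refl. Qed.

Lemma is_end_class_meet U c c' f : is_end_class U c -> is_end_class U c' ->
  c f -> c' f -> c = c'.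
Proof.
by move=> /is_end_classE Hc /is_end_classE Hc' /Hc[_ _ ->] /Hc'[_ _ ->].
Qed.

Lemma bclass_determined x x' U V : cnbhs (pr x) V -> cnbhs (pr x') V ->
  cnbhs (pr x) U -> cnbhs (pr x') U -> V `<=` U ->
  bclass x V = bclass x' V -> bclass x U = bclass x' U.
Proof.
move=> xV x'V xU x'U VU E.
have [f xf] := is_end_class_neq0 (bclassP xV).
apply: (@is_end_class_meet U _ _ f); [exact: bclassP|exact: bclassP| |].
  exact: bclass_sub xf.
by apply: (bclass_sub x'V x'U VU); rewrite -E.
Qed.

Lemma leaf_sub x U V : cnbhs (pr x) V -> cnbhs (pr x) U -> V `<=` U ->
  leaf V (bclass x V) `<=` leaf U (bclass x U).
Proof.
move=> xV xU VU z [Vz zV]; have [oV cV _] := xV; have [oU cU _] := xU.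
split; first exact: VU.
by apply: (@bclass_determined _ _ U V) => //; split => //; exact: VU.
Qed.

Lemma leaf_open U c : open U -> connected U -> open (leaf U c).
Proof.
move=> oU cU; exists [set leaf U c]; last by rewrite bigcup_set1.
move=> _ ->; exists (fset1 (U, c)); last by rewrite set_fset1 bigcap_set1.
by move=> i; rewrite finmap.inE => /eqP ->; rewrite inE.
Qed.

Hypothesis lY : locally_path_connected R Y.

Lemma nbhs_leaf x (W : set X) : nbhs x W <->
  exists2 U, cnbhs (pr x) U & leaf U (bclass x U) `<=` W.
Proof.
split; last first.
  move=> [U [oU cU Ux] UW]; apply: (filterS UW); apply: open_nbhs_nbhs.
  by split; [exact: leaf_open|split].
rewrite nbhsE => -[W' [oW' W'x] W'W].
move: oW' => [F FB FE].
move: W'x; rewrite -FE => -[C FC Cx]; have [D' D'B CE] := FB _ FC.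
subst C.
have {}Cx i : i \in D' -> leaf i.1 i.2 x := Cx i.
have nV : nbhs (pr x) (\bigcap_(i in [set` D']) i.1).
  apply: filter_bigI => i iD; have := D'B _ iD; rewrite inE => -[oi ci].
  by apply: open_nbhs_nbhs; split => //; have [] := Cx _ iD.
have [U [oU cU Ux UV]] := lpc_connected lY nV.
exists U => // z zU; apply: W'W; rewrite -FE.
exists (\bigcap_(i in [set` D']) leaf i.1 i.2); first exact: FC.
suff : (\bigcap_(i in [set` D']) leaf i.1 i.2) z by [].
move=> i /= iD; have := D'B _ iD; rewrite inE => -[oi ci].
have [ix xi] := Cx _ iD.
have Ui : U `<=` i.1 by move=> u /UV; apply.
have : leaf i.1 (bclass x i.1) z by apply: (leaf_sub _ _ Ui zU).
by rewrite xi.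
Qed.

Lemma bproj_continuous : continuous pr.
Proof.
move=> x W nW; apply/nbhs_leaf.
have [U [oU cU Ux UW]] := lpc_connected lY nW.
by exists U => // z [Uz _]; exact: UW.
Qed.

Lemma hausdorff_branched_space : hausdorff_space Y -> hausdorff_space X.
Proof.
move=> hY; rewrite open_hausdorff => x x' /eqP xx'.
have [pxx|pxx] := pselect (pr x = pr x'); last first.
  have [A [B [oA oB Ax Bx AB]]] := hausdorff_sep hY pxx.
  exists (pr @^-1` A, pr @^-1` B) => /=; first by rewrite !inE.
  split; [by apply: open_comp => // z _; exact: bproj_continuous..|].
  by rewrite -preimage_setI AB preimage_set0.
have /existsNP [U /not_implyP [[oU cU Ux] nE]] :
    ~ forall U, cnbhs (pr x) U -> bclass x U = bclass x' U.
  by move=> /(branched_space_eq pxx).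
exists (leaf U (bclass x U), leaf U (bclass x' U)) => /=.
  by rewrite !inE; split; split => //; rewrite -pxx.
split; [exact: leaf_open..|].
apply/eqP; apply/seteqP; split => // z [[_ zx] [_ zx']].
by apply: nE; rewrite -zx -zx'.
Qed.

Lemma first_countable_branched_space : first_countable Y -> first_countable X.
Proof.
move=> fY x; have [U [oU cU Ux _]] := lpc_connected lY (nbhs_setT (pr x)).
have [B [B0 HB decB baseB]] := connected_base lY fY oU cU Ux.
exists (fun n => leaf (B n) (bclass x (B n))); split.
  by move=> n; apply/nbhs_leaf; exists (B n) => //; exact: HB.
move=> W /nbhs_leaf [V nV VW]; have [oV cV Vx] := nV.
have [n nBV] := baseB V (open_nbhs_nbhs (conj oV Vx)).
by exists n; apply: subset_trans VW; apply: leaf_sub => //; exact: HB.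
Qed.

(** [k 1] may lie in [S]. The class on [U] is that of [k] stopped at any time from which it stays in
    [U]; by [truncate_drel] the choice of this time is immaterial. *)
Lemma path_point (k : R -> Y) : continuous k -> k 0 = y0 ->
  (forall t : R, 0 <= t < 1 -> D (k t)) ->
  exists x, pr x = k 1 /\ forall U, cnbhs (k 1) U ->
    forall u : R, 0 <= u < 1 -> (forall t : R, u <= t <= 1 -> U (k t)) ->
    bclass x U = end_class U (truncate k u).
Proof.
move=> ck k0 kD.
have tail_ex U : cnbhs (k 1) U -> exists u : R, 0 <= u < 1 /\
    forall t : R, u <= t <= 1 -> U (k t).
  move=> [oU _ Uk].
  have /near_ballP [e e_gt0 He] : \forall t \near (1 : R), U (k t).
    by apply: ck; exact: open_nbhs_nbhs.
  exists (Num.max 0 (1 - e / 2)); split.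
    by rewrite le_max lexx /= gt_max ltr01 /=; lra.
  by move=> t; rewrite ge_max => /andP[/andP[t0 te] t1]; apply: He; lra.
have td (u : R) : 0 <= u < 1 -> dpath (truncate k u).
  move=> /andP[u0 u1]; apply: truncate_dpath => // t /andP[t0 tu].
  by apply: kD; rewrite t0 (le_lt_trans tu).
have tr U (u v : R) : 0 <= u < 1 -> 0 <= v < 1 ->
    (forall t : R, u <= t <= 1 -> U (k t)) ->
    (forall t : R, v <= t <= 1 -> U (k t)) ->
    drel U (truncate k u) (truncate k v).
  move=> /andP[u0 u1] /andP[v0 v1] uU vU; apply: truncate_drel => //.
    move=> t t0 tuv; apply: kD; rewrite t0 /=.
    by case/orP: tuv => h; apply: le_lt_trans h _.
  move=> t /orP[|] /andP[t1 t2]; [apply: uU|apply: vU]; rewrite t1 /=.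
    by apply: le_trans t2 _; exact: ltW.
  by apply: le_trans t2 _; exact: ltW.
have t1 (u : R) : truncate k u 1 = k u.
  by rewrite /truncate clamp_id ?lexx ?ler01// mulr1.
pose ch U := [set g | exists u : R, [/\ 0 <= u < 1,
  forall t : R, u <= t <= 1 -> U (k t) & end_class U (truncate k u) g]].
have chE U u : 0 <= u < 1 -> (forall t : R, u <= t <= 1 -> U (k t)) ->
    ch U = end_class U (truncate k u).
  move=> u01 uU; apply/seteqP; split => g; last by exists u.
  by move=> [v [v01 vU]]; rewrite (end_class_eq (tr _ _ _ u01 v01 uU vU)).
have [||x [px xch]] := @branched_point_intro (k 1) ch.
- move=> U nU; have [u [u01 uU]] := tail_ex U nU.
  exists (truncate k u); split; [exact: td| |exact: chE].
  by rewrite t1; apply: uU; case/andP: u01 => _ /ltW ->; rewrite lexx.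
- move=> U V nU nV UV g [u [u01 uU [dg ug]]]; exists u; split => //.
    by move=> t /uU /UV.
  by split => //; exact: drel_sub ug.
exists x; split => // U nU u u01 uU.
by rewrite xch// (chE U u).
Qed.

Lemma dpath_point f : dpath f ->
  exists x, pr x = f 1 /\ forall U, cnbhs (f 1) U -> bclass x U = end_class U f.
Proof.
move=> df; apply: branched_point_intro.
  by move=> U [oU cU Uf]; exists f.
move=> U V [_ _ Uf] [_ _ Vf] UV g [dg fg]; split => //; exact: drel_sub fg.
Qed.

(* The value outside of [dpath] is the junk value [x0]. *)
Definition dpath_pt (x0 : X) f : X :=
  if pselect (dpath f) is left df then projT1 (cid (dpath_point df)) else x0.

Variable x0 : X.
Local Notation pt := (dpath_pt x0).

Lemma dpath_ptP f : dpath f -> pr (pt f) = f 1 /\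
  forall U, cnbhs (f 1) U -> bclass (pt f) U = end_class U f.
Proof.
move=> df; rewrite /dpath_pt; case: pselect => // df'.
by case: (cid _).
Qed.

Lemma dpath_pt_leaf U c f : open U -> connected U -> is_end_class U c -> c f ->
  leaf U c (pt f).
Proof.
move=> oU cU Hc cf; have [df Uf ->] := is_end_classE Hc cf.
have [pf Hf] := dpath_ptP df; split; first by rewrite pf.
by rewrite Hf.
Qed.

Lemma dpath_pt_eq f g : dpath f -> dpath g -> drel [set f 1] f g -> pt f = pt g.
Proof.
move=> df dg fg; have [pf Hf] := dpath_ptP df; have [pg Hg] := dpath_ptP dg.
have [_ /= g1] := drel_end fg.
apply: branched_space_eq; first by rewrite pf pg g1.
move=> U; rewrite pf => nU; rewrite Hf// Hg ?g1//; apply: end_class_eq.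
by apply: drel_sub fg => _ ->; case: nU.
Qed.

Lemma dpath_pt_continuous (G : (R * R) * R -> Y) : continuous G ->
  (forall z, G (z, 0) = y0) -> (forall z, D (G z)) ->
  continuous (fun z => pt (fun t => G (z, t))).
Proof.
move=> cG G0 GD.
have dG z : dpath (fun t => G (z, t)).
  by split => //; apply: (@cont_comp _ _ _ G (fun t => (z, t))) => //; cont.
move=> z W /nbhs_leaf [U nU UW].
have [pz Hz] := dpath_ptP (dG z); rewrite pz in nU; have [oU cU Uz] := nU.
rewrite Hz// in UW.
suff : \forall z' \near z, W (pt (fun t => G (z', t))) by [].
have : nbhs z ((fun z => G (z, 1)) @^-1` U).
  have cG1 : continuous (fun z => G (z, 1)) by cont.
  by apply: cG1; exact: open_nbhs_nbhs.
move=> [[P Q] /= [/near_ballP [e e_gt0 He] /near_ballP [d d_gt0 Hd]] PQ].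
exists ([set s | z.1 - e < s < z.1 + e], [set s | z.2 - d < s < z.2 + d]) => /=.
  by split; apply/near_ballP; [exists e|exists d].
move=> z' [/= z1 z2]; apply: UW.
have U' (s : R) : U (G ((z.1 + clamp 0 1 s * (z'.1 - z.1),
                 z.2 + clamp 0 1 s * (z'.2 - z.2)), 1)).
  have s01 := @clamp_itv R 0 1 s ler01.
  by apply: PQ; split => /=; [apply: He|apply: Hd]; nra.
have [pz' Hz'] := dpath_ptP (dG z').
have Uz' : U (G (z', 1)).
  have := U' 1; rewrite clamp_id ?lexx ?ler01// !mul1r !(addrC _ (_ - _)).
  by rewrite !subrK -surjective_pairing.
split; first by rewrite pz'.
rewrite Hz'//; apply: end_class_eq; apply: drel_sym.
exists (fun w : R * R => G ((z.1 + clamp 0 1 w.1 * (z'.1 - z.1),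
                 z.2 + clamp 0 1 w.1 * (z'.2 - z.2)), w.2)); split => //.
- by cont.
- move=> t _; rewrite /= clamp_id ?lexx ?ler01// !mul0r !addr0.
  by rewrite -surjective_pairing.
- move=> t _; rewrite /= clamp_id ?lexx ?ler01// !mul1r !(addrC _ (_ - _)).
  by rewrite !subrK -surjective_pairing.
Qed.

Lemma drel_joined U f g : open U -> connected U -> dpath f -> drel U f g ->
  dpath g -> joined R (leaf U (end_class U f) `&` range pt `&` pr @^-1` D)
    (pt f) (pt g).
Proof.
move=> oU cU df [H [cH H0 H1 Hs HD]] dg.
pose G (z : (R * R) * R) := H (clamp 0 1 z.1.1, clamp 0 1 z.2).
have cGz : continuous (fun z : R * R => pt (fun t => G (z, t))).
  apply: dpath_pt_continuous.
  - by rewrite /G; cont.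
  - by move=> z; rewrite /G /= (@clamp_id R 0 1 0) ?lexx ?ler01// (Hs _).1.
  - by move=> z; exact: HD.
have dG s : dpath (fun t => G ((s, 0), t)).
  split => //.
  - by rewrite /G; cont.
  - by rewrite /G /= (@clamp_id R 0 1 0) ?lexx ?ler01// (Hs _).1.
  - by move=> t; exact: HD.
have end1 h h' : dpath h -> dpath h' ->
    (forall t : R, 0 <= t <= 1 -> h t = h' t) -> pt h = pt h'.
  by move=> dh dh' hh'; apply: dpath_pt_eq => //; exact: drel_eq.
exists (fun s => pt (fun t => G ((s, 0), t))); split.
- by apply: (@cont_comp _ _ _ (fun z : R * R => pt (fun t => G (z, t)))
    (fun s : R => (s, 0))) => //; cont.
- apply: end1 => // t t01.
  by rewrite /G /= (@clamp_id R 0 1 0) ?lexx ?ler01// clamp_id// H0.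
- apply: end1 => // t t01.
  by rewrite /G /= (@clamp_id R 0 1 1) ?lexx ?ler01// clamp_id// H1.
- move=> s; split; last first.
    have [Es _] := dpath_ptP (dG s).
    suff : D (pr (pt (fun t => G ((s, 0), t)))) by [].
    by rewrite Es; exact: HD.
  split; last by exists (fun t => G ((s, 0), t)).
  apply: dpath_pt_leaf => //.
    exists f; split => //.
    by rewrite -H0 ?lexx ?ler01//; exact: (Hs _).2.
  split => //.
  (* Running the homotopy only up to [s] shows that the intermediate path is in the class of [f]. *)
  exists (fun z => H (clamp 0 1 s * clamp 0 1 z.1, clamp 0 1 z.2)); split => //.
  + by cont.
  + move=> t t01; rewrite /= (clamp_id t01) (@clamp_id R 0 1 0) ?lexx ?ler01//.
    by rewrite mulr0 H0.
  + move=> t t01; rewrite /= (@clamp_id R 0 1 1) ?lexx ?ler01// mulr1.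
    by rewrite /G /=.
  + move=> u /=; rewrite (@clamp_id R 0 1 0) ?(@clamp_id R 0 1 1) ?lexx ?ler01//.
Qed.

Hypothesis fY : first_countable Y.

(** Representatives of the classes of [x] on a shrinking base are joined successively by homotopies
    whose end stays in [B n]; the telescope of these paths ends at [x], even when [x] lies over
    [S]. *)
Lemma leaf_joined_pt U c f x : open U -> connected U -> is_end_class U c ->
  c f -> leaf U c x -> joined R (leaf U c) (pt f) x.
Proof.
move=> oU cU Hc cf [Ux xc].
have [B [B0 HB decB baseB]] := connected_base lY fY oU cU Ux.
have HBc n : is_end_class (B n) (bclass x (B n)) by apply: bclassP; exact: HB.
have [b Hb] := choice (fun n => is_end_class_neq0 (HBc n)).
pose a n := if n is 0%N then f else b n.
have Ha n : bclass x (B n) (a n).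
  by case: n => [|n]; [rewrite /a B0 xc|exact: Hb].
have [|||g [cg g0 g1 gA]] := @telescoping_path R _ x
    (fun n => leaf (B n) (bclass x (B n))) (fun n => pt (a n)).
- by move=> n; apply: leaf_sub => //; exact: HB.
- move=> W /nbhs_leaf [V nV VW]; have [oV cV Vx] := nV.
  have [n nBV] := baseB V (open_nbhs_nbhs (conj oV Vx)).
  by exists n; apply: subset_trans VW; apply: leaf_sub => //; exact: HB.
- move=> n; have [oB cB _] := HB n.
  have [da _ E] := is_end_classE (HBc n) (Ha n).
  have : bclass x (B n) (a n.+1).
    by apply: (bclass_sub (HB n.+1)) (Ha n.+1).
  rewrite [in X in X -> _]E => -[da' aa'].
  apply: joined_sub (drel_joined oB cB da aa' da').
  by rewrite E => z [[]].
exists g; split => //; first exact: g1.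
move=> t; have [t1|t1] := ltrP t 1; last by rewrite g1.
by have := gA _ t1; rewrite B0 xc.
Qed.

Lemma leaf_joined U c x x' : open U -> connected U -> is_end_class U c ->
  leaf U c x -> leaf U c x' -> joined R (leaf U c) x x'.
Proof.
move=> oU cU Hc cx cx'; have [f cf] := is_end_class_neq0 Hc.
apply: (@joined_trans _ _ _ (pt f)).
  by apply: joined_sym; exact: leaf_joined_pt.
exact: leaf_joined_pt.
Qed.

End branched_space.

(** * Subspaces, connectedness and portly sets *)

Lemma nbhs_set_type (T : topologicalType) (A : set T) (e : set_type A)
    (W : set (set_type A)) : nbhs e W <->
  exists2 V, nbhs (set_val e) V & set_val @^-1` V `<=` W.
Proof.
split.
  rewrite nbhsE => -[_ [[V oV <-] Ve] VW]; exists V => //.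
  by exists V; [split|].
move=> [V nV VW]; apply: (filterS VW).
exact: (@initial_continuous _ _ (set_val : set_type A -> T)).
Qed.

Lemma corestrict (T U : topologicalType) (A : set U) (f : T -> U) :
  continuous f -> (forall t, A (f t)) ->
  exists2 f' : T -> set_type A, continuous f' & forall t, set_val (f' t) = f t.
Proof.
move=> cf fA; exists (fun t => SigSub (mem_set (fA t))) => //.
exact: continuous_comp_initial.
Qed.

Lemma open_set_type_admissible (R : realType) (T : topologicalType)
    (A : set T) :
  open A -> admissible_space R T -> admissible_space R (set_type A).
Proof.
move=> oA [hT lT fT].
have cv := @initial_continuous _ _ (set_val : set_type A -> T).
split.
- by apply: (hausdorff_inj hT cv); exact: val_inj.
- apply: joined_lpc => e W /nbhs_set_type [V nV VW].
  have nVA : nbhs (set_val e) (V `&` A).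
    by apply: filterI => //; apply: open_nbhs_nbhs; split => //; exact: set_valP.
  have [B [oB Be BVA jB]] := lpc_joined lT nVA.
  exists (set_val @^-1` B); split => //.
  + by apply: open_comp => // x _; exact: cv.
  + by move=> x /BVA [Vx _]; exact: VW.
  + move=> x y Bx By; have [f [cf f0 f1 fB]] := jB _ _ Bx By.
    have [f' cf' f'E] := corestrict cf (fun t => (BVA _ (fB t)).2).
    exists f'; split => //.
    * by apply: val_inj; rewrite -set_valE f'E.
    * by apply: val_inj; rewrite -set_valE f'E.
    * by move=> t; rewrite /= f'E.
- move=> e; have [B [nB HB]] := fT (set_val e).
  exists (fun n => set_val @^-1` B n); split.
    by move=> n; apply/nbhs_set_type; exists (B n).
  move=> W /nbhs_set_type [V nV VW]; have [n BV] := HB _ nV.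
  by exists n => x /BV; exact: VW.
Qed.

Lemma connected_intro (T : topologicalType) (A : set T) :
  (forall Q : T -> Prop,
    (forall t, A t -> \forall u \near t, A u -> (Q t <-> Q u)) ->
    forall t u, A t -> A u -> Q t -> Q u) -> connected A.
Proof.
move=> H B [b Bb] [C oC BC] [C' cC' BC'].
apply/seteqP; split; first by rewrite BC => x [].
move: (Bb); rewrite [X in X b]BC => -[Ab _].
move=> u Au; apply: (H B _ b u Ab Au Bb) => t At.
have [Bt|nBt] := pselect (B t).
  have : nbhs t C.
    by apply: open_nbhs_nbhs; split => //; move: Bt; rewrite BC => -[].
  by apply: filterS => v Cv Av; rewrite {2}BC.
have : nbhs t (~` C').
  apply: open_nbhs_nbhs; split; first exact: closed_openC.
  by move=> C't; apply: nBt; rewrite BC'.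
by apply: filterS => v nCv Av; split => //; rewrite BC' => -[].
Qed.

(** A locally constant property of the trace of [E] on [W] is extended to the points of [W] near
    which it holds on a whole trace. Density makes small traces nonempty, so the extension is
    locally constant on [W], which is connected. *)
Lemma locally_connected_in_base (T : topologicalType) (E : set T) :
  dense E -> (forall x W, nbhs x W ->
    exists B, [/\ open B, B x, B `<=` W & connected (B `&` E)]) ->
  locally_connected_in E.
Proof.
move=> dE base W oW cW; apply: connected_intro => Q locQ t u [Wt Et] [Wu Eu] Qt.
pose Q' x := exists B, [/\ open B, B x, B `<=` W &
  forall y, (B `&` E) y -> Q y].
have Bconst B : B `<=` W -> connected (B `&` E) -> forall x y,
    (B `&` E) x -> (B `&` E) y -> Q x -> Q y.
  move=> BW cB; apply: (connected_ind cB) => x [Bx Ex].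
  have := locQ x (conj (BW _ Bx) Ex); apply: filterS => v H [Bv Ev].
  by apply: H; split => //; exact: BW.
have {}base x V : open V -> V x -> exists B, [/\ open B, B x, B `<=` V &
    connected (B `&` E)].
  by move=> oV Vx; apply: base; exact: open_nbhs_nbhs.
have [B [_ Bu _ BQ]] : Q' u; last by apply: BQ.
apply: (@connected_ind _ W Q' cW _ t u Wt Wu); last first.
  have [B [oB Bt BW cB]] := base _ _ oW Wt.
  by exists B; split => // y By; apply: (Bconst B BW cB t).
move=> x Wx; have [B [oB Bx BW cB]] := base _ _ oW Wx.
have [b [Bb Eb]] := dE _ (ex_intro _ x Bx) oB.
have nB : nbhs x B by exact: open_nbhs_nbhs.
have QQ' : Q b -> forall v, B v -> Q' v.
  by move=> Qb v Bv; exists B; split => // y By; apply: (Bconst B BW cB b).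
have Q'Q v : B v -> Q' v -> Q b.
  move=> Bv [B' [oB' B'v B'W B'Q]].
  have [w [[Bw B'w] Ew]] :=
    dE (B `&` B') (ex_intro _ v (conj Bv B'v)) (openI oB oB').
  by apply: (Bconst B BW cB w); [split|split|apply: B'Q].
by apply: filterS nB => v Bv _; split => [/(Q'Q _ Bx)/QQ'|/(Q'Q _ Bv)/QQ']; apply.
Qed.

(** A point of [B] is approximated in the same open set by points of [A], at which a locally
    constant property takes the same value. This is for ordinary loci, which may be larger than the
    complement of [S]. *)
Lemma portly_sub (T : topologicalType) (A B : set T) : portly A -> open B ->
  A `<=` B -> portly B.
Proof.
move=> [oA dA lA] oB AB; split => //.
  by move=> O O0 oO; have [x [Ox /AB Bx]] := dA O O0 oO; exists x.
move=> U oU cU; have cUA := lA U oU cU.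
apply: connected_intro => Q locQ t u Ht Hu Qt.
have appr v : (U `&` B) v -> exists w, (U `&` A) w /\ (Q v <-> Q w).
  move=> [Uv Bv].
  have : nbhs v [set w | (U `&` B) w -> (Q v <-> Q w)].
    exact: (locQ v (conj Uv Bv)).
  rewrite nbhsE => -[G [oG Gv] HG].
  have [w [[Gw Uw] Aw]] := dA (G `&` U) (ex_intro _ v (conj Gv Uv)) (openI oG oU).
  exists w; split; first by split.
  by apply: HG => //; split => //; exact: AB.
have [t' [UAt' tt']] := appr _ Ht; have [u' [UAu' uu']] := appr _ Hu.
apply/uu'; apply: (connected_ind cUA _ UAt' UAu'); last exact/tt'.
move=> v [Uv Av]; have := locQ v (conj Uv (AB _ Av)).
by apply: filterS => w H [Uw Aw]; apply: H; split => //; exact: AB.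
Qed.

Lemma ordinary_open (X Y : topologicalType) (p : X -> Y) : open (ordinary p).
Proof.
rewrite openE => y [U [oU Uy HU]]; rewrite /interior.
by apply: (@filterS _ _ _ U); [move=> z Uz; exists U|exact: open_nbhs_nbhs].
Qed.

(** * The construction is a branched covering *)

Section universal_branched.
Variables (R : realType) (Y : topologicalType) (S : set Y) (y0 : Y).
Local Notation D := (~` S).
Local Notation X := (branched_space R S y0).
Local Notation pr := (@bproj R Y S y0).
Local Notation dpath := (@dpath R Y S y0).
Local Notation drel := (@drel R Y S y0).
Local Notation end_class := (@end_class R Y S y0).
Local Notation is_end_class := (@is_end_class R Y S y0).
Local Notation leaf := (@leaf R Y S y0).
Hypotheses (aY : admissible_space R Y) (cY : connected [set: Y]).
Hypotheses (pD : portly D) (Dy0 : D y0).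
Variable x0 : X.
Local Notation pt := (dpath_pt x0).
Implicit Types (U V W : set Y) (x : X) (f g : R -> Y) (c : set (R -> Y)).

Let hY : hausdorff_space Y. Proof. by case: aY. Qed.
Let lY : locally_path_connected R Y. Proof. by case: aY. Qed.
Let fY : first_countable Y. Proof. by case: aY. Qed.
Let oD : open D. Proof. by case: pD. Qed.
Let bpC : continuous pr := bproj_continuous lY.

Lemma cst_dpath : dpath (fun _ => y0).
Proof. by split => //; cont. Qed.

Lemma leaf_connected U c : open U -> connected U -> is_end_class U c ->
  connected (leaf U c).
Proof.
move=> oU cU Hc; apply: (@joined_connected R) => x x'.
exact: (leaf_joined lY x0 fY oU cU Hc).
Qed.

Lemma branched_space_admissible : admissible_space R X.
Proof.
split; [exact: hausdorff_branched_space| |exact: first_countable_branched_space].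
apply: joined_lpc => x W /(nbhs_leaf lY) [U nU UW]; have [oU cU Ux] := nU.
exists (leaf U (bclass x U)); split => //; first exact: leaf_open.
by move=> z z'; apply: (leaf_joined lY x0 fY oU cU); exact: bclassP.
Qed.

(** The class on [U] is locally constant over [U], and leaves are connected. *)
Lemma component_leaf U x : open U -> connected U -> U (pr x) ->
  connected_component (pr @^-1` U) x = leaf U (bclass x U).
Proof.
move=> oU cU Ux; apply/seteqP; split.
  move=> z xz; split; first exact: (connected_component_sub xz).
  apply: (@connected_ind _ _ (fun z => bclass z U = bclass x U)
    (@component_connected _ (pr @^-1` U) x) _ x z _ xz) => //; last first.
    exact: connected_component_refl.
  move=> v /connected_component_sub Uv.
  have : nbhs v (leaf U (bclass v U)).
    by apply/(nbhs_leaf lY); exists U.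
  by apply: filterS => w [_ ->].
apply: connected_component_max => //; first by move=> z [].
by apply: leaf_connected => //; exact: bclassP.
Qed.

Lemma bproj_spread : spread pr.
Proof.
have [_ lX _] := branched_space_admissible.
apply: (spread_intro lX bpC) => x W /(nbhs_leaf lY) [U [oU cU Ux] UW].
by exists U; split => //; rewrite component_leaf.
Qed.

(** Components over connected open sets are leaves, so an increasing choice of components is an
    increasing choice of classes, that is, a point. *)
Lemma bproj_complete : complete pr.
Proof.
move=> y _ ch N chN chS.
pose cc U := [set f | exists x, [/\ N U, ch U x & bclass x U f]].
have chE U : N U -> exists x, [/\ cnbhs (pr x) U, ch U = leaf U (bclass x U) &
    cc U = bclass x U].
  move=> NU; have [oU cU _] := NU; have [x Ux E] := chN U NU.
  have cE : ch U = leaf U (bclass x U) by rewrite E component_leaf.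
  exists x; split => //; apply/seteqP; split => f.
    by move=> [z [_]]; rewrite cE => -[_ ->].
  by move=> xf; exists x; split => //; rewrite cE.
have [||x [px xE]] := @branched_point_intro R Y S y0 y cc.
- by move=> U /chE [x [nU _ ->]]; exact: bclassP.
- move=> U V NU NV UV; have [x [nU cU ->]] := chE U NU.
  have [x' [nV cV ->]] := chE V NV.
  have [_ <-] : leaf V (bclass x' V) x.
    by rewrite -cV; apply: (chS U V NU NV UV); rewrite cU; split; case: nU.
  have [oV coV _] := nV; apply: bclass_sub => //; split => //.
  by apply: UV; case: nU.
exists x => U NU; have [x' [_ -> E]] := chE U NU.
by split; [rewrite px; case: NU|rewrite xE].
Qed.

(** A representative is continued to [y] inside [U], avoiding [S] before the end. Stopping the
    result at time 1/2 gives back the representative. *)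
Lemma leaf_surj U c y : open U -> connected U -> is_end_class U c -> U y ->
  exists2 x, leaf U c x & pr x = y.
Proof.
move=> oU cU [f [df Uf ->]] Uy; have [cf f0 fD] := df.
have [g [cg g0 g1 gUD]] := portly_path lY fY pD oU cU Uf (fD 1) Uy.
have cfg : continuous (concatR f g) by apply: concatR_continuous.
have n2 := half_itv R.
have [|||x [px xE]] := @path_point R Y S y0 (concatR f g).
- exact: cfg.
- by rewrite concatR0.
- move=> t t01; rewrite /concatR; case: ifP => // _.
  by apply: (gUD _ _).2; lra.
rewrite concatR1 g1// in px xE.
exists x => //; split; first by rewrite px.
rewrite (xE U _ 2^-1 n2)//; last first.
  move=> t t1; rewrite /concatR; case: ifP => t2.
    by have -> : 2 * t = 1 by lra.
  have [t3|t3] := ltrP (2 * t - 1) 1; first exact: (gUD _ t3).1.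
  by rewrite g1.
apply: end_class_eq; apply: drel_sym; apply: drel_eq => // t t01.
by rewrite /truncate clamp_id// mulrC concatR_half.
Qed.

(** On the whole of [Y] the end of a path is free, so that every path retracts to its origin: there
    is one class only, and the space is a single leaf. *)
Lemma branched_space_joined x x' : joined R setT x x'.
Proof.
apply: (@joined_sub _ _ (leaf setT (bclass x setT))) => //.
have nT (z : X) : cnbhs (pr z) setT by split => //; exact: openT.
have Hx := bclassP (nT x); have Hx' := bclassP (nT x').
apply: (leaf_joined lY x0 fY openT cY Hx) => //; split => //.
have [f xf] := is_end_class_neq0 Hx; have [f' xf'] := is_end_class_neq0 Hx'.
have [df _ ->] := is_end_classE Hx xf; have [df' _ ->] := is_end_classE Hx' xf'.
apply: end_class_eq; apply: (@drel_trans _ _ _ _ _ (fun _ => y0)).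
  have [cf' f'0 f'D] := df'.
  apply: (@drel_trans _ _ _ _ _ (truncate f' 1)).
    by apply: drel_eq => // t t01; rewrite /truncate clamp_id// mul1r.
  apply: (@drel_trans _ _ _ _ _ (truncate f' 0)).
    by apply: truncate_drel.
  apply: drel_eq => //; first by apply: truncate_dpath.
  by move=> t t01; rewrite /truncate mul0r.
have [cf f_0 fD] := df; apply: drel_sym.
apply: (@drel_trans _ _ _ _ _ (truncate f 1)).
  by apply: drel_eq => // t t01; rewrite /truncate clamp_id// mul1r.
apply: (@drel_trans _ _ _ _ _ (truncate f 0)).
  by apply: truncate_drel.
apply: drel_eq => //; first by apply: truncate_dpath.
by move=> t t01; rewrite /truncate mul0r.
Qed.

Lemma branched_space_connected : connected [set: X].
Proof.
by apply: (@joined_connected R) => x x' _ _; exact: branched_space_joined.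
Qed.

Lemma bproj_surj y : exists x, pr x = y.
Proof.
have [|x _ px] := @leaf_surj setT (end_class setT (fun _ => y0)) y openT cY _ I.
  by exists (fun _ => y0); split => //; exact: cst_dpath.
by exists x.
Qed.

Definition simple_nbhs U z :=
  [/\ open U, connected U, U z, U `<=` D & null_loops R S U z].

Lemma bclass_end_at x U : cnbhs (pr x) U -> U `<=` D ->
  exists2 f, bclass x U f & f 1 = pr x.
Proof.
move=> nU UD; have [oU cU Ux] := nU; have Hc := bclassP nU.
have [f xf] := is_end_class_neq0 Hc; have [df Uf E] := is_end_classE Hc xf.
have [a [ca a0 a1 aU]] := open_joined lY oU cU Uf Ux.
exists (concatR f a); last by rewrite concatR1.
rewrite E; split; first by apply: concatR_dpath => // t; exact: UD.
by apply: drel_ext => // t; exact: UD.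
Qed.

(** Representatives on a small [B] can be chosen with the same end. As loops of [U] contract, a
    homotopy with its end in [U] can be replaced by one with fixed ends, so the classes already
    agree on [B], hence on [V]. *)
Lemma leaf_inj U z c x x' : simple_nbhs U z -> leaf U c x -> leaf U c x' ->
  pr x = pr x' -> x = x'.
Proof.
move=> [oU cU Uz UD nlU] [Ux xc] [Ux' x'c] pxx.
apply: branched_space_eq => // V nV; have [oV cV Vx] := nV.
have nVU : nbhs (pr x) (V `&` U).
  by apply: open_nbhs_nbhs; split => //; exact: openI.
have [B [oB cB Bx BVU]] := lpc_connected lY nVU.
have nB : cnbhs (pr x) B by [].
have nB' : cnbhs (pr x') B by rewrite -pxx.
have BU : B `<=` U by move=> y /BVU[].
have BD : B `<=` D by move=> y /BU /UD.
have [f xf f1] := bclass_end_at nB BD.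
have [f' xf' f'1] := bclass_end_at nB' BD.
have [df _ E] := is_end_classE (bclassP nB) xf.
have [df' _ E'] := is_end_classE (bclassP nB') xf'.
have cnU : cnbhs (pr x) U by [].
have cnU' : cnbhs (pr x') U by [].
have cxf : bclass x U f by exact: (bclass_sub nB cnU BU).
have cxf' : bclass x U f'.
  by rewrite xc -x'c; exact: (bclass_sub nB' cnU' BU).
have [_ _ EU] := is_end_classE (bclassP cnU) cxf.
have ff' : drel U f f' by move: cxf'; rewrite EU => -[].
have jU := open_joined lY oU cU.
have ff1 : drel [set f 1] f f'.
  by apply: (drel_null_loops_joined UD jU Uz nlU) => //; rewrite f1 f'1.
apply: (@bclass_determined _ _ _ _ _ _ V B) => //; first by rewrite -pxx.
- by move=> y /BVU[].
- rewrite E E'; apply: end_class_eq; apply: drel_sub ff1 => y ->.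
  by rewrite f1.
Qed.

Lemma leaf_maps_homeomorphically U z c : simple_nbhs U z -> is_end_class U c ->
  maps_homeomorphically (leaf U c) U pr.
Proof.
move=> gU Hc; have [oU cU Uz UD nlU] := gU; split.
- split.
  + by move=> x [].
  + by move=> x x' /set_mem Hx /set_mem Hx'; exact: (leaf_inj gU Hx Hx').
  + by move=> y Uy; have [x cx <-] := leaf_surj oU cU Hc Uy; exists x.
- exact: continuous_subspaceT.
- move=> W oW; exists (pr @` (leaf U c `&` W)).
    rewrite openE => _ [x [[Ux xc] Wx] <-]; rewrite /interior.
    have : nbhs x (leaf U c `&` W).
      apply: open_nbhs_nbhs; split; last by split.
      by apply: openI => //; exact: leaf_open.
    move=> /(nbhs_leaf lY) [V [oV cV Vx] VW].
    apply: (@filterS _ _ _ V); last exact: open_nbhs_nbhs.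
    move=> v Vv.
    have nV : cnbhs (pr x) V by [].
    have [x' Vx' <-] := leaf_surj oV cV (bclassP nV) Vv.
    by exists x'; first exact: VW.
  apply/seteqP; split => y; last by case.
  by move=> [x [[Ux xc] Wx] <-]; split => //; exists x.
Qed.

Hypothesis gN : forall z, D z -> exists U, simple_nbhs U z.

Lemma over_dpath x : D (pr x) -> exists2 f, dpath f & x = pt f.
Proof.
move=> Dx; have [U gU] := gN Dx; have [oU cU Ux UD nlU] := gU.
have nU : cnbhs (pr x) U by [].
have [f xf f1] := bclass_end_at nU UD.
have [df _ E] := is_end_classE (bclassP nU) xf.
exists f => //; apply: (leaf_inj gU (c := bclass x U)) => //.
  by apply: dpath_pt_leaf => //; exact: bclassP.
by have [-> _] := dpath_ptP x0 df.
Qed.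

(** Local connectedness is checked on leaves: over [D] their points come from paths of [D], and a
    homotopy between two such paths joins the points without leaving the part over [D]. *)
Lemma portly_over : portly (pr @^-1` D).
Proof.
have dD : dense (pr @^-1` D).
  move=> O [x Ox] oO.
  have [U [oU cU Ux] UO] := (nbhs_leaf lY _ _).1 (open_nbhs_nbhs (conj oO Ox)).
  have Hc := bclassP (And3 oU cU Ux).
  have [f xf] := is_end_class_neq0 Hc; have [df _ _] := is_end_classE Hc xf.
  exists (pt f); split; first by apply: UO; exact: dpath_pt_leaf.
  have [pf _] := dpath_ptP x0 df.
  suff : D (pr (pt f)) by [].
  by rewrite pf; case: df.
split => //; first by apply: open_comp => // x _; exact: bpC.
apply: locally_connected_in_base => // x W /(nbhs_leaf lY) [U nU UW].
have [oU cU Ux] := nU; have Hc := bclassP nU.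
exists (leaf U (bclass x U)); split => //; first exact: leaf_open.
apply: (@joined_connected R) => z z' [[Uz zx] Dz] [[Uz' z'x] Dz'].
have [f df zE] := over_dpath Dz; have [f' df' z'E] := over_dpath Dz'.
have [pf Hf] := dpath_ptP x0 df; have [pf' Hf'] := dpath_ptP x0 df'.
subst z z'.
have xE : bclass x U = end_class U f by rewrite -zx Hf// -pf.
have xE' : bclass x U = end_class U f' by rewrite -z'x Hf'// -pf'.
have [_ ff'] : end_class U f f'.
  by rewrite -xE xE'; apply: end_class_refl; rewrite -?pf'.
rewrite xE; apply: joined_sub (drel_joined lY x0 oU cU df ff' df').
by move=> z [[]].
Qed.

Lemma over_ordinary : D `<=` ordinary pr.
Proof.
move=> z Dz; have [U gU] := gN Dz; have [oU cU Uz UD nlU] := gU.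
exists U; split => // _ [x Ux ->]; rewrite component_leaf//.
by apply: (leaf_maps_homeomorphically gU); exact: bclassP.
Qed.

Lemma bproj_branched_covering : branched_covering R pr.
Proof.
have aX := branched_space_admissible.
have oOrd := @ordinary_open X Y pr.
split.
- by split.
- by split; [exact: bproj_spread|exact: bproj_complete].
- by move=> y _; have [x <-] := bproj_surj y; exists x.
- by split => //; exact: branched_space_connected.
- split.
    apply: portly_sub portly_over _ _; last by move=> x; exact: over_ordinary.
    by apply: open_comp => // x _; exact: bpC.
  by apply: portly_sub pD oOrd over_ordinary.
Qed.

End universal_branched.

(* If [L] is a homotopy between [f * g] and [f] with fixed ends, then [g] is
   contracted through the sides of the square, along which [L] reads
   [f^-1 * cst * f * cst]. *)
Lemma square_contraction (R : realType) (Z : topologicalType)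
    (L : R * R -> Z) (b e : Z) : continuous L ->
  (forall s : R, L (s, 0) = b) -> (forall s : R, L (s, 1) = e) ->
  (forall t : R, 0 <= t <= 1 -> L (0, t / 2) = L (1, t)) ->
  exists N : R * R -> Z, [/\ continuous N,
    forall t : R, 0 <= t <= 1 -> N (0, t) = L (0, (1 + t) / 2),
    forall t : R, N (1, t) = e, forall s : R, N (s, 0) = e /\ N (s, 1) = e &
    forall z, range L (N z)].
Proof.
move=> cL Lb Le L01.
(* [(b1 t, b2 t)] goes from [(0, 1/2)] to [(0, 0)], then [(1, 0)], [(1, 1)] and [(0, 1)], a quarter
   of the time for each piece. By [Lbph], what [L] reads on this route it also reads on the side
   [s = 1] at the times [ph t]. *)
pose b1 (t : R) := clamp 0 1 (Num.min (4 * t - 1) (4 - 4 * t)).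
pose b2 (t : R) := Num.max (2^-1 - 2 * t) (clamp 0 1 (4 * t - 2)).
pose ph (t : R) := Num.max (1 - 4 * t) (clamp 0 1 (4 * t - 2)).
have Lbph (t : R) : 0 <= t <= 1 -> L (b1 t, b2 t) = L (1, ph t).
  move=> t01; rewrite /b1 /b2 /ph.
  have [t4|t4] := lerP t 4^-1.
    rewrite (@clamp_le R 0 1 (4 * t - 2)) ?ler01//; last by lra.
    rewrite (@clamp_le R 0 1 (Num.min _ _)) ?ler01//; last first.
      by rewrite ge_min; apply/orP; left; lra.
    rewrite max_l; last by lra.
    rewrite max_l; last by lra.
    by rewrite -L01; [congr (L (_, _)); lra|lra].
  have [t2|t2] := lerP t 2^-1.
    rewrite (@clamp_le R 0 1 (4 * t - 2)) ?ler01//; last by lra.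
    rewrite max_r; last by lra.
    rewrite max_r; last by lra.
    by rewrite !Lb.
  have /andP[c42 _] := @clamp_itv R 0 1 (4 * t - 2) ler01.
  rewrite max_r; last by apply: le_trans c42; lra.
  rewrite max_r; last by apply: le_trans c42; lra.
  have [t3|t3] := lerP t (3 / 4).
    rewrite (@clamp_ge R 0 1 (Num.min _ _)) ?ler01//.
    by rewrite le_min; apply/andP; split; lra.
  rewrite (@clamp_ge R 0 1 (4 * t - 2)) ?ler01//; last by lra.
  by rewrite !Le.
have b10 : b1 0 = 0.
  by rewrite /b1 clamp_le ?ler01// ge_min; apply/orP; left; lra.
have b11 : b1 1 = 0.
  by rewrite /b1 clamp_le ?ler01// ge_min; apply/orP; right; lra.
have c42_0 : clamp 0 1 (4 * 0 - 2) = 0 :> R.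
  by apply: clamp_le; [exact: ler01|lra].
have c42_1 : clamp 0 1 (4 * 1 - 2) = 1 :> R.
  by apply: clamp_ge; [exact: ler01|lra].
have b20 : b2 0 = 2^-1 by rewrite /b2 c42_0 mulr0 subr0 max_l// invr_ge0.
have b21 : b2 1 = 1 by rewrite /b2 c42_1 max_r//; lra.
have ph0 : ph 0 = 1 by rewrite /ph c42_0 mulr0 subr0 max_l// ler01.
have ph1 : ph 1 = 1 by rewrite /ph c42_1 max_r//; lra.
have cb1 : continuous b1 by rewrite /b1; cont.
have cb2 : continuous b2 by rewrite /b2; cont.
have cph : continuous ph by rewrite /ph; cont.
pose M (s t : R) := if s <= 2^-1
  then L (2 * s * b1 t, (1 - 2 * s) * ((1 + t) / 2) + 2 * s * b2 t)
  else L (1, (2 - 2 * s) * ph t + (2 * s - 1)).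
have l2 : L (0, 2^-1) = e.
  have := L01 1; rewrite mul1r => ->; first exact: Le.
  by rewrite lexx ler01.
have c0 : clamp 0 1 0 = 0 :> R by rewrite clamp_id ?lexx ?ler01.
have c1 : clamp 0 1 1 = 1 :> R by rewrite clamp_id ?lexx ?ler01.
exists (fun z => M (clamp 0 1 z.1) (clamp 0 1 z.2)); split.
- apply: (@cont_glue R) => //; cont => z E; rewrite E.
  have -> : 2 * 2^-1 = 1 :> R by rewrite mulfV.
  rewrite !mul1r subrr mul0r add0r addr0 Lbph; last exact: clamp_itv ler01.
  by congr (L (_, _)); lra.
- move=> t t01; rewrite /= c0 (clamp_id t01) /M invr_ge0 ler0n.
  by rewrite mulr0 !mul0r subr0 mul1r addr0.
- move=> t; rewrite /= c1 /M ifF; last by apply/negbTE; rewrite -ltNge; lra.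
  rewrite (_ : _ + _ = 1); first exact: Le.
  by rewrite (_ : 2 - 2 * 1 = 0 :> R) ?mul0r; lra.
- move=> s; rewrite /= c0 c1 /M b10 b11 b20 b21 ph0 ph1 !mulr0 !mulr1.
  case: ifP => _.
    split; first by rewrite (_ : _ + _ = 2^-1) ?l2//; lra.
    by rewrite (_ : _ + _ = 1) ?Le//; lra.
  by rewrite (_ : _ + _ = 1) ?Le//; lra.
- by move=> z; rewrite /M; case: ifP => _; eexists.
Qed.

Lemma simple_nbhs_exists (R : realType) (Y : topologicalType) (S : set Y) :
  locally_path_connected R Y -> open (~` S) ->
  semi_locally_simply_connected R (set_type (~` S)) ->
  forall z, (~` S) z -> exists U, simple_nbhs R S U z.
Proof.
move=> lY oD sl z Dz.
have [W nW HW] := sl (SigSub (mem_set Dz)).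
have [V nV VW] := (nbhs_set_type _ _).1 nW.
have nVD : nbhs z (V `&` ~` S) by apply: filterI => //; exact: open_nbhs_nbhs.
have [U [oU cU Uz UVD]] := lpc_connected lY nVD.
exists U; split => //; first by move=> u /UVD[].
move=> f cf fU f0 f1.
have cfv : continuous (fun i : unit_interval R => f (val i)).
  by cont; exact: val_continuous.
have [f' cf' f'E] := corestrict cfv (fun i => (UVD _ (fU (val i))).2).
have [|i|N [cN N0 N1 Ns _]] := HW f'.
- split => //.
    by apply: val_inj; rewrite -set_valE f'E /= f0.
  by apply: val_inj; rewrite -set_valE f'E /= f1.
- by apply: VW; rewrite /= f'E; exact: (UVD _ (fU (val i))).1.
have cI := @clampI_continuous R.
have cv := @initial_continuous _ _ (set_val : set_type (~` S) -> Y).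
exists (fun x => set_val (N (clampI x.1, clampI x.2))); split.
- by cont.
- by move=> t t01; rewrite /= clampI0 N0 f'E val_clampI clamp_id.
- by move=> t; rewrite /= clampI1 N1.
- move=> s; rewrite /= clampI0 clampI1 (Ns _).1 (Ns _).2 !f'E.
  by rewrite -clampI0 -clampI1 !val_clampI !clamp_id ?lexx ?ler01.
- by move=> x; exact: set_valP.
Qed.

(** * The part over the complement of [S] is a universal covering *)

Section universal_cover.
Variables (R : realType) (Y : topologicalType) (S : set Y) (y0 : Y).
Local Notation D := (~` S).
Local Notation X := (branched_space R S y0).
Local Notation pr := (@bproj R Y S y0).
Local Notation dpath := (@dpath R Y S y0).
Local Notation drel := (@drel R Y S y0).
Local Notation end_class := (@end_class R Y S y0).
Local Notation is_end_class := (@is_end_class R Y S y0).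
Local Notation leaf := (@leaf R Y S y0).
Hypotheses (aY : admissible_space R Y) (cY : connected [set: Y]).
Hypotheses (pD : portly D) (Dy0 : D y0).
Variable x0 : X.
Hypothesis gN : forall z, D z -> exists U, simple_nbhs R S U z.
Local Notation pt := (dpath_pt x0).
Local Notation E := (set_type (pr @^-1` D)).
Implicit Types (U V W : set Y) (x : X) (f g : R -> Y) (c : set (R -> Y)).

Let lY : locally_path_connected R Y. Proof. by case: aY. Qed.
Let oD : open D. Proof. by case: pD. Qed.
Let aX : admissible_space R X := branched_space_admissible aY x0.
Let bpC : continuous pr := bproj_continuous lY.
Let oE : open (pr @^-1` D).
Proof. by apply: open_comp => // x _; exact: bpC. Qed.
Let vC : continuous (set_val : E -> X) := @initial_continuous _ _ _.

Definition cover_proj (e : E) : set_type D :=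
  SigSub (mem_set (set_valP e : D (pr (set_val e)))).

Lemma cover_proj_continuous : continuous cover_proj.
Proof.
by apply: continuous_comp_initial; exact: (cont_comp bpC vC).
Qed.

Lemma cover_proj_covering : covering cover_proj.
Proof.
split; first exact: cover_proj_continuous.
  move=> y _; have [x px] := bproj_surj aY cY pD Dy0 (set_val y).
  have Dx : (pr @^-1` D) x by rewrite /= px; exact: (set_valP y).
  by exists (SigSub (mem_set Dx)) => //; apply: val_inj.
move=> y; have [U gU] := gN (set_valP y); have [oU cU Uy UD nlU] := gU.
have cv := @initial_continuous _ _ (set_val : set_type D -> Y).
exists (set_val @^-1` U); split => //.
  by apply: open_comp => // z _; exact: cv.
exists [set set_val @^-1` leaf U c | c in is_end_class U]; split.
- apply/seteqP; split => e.
    move=> Ue; exists (set_val @^-1` leaf U (bclass (set_val e) U)) => //.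
    by exists (bclass (set_val e) U) => //; exact: bclassP.
  by move=> [_ [c Hc <-] [Ue _]].
- by move=> _ _ [c Hc <-] [c' Hc' <-] [e [[_ ec] [_ ec']]]; rewrite -ec -ec'.
- move=> _ [c Hc <-]; split.
    by apply: open_comp; [move=> e _; exact: vC|exact: leaf_open].
  have [[_ inj surj] _ op] := leaf_maps_homeomorphically aY pD gU Hc.
  split.
  + split.
    * by move=> e [Ue _].
    * move=> e e' /set_mem He /set_mem He' /(congr1 set_val) /= ee'.
      by apply: val_inj; apply: inj ee'; rewrite inE.
    * move=> z Uz; have [x cx px] := surj _ Uz.
      have Dx : (pr @^-1` D) x by rewrite /= px; exact: (set_valP z).
      by exists (SigSub (mem_set Dx)) => //; apply: val_inj.
  + by apply: continuous_subspaceT; exact: cover_proj_continuous.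
  + move=> _ [W oW <-]; have [W' oW' WW'] := op W oW.
    exists (set_val @^-1` W'); first by apply: open_comp => // z _; exact: cv.
    apply/seteqP; split => z.
      move=> [e [ec We] <-].
      suff : (U `&` W') (pr (set_val e)) by [].
      by rewrite -WW'; exists (set_val e).
    move=> [Uz W'z]; have : (U `&` W') (set_val z) by [].
    rewrite -WW' => -[x [cx Wx] px].
    have Dx : (pr @^-1` D) x by rewrite /= px; exact: (set_valP z).
    by exists (SigSub (mem_set Dx)) => //; apply: val_inj.
Qed.

Let embE : embedding (set_val : E -> X).
Proof.
split; first exact: val_inj.
by move=> A; split; [move=> [B oB <-]; exists B|move=> [B oB ->]; exists B].
Qed.

Let rangeE : range (set_val : E -> X) = pr @^-1` D.
Proof.
apply/seteqP; split => x; first by move=> [e _ <-]; exact: set_valP.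
by move=> Dx; exists (SigSub (mem_set Dx)).
Qed.

Let shE : sheeted pr (pr @^-1` D) S.
Proof.
rewrite -rangeE; apply: covering_sheeted cover_proj_covering => //.
by rewrite rangeE.
Qed.

(** The loop equals the lift of its projection [om] made of classes of stopped paths. Its closing up
    says that [a] followed by [om] has the same class as [a], hence is homotopic to it with fixed
    ends; stopping the paths of this homotopy gives a square of points that contracts the loop. *)
Lemma cover_simply_connected : simply_connected R E.
Proof.
have [hX lX _] := aX.
have [_ _ lcE] := portly_over aY pD x0 gN.
split.
  move=> e e' _ _.
  have cE : connected (pr @^-1` D).
    rewrite -[X in connected X](setTI (pr @^-1` D)); apply: lcE openT _.
    exact: branched_space_connected aY cY x0.
  have [f [cf f0 f1 fE]] := open_joined lX oE cE (set_valP e) (set_valP e').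
  apply: joined_is_path; have [f' cf' f'E] := corestrict cf fE.
  by exists f'; split => //; apply: val_inj; rewrite -set_valE f'E.
move=> e l [cl l0 l1].
pose z := pr (set_val e); have Dz : D z := set_valP e.
have [U gU] := gN Dz; have [oU cU Uz UD nlU] := gU.
have [a da eE] := over_dpath aY x0 gN Dz.
have [ca a0 aD] := da.
have [pa Ha] := dpath_ptP x0 da; rewrite -eE -/z in pa.
pose f (t : R) : X := set_val (l (clampI t)).
have cf : continuous f.
  have cI := @clampI_continuous R; have vC' := vC.
  by rewrite /f; cont.
have f0 : f 0 = set_val e by rewrite /f clampI0 l0.
have f1 : f 1 = set_val e by rewrite /f clampI1 l1.
pose om (t : R) := pr (f t).
have com : continuous om by exact: (cont_comp bpC cf).
have omD t : D (om t) by exact: set_valP (l (clampI t)).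
have om0 : om 0 = a 1 by rewrite /om f0 -pa.
have om1 : om 1 = z by rewrite /om f1.
pose k := concatR a om.
have dk : dpath k by exact: concatR_dpath.
have [ck k0 kD] := dk.
have dtr (u : R) : 0 <= u -> dpath (truncate k u).
  by move=> u0; apply: truncate_dpath.
(* The first half of [k] is [a], so the points of [k] stopped between times 1/2 and 1 start at the
   base point and lie over [om]. *)
pose g (t : R) := pt (truncate k ((1 + clamp 0 1 t) / 2)).
pose G0 (w : (R * R) * R) := k (w.1.1 * clamp 0 1 w.2).
have cG0 : continuous (fun w : R * R => pt (fun u => G0 (w, u))).
  apply: dpath_pt_continuous => //.
  - by rewrite /G0; cont.
  - by move=> w; rewrite /G0 /= (@clamp_id R 0 1 0) ?lexx ?ler01// mulr0.
  - by move=> w; exact: kD.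
have cg : continuous g.
  apply: (@cont_comp _ _ _ (fun w : R * R => pt (fun u => G0 (w, u)))
    (fun t : R => ((1 + clamp 0 1 t) / 2, 0 : R)) cG0).
  by cont.
have c0 : clamp 0 1 0 = 0 :> R by rewrite clamp_id ?lexx ?ler01.
have c1 : clamp 0 1 1 = 1 :> R by rewrite clamp_id ?lexx ?ler01.
have pg (t : R) : pr (g t) = k ((1 + clamp 0 1 t) / 2).
  have t01 := @clamp_itv R 0 1 t ler01.
  have [|-> _] := dpath_ptP x0 (dtr ((1 + clamp 0 1 t) / 2) _); first by lra.
  by rewrite /truncate c1 mulr1.
have pt_eq h h' : dpath h -> dpath h' ->
    (forall t : R, 0 <= t <= 1 -> h t = h' t) -> pt h = pt h'.
  by move=> dh dh' hh'; apply: dpath_pt_eq => //; exact: drel_eq.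
have g0 : g 0 = set_val e.
  rewrite /g c0 addr0 eE; apply: pt_eq => //; first by apply: dtr; lra.
  by move=> t t01; rewrite /truncate (clamp_id t01) mul1r mulrC /k concatR_half.
have fg (t : R) : 0 <= t <= 1 -> f t = g t.
  move=> t01; apply: (@lift_unique _ _ pr _ S hX _ shE R [set` `[0, 1]] f g 0).
  - by [].
  - exact: connected_itv.
  - by move=> u _; exact: cf.
  - by move=> u _; exact: cg.
  - move=> u; rewrite /= in_itv /= => u01; split.
    + exact: omD.
    + by rewrite pg; exact: kD.
    + rewrite pg (clamp_id u01) /k /concatR; case: ifP => u2.
        have -> : u = 0 by lra.
        by rewrite addr0 (_ : 2 * (1 / 2) = 1 :> R) -?om0//; lra.
      by rewrite /om; congr (pr (f _)); lra.
  - by rewrite /= in_itv /= lexx ler01.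
  - by rewrite f0 g0.
  - by rewrite /= in_itv.
have kk1 t : 0 <= t <= 1 -> truncate k 1 t = k t.
  by move=> t01; rewrite /truncate clamp_id// mul1r.
have g1 : g 1 = pt k.
  rewrite /g c1 (_ : (1 + 1) / 2 = 1 :> R); last by lra.
  by apply: pt_eq => //; apply: dtr; exact: ler01.
have ptka : pt k = pt a by rewrite -g1 -fg ?lexx ?ler01// f1 eE.
have k1 : k 1 = z by rewrite /k concatR1.
have ka : drel U k a.
  have [_ Hk] := dpath_ptP x0 dk.
  have := Ha U; rewrite -ptka -pa Hk ?k1// => /(_ (And3 oU cU Uz)) ka.
  have : end_class U a a by apply: end_class_refl; rewrite // -pa.
  by rewrite -ka => -[].
have [H [cH H0 H1 Hs HD]] : drel [set z] k a.
  by apply: (drel_null_loops nlU).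
(* [L (s, t)] is the point of the [s]-th path stopped at time [t]. On the side [s = 0] the second
   half reads the loop and the first half reads the same as the side [s = 1]: the situation of
   [square_contraction]. *)
pose G (w : (R * R) * R) := H (w.1.1, clamp 0 1 w.1.2 * clamp 0 1 w.2).
pose L (w : R * R) := pt (fun u => G (w, u)).
have dG w : dpath (fun u => G (w, u)).
  split.
  - by rewrite /G; cont.
  - by rewrite /G /= c0 mulr0 (Hs _).1.
  - by move=> u; exact: HD.
have cL : continuous L.
  apply: dpath_pt_continuous => //.
  - by rewrite /G; cont.
  - by move=> w; rewrite /G /= c0 mulr0 (Hs _).1.
  - by move=> w; exact: HD.
have LD w : D (pr (L w)).
  by have [-> _] := dpath_ptP x0 (dG w); exact: HD.
have L0 (t : R) : 0 <= t <= 1 -> L (0, t) = pt (truncate k t).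
  move=> t01; apply: pt_eq => //; first by apply: dtr; case/andP: t01.
  move=> u u01; rewrite /G /truncate /= (clamp_id t01) (clamp_id u01) H0//.
  by have /andP[? ?] := t01; have /andP[? ?] := u01; rewrite mulr_ge0// mulr_ile1.
have [|||N [cN N0 N1 Ns NL]] :=
    @square_contraction R X L (pt (fun _ => y0)) (set_val e) cL.
- move=> s; congr dpath_pt; apply/funext => u.
  by rewrite /G /= c0 mul0r (Hs _).1.
- move=> s; rewrite eE -ptka; apply: dpath_pt_eq => //.
  have Hz (r : R) : H (r, 1) = z by have [_ ->] := Hs r.
  exists (fun w => H ((1 - w.1) * s, clamp 0 1 w.2)); split.
  + by cont.
  + move=> t t01; rewrite /G /= c1 subr0 !mul1r//.
  + by move=> t t01; rewrite /= subrr mul0r (clamp_id t01) H0.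
  + move=> r /=; rewrite c0 c1 (Hs _).1; split => //.
    by rewrite /G /= !c1 mulr1 !Hz.
  + by move=> w; exact: HD.
- move=> t t01; rewrite L0; last by lra.
  apply: pt_eq => //; first by apply: dtr; lra.
  move=> u u01; rewrite /G /truncate /= (clamp_id t01) (clamp_id u01) H1.
    rewrite /k (_ : t / 2 * u = (t * u) / 2); last by lra.
    rewrite concatR_half//.
    have /andP[? ?] := t01; have /andP[? ?] := u01.
    by rewrite mulr_ge0// mulr_ile1.
  by have /andP[? ?] := t01; have /andP[? ?] := u01; rewrite mulr_ge0// mulr_ile1.
have cNv : continuous (fun w : unit_interval R * unit_interval R =>
    N (val w.1, val w.2)).
  by cont; [exact: val_fst_continuous|exact: val_snd_continuous].
have ND w : (pr @^-1` D) (N w) by have [w' _ <-] := NL w; exact: LD.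
have [N' cN' N'E] := corestrict cNv (fun w => ND _).
have Nf (u : R) : 0 <= u <= 1 -> N (0, u) = f u.
  move=> u01; rewrite N0// L0; last by lra.
  by rewrite fg// /g (clamp_id u01).
exists N'; split => //.
- move=> t; apply: val_inj; rewrite -!set_valE N'E /=.
  by rewrite Nf ?val_unit_itv// /f clampIK.
- by move=> t; apply: val_inj; rewrite -!set_valE N'E /= N1.
- by move=> s; split; apply: val_inj; rewrite -!set_valE N'E /= ?(Ns _).1
    ?(Ns _).2 ?l0 ?l1.
Qed.

Lemma branched_space_universal : is_universal_branched_covering R S pr.
Proof.
have [hX lX fX] := aX.
exists E, cover_proj; split.
  split; [exact: open_set_type_admissible|exact: cover_simply_connected|].
  exact: cover_proj_covering.
split => //.
- have [_ lE _] := open_set_type_admissible oE aX.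
  have cp : continuous (set_val \o cover_proj) by exact: (cont_comp bpC vC).
  apply: (spread_intro lE cp) => e W /nbhs_set_type [V nV VW].
  have [U [oU cU Ue] UV] := (nbhs_leaf lY _ _).1 nV.
  exists U; split => //; apply: subset_trans VW => e' [C [Ce CU cC] Ce'].
  apply: UV; rewrite -(component_leaf aY x0 oU cU Ue).
  exists (set_val @` C); last by exists e'.
  split; [by exists e|by move=> _ [e'' Ce'' <-]; exact: CU|].
  exact: connected_image.
- by split; [exact: bproj_spread|exact: bproj_complete].
- exists set_val; split => //.
  by rewrite rangeE; exact: portly_over.
Qed.

End universal_cover.

(** * The space of almost homotopy classes *)

Section homeomorphism_transport.
Variables (R : realType) (X X' Y : topologicalType) (h : X -> X') (k : X' -> X).
Variable p : X' -> Y.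
Hypotheses (ch : continuous h) (ck : continuous k).
Hypotheses (hK : cancel h k) (kK : cancel k h).

Let open_pre (W : set X) : open W -> open (k @^-1` W).
Proof. by move=> oW; apply: open_comp => // x _; exact: ck. Qed.

Let open_preh (W : set X') : open W -> open (h @^-1` W).
Proof. by move=> oW; apply: open_comp => // x _; exact: ch. Qed.

Lemma homeo_admissible : admissible_space R X' -> admissible_space R X.
Proof.
move=> [hX lX fX]; split.
- exact: (hausdorff_inj hX ch (can_inj hK)).
- apply: joined_lpc => x W nW.
  have nW' : nbhs (h x) (k @^-1` W) by apply: ck; rewrite hK.
  have [V [oV Vx VW jV]] := lpc_joined lX nW'.
  exists (h @^-1` V); split => //; first exact: open_preh.
    by move=> y /VW; rewrite /= hK.
  move=> y z Vy Vz; have [f [cf f0 f1 fV]] := jV _ _ Vy Vz.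
  exists (fun t => k (f t)); split; first by cont.
  - by rewrite f0 hK.
  - by rewrite f1 hK.
  - by move=> t; rewrite /= kK.
- move=> x; have [B [nB HB]] := fX (h x).
  exists (fun n => h @^-1` B n); split; first by move=> n; exact: ch.
  move=> W nW; have [|n BW] := HB (k @^-1` W); first by apply: ck; rewrite hK.
  by exists n => y /BW; rewrite /= hK.
Qed.

Lemma homeo_component (B : set X') x : connected_component (h @^-1` B) x =
  h @^-1` connected_component B (h x).
Proof.
apply/seteqP; split => y [C [Cx CB cC] Cy].
  exists (h @` C); last by exists y.
  split; [by exists x|by move=> _ [z Cz <-]; exact: CB|exact: connected_image].
exists (k @` C); last by exists (h y) => //; rewrite hK.
split; first by exists (h x) => //; rewrite hK.
  by move=> _ [z Cz <-]; rewrite /= kK; exact: CB.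
exact: connected_image.
Qed.

Lemma homeo_spread : locally_path_connected R X -> locally_path_connected R Y ->
  spread p -> spread (p \o h).
Proof.
move=> lX lY sp; have [cp _] := sp.
apply: (spread_intro lX); first exact: (cont_comp cp ch).
move=> x W nW; have nW' : nbhs (h x) (k @^-1` W) by apply: ck; rewrite hK.
have [U [oU cU Ux UW]] := spread_base lY sp nW'.
exists U; split => //; rewrite comp_preimage homeo_component => y /UW.
by rewrite /= hK.
Qed.

Lemma homeo_complete : complete p -> complete (p \o h).
Proof.
move=> cp y cy ch' N chN chS.
have [|||x Hx] := cp y _ (fun U => k @^-1` ch' U).
- apply: closureS cy => _ [x _ <-]; by exists (h x).
- move=> U NU; have [x Ux ->] := chN U NU; exists (h x) => //.
  rewrite comp_preimage homeo_component; apply/seteqP.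
  by split => z; rewrite /= kK.
- by move=> U V NU NV UV z; exact: chS.
by exists (k x).
Qed.

Lemma homeo_portly (A : set X') : portly A -> portly (h @^-1` A).
Proof.
move=> [oA dA lA]; split; first exact: open_preh.
- move=> O [x Ox] oO.
  have [|z [Oz Az]] := dA (k @^-1` O) _ (open_pre oO).
    by exists (h x); rewrite /= hK.
  by exists (k z); split; rewrite //= kK.
- move=> U oU cU.
  rewrite (_ : U `&` _ = k @` ((k @^-1` U) `&` A)).
    apply: connected_image => //; apply: lA; first exact: open_pre.
    rewrite (_ : k @^-1` U = h @` U); first exact: connected_image.
    apply/seteqP; split => z; last by move=> [x Ux <-]; rewrite /= hK.
    by move=> Uz; exists (k z).
  apply/seteqP; split => x.
    by move=> [Ux Ax]; exists (h x); rewrite /= ?hK.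
  by move=> [z [Uz Az] <-]; split; rewrite //= kK.
Qed.

Lemma homeo_ordinary : continuous p -> ordinary p `<=` ordinary (p \o h).
Proof.
move=> cp y [U [oU Uy HU]]; exists U; split => // _ [x Ux ->].
have [|[_ inj surj] _ op] := HU (connected_component (p @^-1` U) (h x)).
  by exists (h x).
rewrite comp_preimage homeo_component; split.
- split.
  + by move=> z /connected_component_sub.
  + move=> z z' /set_mem Hz /set_mem Hz' /= zz'.
    by apply: (can_inj hK); apply: inj zz'; rewrite inE.
  + move=> u Uu; have [z Cz <-] := surj _ Uu.
    by exists (k z); rewrite /= ?kK.
- by apply: continuous_subspaceT; exact: (cont_comp cp ch).
- move=> W oW; have [W' oW' WW'] := op _ (open_pre oW).
  exists W' => //; rewrite -WW'; apply/seteqP; split => u.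
    by move=> [z [Cz Wz] <-]; exists (h z) => //; split; rewrite //= hK.
  by move=> [z [Cz Wz] <-]; exists (k z); rewrite /= ?kK.
Qed.

Lemma homeo_branched_covering : branched_covering R p ->
  branched_covering R (p \o h).
Proof.
move=> [[aX' aY] [sp cpl] sj [cX' cY] [poX poY]].
have aX := homeo_admissible aX'; have [_ lX _] := aX; have [_ lY _] := aY.
have [cp _] := sp; have cph : continuous (p \o h) by exact: (cont_comp cp ch).
have oo := homeo_ordinary cp.
split => //.
- by split; [exact: homeo_spread|exact: homeo_complete].
- move=> y _; have [z _ <-] := sj y I; exists (k z) => //.
  by rewrite /= kK.
- split => //; rewrite (_ : setT = k @` setT); first exact: connected_image.
  by apply/esym/seteqP; split => // x _; exists (h x).
- split.
    apply: portly_sub (homeo_portly poX) _ _; last by move=> x; exact: oo.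
    by apply: open_comp; [move=> x _; exact: cph|exact: ordinary_open].
  exact: portly_sub poY (@ordinary_open _ _ _) oo.
Qed.

End homeomorphism_transport.

(** The fibers of [L] are those of the quotient map, so [L] induces a continuous bijection, whose
    inverse is continuous because [L] is open. It is applied to the constructed covering and again
    to an arbitrary one. *)
Lemma almost_homotopy_space_homeomorphism (R : realType) (Y : topologicalType)
    (S : set Y) (y0 : Y) (X : topologicalType) (p : X -> Y) :
  admissible_space R Y -> open (~` S) -> (~` S) y0 ->
  is_universal_branched_covering R S p ->
  exists h : almost_homotopy_space R S y0 -> X, homeomorphism h /\
    forall w, p (h (class_of w)) = endpoint w.
Proof.
move=> aY oD Dy0 /(universal_lift aY oD Dy0) [L [cL oL surjL pL fibL]].
have classE w w' : class_of w = class_of w' :> almost_homotopy_space R S y0 <->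
    L w = L w'.
  split.
    move=> /(congr1 (fun c => val (c : almost_homotopy_classes R S y0))) /= E.
    apply/fibL; suff : almost_homotopy_class w w' by [].
    by rewrite E; exact/fibL.
  move=> ww'; apply: (@val_inj _ _ (set_type (range _))) => /=.
  apply/seteqP; split => v /fibL wv; apply/fibL; first by rewrite -ww'.
  by rewrite ww'.
pose Q := almost_homotopy_space R S y0.
have reprE (c : Q) : class_of (class_repr c) = c by exact: class_reprK.
pose h (c : Q) := L (class_repr c).
have hE w : h (class_of w) = L w by apply/classE; exact: reprE.
have [s sE] := choice surjL.
have piE : \pi_(quotient_topology (almost_homotopy_classes R S y0))%qT =
  @class_of R Y S y0 by rewrite generic_quotient.pi.unlock.
have cc : continuous (@class_of R Y S y0) by rewrite -piE; exact: pi_continuous.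
exists h; split; last by move=> w; rewrite hE pL.
split.
  apply/quotient_continuous; rewrite piE (_ : h \o _ = L) //.
  by apply/funext => w; exact: hE.
exists (fun x => class_of (s x)); split.
- apply/continuousP => O oO; rewrite openE => x Ox; rewrite /interior.
  have oO' : open (@class_of R Y S y0 @^-1` O).
    by apply: open_comp => // w _; exact: cc.
  have := oL (s x) _ (open_nbhs_nbhs (conj oO' Ox)); rewrite sE.
  apply: filterS => _ [w Ow <-] /=.
  by rewrite (_ : class_of (s (L w)) = class_of w)//; apply/classE; exact: sE.
- move=> c; rewrite -[in RHS](reprE c) -[in LHS](reprE c).
  by apply/classE; rewrite sE hE.
- by move=> x; rewrite hE sE.
Qed.

Lemma universal_branched_covering_exists (R : realType) (Y : topologicalType)
    (S : set Y) (y0 : Y) : admissible_space R Y -> connected [set: Y] ->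
  skeletal S -> semi_locally_simply_connected R (set_type (~` S)) ->
  (~` S) y0 -> exists (X : topologicalType) (p : X -> Y),
  is_universal_branched_covering R S p /\ branched_covering R p.
Proof.
move=> aY cY pD slD Dy0; have [_ lY _] := aY; have [oD _ _] := pD.
have gN := simple_nbhs_exists lY oD slD.
have [x0 _] := dpath_point (cst_dpath R Dy0).
exists (branched_space R S y0), (@bproj R Y S y0); split.
  exact: branched_space_universal x0 gN.
exact: bproj_branched_covering x0 gN.
Qed.

Theorem proposition2p26 (R : realType) (Y : topologicalType) (S : set Y)
    (y0 : Y)
    (hY : admissible_space R Y)
    (cY : connected [set: Y])
    (hS : skeletal S)
    (hYS : semi_locally_simply_connected R (set_type (~` S)))
    (hy0 : (~` S) y0) :
  exists phibar : almost_homotopy_space R S y0 -> Y,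
    [/\ forall g : Omega R S y0, phibar (class_of g) = endpoint g,
        branched_covering R phibar,
        exists (X' : topologicalType) (p' : X' -> Y),
          is_universal_branched_covering R S p' /\ isomorphic_over phibar p'
      & forall (X' : topologicalType) (p' : X' -> Y),
          is_universal_branched_covering R S p' -> isomorphic_over phibar p'].
Proof.
have [oD _ _] := hS.
have [X [p [univ_p branched_p]]] :=
  universal_branched_covering_exists hY cY hS hYS hy0.
have [h [[ch [k [ck hK kK]]] hE]] :=
  almost_homotopy_space_homeomorphism hY oD hy0 univ_p.
exists (p \o h); split.
- exact: hE.
- exact: (homeo_branched_covering ch ck hK kK).
- exists X, p; split => //; exists h => //.
  by split => //; exists k.
(* The two projections coincide since both send the class of a path to the end of the path. *)
- move=> X' p' /(almost_homotopy_space_homeomorphism hY oD hy0) [h' [hh' hE']].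
  exists h' => //; apply/funext => c.
  have <- : class_of (class_repr c) = c := class_reprK c.
  by rewrite /= hE hE'.
Qed.
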